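(* Assume that $a,b\in\mathbb{C}$, $c\in\mathbb{C}\setminus\mathbb{Z}_{\leqslant 0}$ and $a-b\in\mathbb{C}\setminus\mathbb{Z}$. Set $\eta=xy$. Then under the condition $$x\to\infty,\quad|\arg(-x)|<\pi,\quad0<\eta_1\leqslant|\eta|\leqslant\eta_2<\infty$$ (with $\eta_1,\eta_2$ fixed), we have the asymptotic expansion $$\Phi_1[a,b;c;x,y]=\frac{\Gamma(c)\Gamma(b-a)}{\Gamma(b)\Gamma(c-a)}(-x)^{-a}\sum_{k=0}^{N-1}b_k^{(1)}(\eta)x^{-k}+\frac{\Gamma(c)\Gamma(a-b)}{\Gamma(a)\Gamma(c-b)}(-x)^{-b}\sum_{k=0}^{N-1}b_k^{(2)}(\eta)x^{-k}+\mathcal{O}\left(|x|^{-\Re(a)-N}+|x|^{-\Re(b)-N}\right),$$ where $N$ is any integer such that $N\geqslant\max\{1,|a|,|b|\}$, and $$b_k^{(1)}(\eta)=\sum_{\substack{m,n\geqslant0\\ m+2n=k}}\frac{(a)_{m+n}(a-c+1)_m}{(a-b+1)_{m+n}\,m!\,n!}\,\eta^n,\qquad b_k^{(2)}(\eta)=\sum_{\substack{m,n\geqslant0\\ m+n=k}}\frac{(b)_m(b-c+1)_{m-n}}{(b-a+1)_{m-n}\,m!\,n!}\,\eta^n.$$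
   Context: $(\alpha)_n=\Gamma(\alpha+n)/\Gamma(\alpha)$, also for negative integers $n$; powers take principal values. When $c-b\in\mathbb{Z}$, the product $\frac{1}{\Gamma(c-b)}(b-c+1)_{j}$ ($j\in\mathbb{Z}$) is understood by continuity as $\frac{(-1)^j}{\Gamma(c-b-j)}$. The Humbert function $\Phi_1$ is defined for $|x|<1$, $y\in\mathbb{C}$ by $$\Phi_1[a,b;c;x,y]=\sum_{m,n=0}^{\infty}\frac{(a)_{m+n}(b)_m}{(c)_{m+n}}\frac{x^m}{m!}\frac{y^n}{n!},$$ and is continued analytically to all $x\in\mathbb{C}\setminus[1,\infty)$, $y\in\mathbb{C}$ by $$\Phi_1[a,b;c;x,y]=\sum_{n=0}^{\infty}\frac{(a)_n}{(c)_n}\,{}_2F_1\left[\begin{matrix}a+n,b\\ c+n\end{matrix};x\right]\frac{y^n}{n!}$$ (principal branch of ${}_2F_1$). *)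

(* Defs.v *)
From Stdlib Require Import Reals ZArith ClassicalEpsilon.
From Coquelicot Require Import Coquelicot.

Open Scope R_scope.
Open Scope C_scope.

(** ** Limits and sums in [C] *)

(* As for Coquelicot's [RInt], these are total functions whose value is
   meaningful when the limit exists. *)
Definition CLim (u : nat -> C) : C :=
  iota (T := C_CompleteNormedModule)
    (fun l => filterlim u eventually (locally (T := C_CompleteNormedModule) l)).

Definition CSeries (u : nat -> C) : C :=
  iota (T := C_CompleteNormedModule)
    (fun l => is_series (V := C_NormedModule) u l).

(* [Csum n u] is [u 0 + ... + u (n - 1)], with [n] terms. *)
Fixpoint Csum (n : nat) (u : nat -> C) : C :=
  match n with
  | O => 0
  | S p => Csum p u + u p
  end.

(** ** Principal values *)

(* The argument of [z <> 0], in (-PI, PI]; [Carg 0] is meaningless. *)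
Definition Carg (z : C) : R :=
  if Rle_dec 0 (Im z) then acos (Re z / Cmod z) else (- acos (Re z / Cmod z))%R.

Definition Clog (z : C) : C := (ln (Cmod z), Carg z).

Definition Cexp (z : C) : C :=
  ((exp (Re z) * cos (Im z))%R, (exp (Re z) * sin (Im z))%R).

Definition Cpower (z w : C) : C := Cexp (w * Clog z).

(** ** Gamma function and Pochhammer symbols *)

Definition Cint (z : C) : Prop := exists k : Z, z = RtoC (IZR k).

Fixpoint pochn (z : C) (n : nat) : C :=
  match n with
  | O => 1
  | S p => pochn z p * (z + RtoC (INR p))
  end.

(* The quotient Gamma (z + j) / Gamma z, with its limiting value where numerator
   and denominator both have a pole: z (z+1) ... (z+j-1) for j >= 0, and
   1 / ((z-1) (z-2) ... (z-|j|)) for j < 0. *)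
Definition poch (z : C) (j : Z) : C :=
  if (0 <=? j)%Z then pochn z (Z.to_nat j)
  else / pochn (z + RtoC (IZR j)) (Z.to_nat (- j)).

(* The entire function 1 / Gamma, by Gauss's product
   lim z (z+1) ... (z+n) / (n! n^z). *)
Definition rGamma (z : C) : C :=
  CLim (fun n => pochn z (S n)
                 / (RtoC (INR (fact n)) * Cpower (RtoC (INR n)) z)).

Definition Gamma (z : C) : C := / rGamma z.

(* The product 1 / Gamma (c - b) * (b - c + 1)_j, understood by continuity when
   c - b is an integer. *)
Definition rGamma_poch (b c : C) (j : Z) : C :=
  if excluded_middle_informative (Cint (c - b))
  then RtoC (powerRZ (-1) j) * rGamma (c - b - RtoC (IZR j))
  else rGamma (c - b) * poch (b - c + 1) j.

(** ** Gauss and Humbert functions *)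

(* The complex plane cut along [1, +oo). *)
Definition cut_plane (x : C) : Prop := ~ (Im x = 0%R /\ (1 <= Re x)%R).

Definition analytic_at (f : C -> C) (z0 : C) : Prop :=
  exists (u : nat -> C) (r : R), (0 < r)%R /\
    forall z : C, (Cmod (z - z0) < r)%R ->
      is_pseries (K := C_AbsRing) (V := C_NormedModule) u (z - z0) (f z).

Definition hyp2F1_coef (a b c : C) (m : nat) : C :=
  pochn a m * pochn b m / (pochn c m * RtoC (INR (fact m))).

Definition is_hyp2F1 (a b c : C) (F : C -> C) : Prop :=
  (forall x : C, cut_plane x -> analytic_at F x) /\
  (forall x : C, (Cmod x < 1)%R ->
     is_pseries (K := C_AbsRing) (V := C_NormedModule)
       (hyp2F1_coef a b c) x (F x)).

(* The principal branch: [is_hyp2F1] determines [F] on the connected open set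
   [cut_plane]; the values on [1, +oo) are unspecified. *)
Definition hyp2F1 (a b c : C) : C -> C :=
  epsilon (inhabits (fun _ : C => RtoC 0)) (is_hyp2F1 a b c).

(* Meaningful for [cut_plane x]. When |x| < 1, inserting the Gauss series gives
   the double series sum_(m,n) (a)_(m+n) (b)_m / (c)_(m+n) x^m/m! y^n/n!. *)
Definition Phi1 (a b c x y : C) : C :=
  CSeries (fun n =>
    pochn a n / pochn c n
    * hyp2F1 (a + RtoC (INR n)) b (c + RtoC (INR n)) x
    * (y ^ n / RtoC (INR (fact n)))).

(** ** Coefficients of the expansion *)

(* Sum over m + 2 n = k, indexed by n with m = k - 2 n. *)
Definition b1 (a b c : C) (k : nat) (eta : C) : C :=
  Csum (S (Nat.div2 k)) (fun n =>
    let m := (k - 2 * n)%nat in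
    pochn a (m + n) * pochn (a - c + 1) m
    / (pochn (a - b + 1) (m + n)
       * RtoC (INR (fact m)) * RtoC (INR (fact n)))
    * eta ^ n).

(* 1 / Gamma (c - b) times the coefficient
     sum_(m + n = k) (b)_m (b-c+1)_(m-n) / ((b-a+1)_(m-n) m! n!) eta^n.
   The two factors are kept together because only their product is defined when
   c - b is an integer. The sum is indexed by n with m = k - n. *)
Definition rGamma_b2 (a b c : C) (k : nat) (eta : C) : C :=
  Csum (S k) (fun n =>
    let m := (k - n)%nat in
    let j := (Z.of_nat m - Z.of_nat n)%Z in
    pochn b m * rGamma_poch b c j
    / (poch (b - a + 1) j
       * RtoC (INR (fact m)) * RtoC (INR (fact n)))
    * eta ^ n).

(* Main.v *)
Require Import Defs.
From Stdlib Require Import Reals ZArith Lra Lia ClassicalEpsilon.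
From Coquelicot Require Import Coquelicot.
Open Scope R_scope.
Open Scope C_scope.

(** The expansion is the truncation of a convergent one. At infinity,
    2F1(a+n,b;c+n;x) / Gamma(c+n) is a combination of (-x)^(-a-n) and (-x)^(-b), each
    multiplied by a power series in 1/x ([hyp2F1_expansion]). Inserting this in the series
    for Phi1 and writing y = eta / x, the Gamma quotients lose their dependence on n, and
    one obtains double series in x^(-m-2n) and x^(-m-n) whose coefficients are those of
    b^(1) and b^(2) ([Phi1_term_expansion]). These coefficients grow at most geometrically,
    uniformly for bounded eta ([coef1_bound], [coef2_bound]), so for large |x| the terms
    of weight at least N sum to O(|x|^(-N)) ([double_series_remainder]). The powers
    (-x)^(-a) and (-x)^(-b) are O(|x|^(-Re a)) and O(|x|^(-Re b)) because arg(-x) is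
    bounded.

    The connection formula is proved without contour integrals. For large Re a and
    Re (c - a) the Gauss function is Euler's integral of
    t^(a-1) (1-t)^(c-a-1) (1 - x t)^(-b), which the binomial series makes analytic on the
    cut plane ([euler_int_taylor]). Expanding (1-t)^(c-a-1) in powers of t reduces it to
    the integrals I(s,b;x) of t^(s-1) (1 - x t)^(-b) over [0, 1]. In the coordinate
    x = - e^w these satisfy a first-order equation, whence
    e^(sw) I(s,s+r;-e^w) + e^(-rw) I(r,s+r;-e^(-w)) is constant on the strip |Im w| < PI.
    Its value at w = 0 is a Beta integral folded at 1/2, and the second integral is a
    power series in 1/x ([ibeta_reflection], [ibeta_connection]). Contiguous relations,
    respected by the expansions term by term, then give all parameters
    ([continued_all]), and the identity theorem on the star-shaped cut plane identifies
    the function so obtained with the principal branch ([is_hyp2F1_unique]).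

    All Gamma factors come from one identity ([beta_series]): for Re p >= 2, the series of
    (1-p)_k / (k! (z+k)) has the sum Gamma(z) Gamma(p) / Gamma(z+p). It is the limit of
    the partial fraction decomposition of (z+p)_n / (z)_(n+1), whose two sides are governed
    by Gauss's product; the convergence of that product is [gauss_cv]. *)

(** * Exponential and principal logarithm *)

Lemma C_ext (z w : C) : Re z = Re w -> Im z = Im w -> z = w.
Proof. destruct z, w; simpl; intros -> ->; reflexivity. Qed.

Lemma Im_le_Cmod (z : C) : Rabs (Im z) <= Cmod z.
Proof.
  apply Rle_trans with (2 := Rmax_Cmod z). apply Rmax_r.
Qed.

Lemma Cmod_le_abs_add (z : C) : Cmod z <= Rabs (Re z) + Rabs (Im z).
Proof.
  destruct z as [x y]; simpl.
  replace (x, y) with (RtoC x + RtoC y * Ci)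
    by (apply C_ext; simpl; ring).
  eapply Rle_trans. apply Cmod_triangle.
  rewrite Cmod_mult, !Cmod_R, Cmod_Ci. lra.
Qed.

Lemma Cexp_add (z w : C) : Cexp (z + w) = Cexp z * Cexp w.
Proof.
  destruct z, w; apply C_ext; unfold Cexp; simpl;
    rewrite exp_plus, ?cos_plus, ?sin_plus; ring.
Qed.

Lemma Cexp_0 : Cexp 0 = 1.
Proof. apply C_ext; unfold Cexp; simpl; rewrite exp_0, ?cos_0, ?sin_0; ring. Qed.

Lemma Cmod_Cexp (z : C) : Cmod (Cexp z) = exp (Re z).
Proof.
  unfold Cexp, Cmod; simpl.
  match goal with |- sqrt ?e = _ =>
    replace e with (exp (Re z) * exp (Re z) * (Rsqr (sin (Im z)) + Rsqr (cos (Im z))))%R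
      by (unfold Rsqr; ring) end.
  rewrite sin2_cos2, Rmult_1_r. apply sqrt_square. left; apply exp_pos.
Qed.

Lemma Cexp_neq_0 (z : C) : Cexp z <> 0.
Proof. apply Cmod_gt_0. rewrite Cmod_Cexp. apply exp_pos. Qed.

Lemma Cexp_opp (z : C) : Cexp (- z) = / Cexp z.
Proof.
  assert (H : Cexp (- z) * Cexp z = 1).
  { rewrite <- Cexp_add. replace (- z + z) with (RtoC 0) by ring. apply Cexp_0. }
  rewrite <- (Cmult_1_r (Cexp (- z))), <- (Cinv_r (Cexp z)) by apply Cexp_neq_0.
  rewrite Cmult_assoc, H. ring.
Qed.

Lemma Cexp_nat (n : nat) (z : C) : Cexp (RtoC (INR n) * z) = Cexp z ^ n.
Proof.
  induction n as [|n IH].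
  - simpl. rewrite Cmult_0_l. apply Cexp_0.
  - rewrite S_INR, RtoC_plus, Cpow_S, <- IH, <- Cexp_add. f_equal; ring.
Qed.

Lemma exp_taylor1 (x : R) : (Rabs x <= 1 / 2 -> Rabs (exp x - 1 - x) <= 2 * x ^ 2).
Proof.
  intros H. apply Rabs_le_between in H.
  assert (H1 := exp_ineq1_le x). assert (H2 := exp_ineq1_le (- x)).
  assert (H3 : (exp x * exp (- x) = 1)%R)
    by (rewrite <- exp_plus, Rplus_opp_r; apply exp_0).
  assert (H4 := exp_pos x). assert (H5 := exp_pos (- x)).
  rewrite Rabs_pos_eq by lra.
  assert (H6 : exp x * (1 - x) <= 1) by nra.
  assert (H7 : exp x <= 2) by nra.
  nra.
Qed.

Lemma abs_sin_le (y : R) : Rabs (sin y) <= Rabs y.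
Proof.
  assert (P : forall y, (0 <= y -> Rabs (sin y) <= y)).
  { clear. intros y Hy. destruct (Rle_dec y 1) as [H|H].
    - assert (HP := PI2_3_2). assert (0 <= sin y) by (apply sin_ge_0; lra).
      rewrite Rabs_pos_eq by assumption.
      destruct Hy as [Hy|<-]; [left; now apply sin_lt_x | rewrite sin_0; lra].
    - assert (B := SIN_bound y). apply Rabs_le. lra. }
  destruct (Rle_dec 0 y) as [H|H].
  - rewrite (Rabs_pos_eq y) by lra. now apply P.
  - rewrite (Rabs_left y) by lra. rewrite <- Rabs_Ropp, <- sin_neg. apply P; lra.
Qed.

Lemma one_sub_cos (y : R) : 0 <= 1 - cos y <= y ^ 2 / 2.
Proof.
  replace y with (2 * (y / 2))%R at 1 2 by field.
  rewrite cos_2a_sin.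
  assert (H := abs_sin_le (y / 2)).
  apply Rsqr_le_abs_1 in H. unfold Rsqr in H. nra.
Qed.

Lemma sin_taylor1 (y : R) : (Rabs y <= 1 -> Rabs (sin y - y) <= y ^ 2).
Proof.
  intros H.
  destruct (MVT_gen (fun t => sin t - t)%R 0 y (fun t => cos t - 1)%R) as (c & Hc & E).
  - intros; auto_derive; [trivial | ring].
  - intros; apply continuity_pt_minus;
      [apply continuity_sin | apply derivable_continuous_pt, derivable_pt_id].
  - rewrite sin_0 in E. replace (sin y - y)%R with ((cos c - 1) * y)%R by lra.
    rewrite Rabs_mult.
    assert (Hc' : Rabs c <= Rabs y).
    { unfold Rmin, Rmax in Hc. unfold Rabs.
      destruct (Rle_dec 0 y), (Rcase_abs c), (Rcase_abs y); lra. }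
    assert (B := one_sub_cos c). rewrite (Rabs_left1 (cos c - 1)) by lra.
    rewrite <- (pow2_abs c) in B. rewrite <- (pow2_abs y).
    assert (Hc0 := Rabs_pos c).
    assert (Rabs c ^ 2 <= Rabs y) by nra.
    assert (Hy0 := Rabs_pos y). nra.
Qed.

Lemma Cexp_taylor1 (z : C) :
  (Cmod z <= 1 / 2 -> Cmod (Cexp z - 1 - z) <= 8 * Cmod z ^ 2).
Proof.
  intros H.
  assert (Hx := re_le_Cmod z). assert (Hy := Im_le_Cmod z).
  destruct z as [x y]; simpl in Hx, Hy. set (r := Cmod (x, y)) in *.
  assert (E1 := exp_taylor1 x ltac:(lra)).
  assert (E2 := one_sub_cos y). assert (E3 := sin_taylor1 y ltac:(lra)).
  rewrite <- (pow2_abs x) in E1. rewrite <- (pow2_abs y) in E2, E3.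
  assert (Hx0 := Rabs_pos x). assert (Hy0 := Rabs_pos y).
  assert (X2 : Rabs x ^ 2 <= r ^ 2) by nra.
  assert (Y2 : Rabs y ^ 2 <= r ^ 2) by nra.
  assert (XY : Rabs x * Rabs y <= r ^ 2) by nra.
  assert (Ee : Rabs (exp x - 1) <= 2 * Rabs x).
  { replace (exp x - 1)%R with ((exp x - 1 - x) + x)%R by ring.
    eapply Rle_trans. apply Rabs_triang. nra. }
  assert (Ee' : Rabs (exp x) <= 2).
  { replace (exp x)%R with ((exp x - 1) + 1)%R by ring.
    eapply Rle_trans. apply Rabs_triang. rewrite Rabs_R1. nra. }
  eapply Rle_trans. apply Cmod_le_abs_add. unfold Cexp; simpl.
  replace (exp x * cos y + - (1) + - x)%R
    with ((exp x - 1 - x) + exp x * - (1 - cos y))%R by ring.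
  replace (exp x * sin y + - 0 + - y)%R
    with ((sin y - y) + (exp x - 1) * sin y)%R by ring.
  assert (A1 := Rabs_triang (exp x - 1 - x) (exp x * - (1 - cos y))).
  assert (A2 := Rabs_triang (sin y - y) ((exp x - 1) * sin y)).
  rewrite Rabs_mult, Rabs_Ropp, (Rabs_pos_eq (1 - cos y)) in A1 by lra.
  rewrite Rabs_mult in A2.
  assert (B2 := abs_sin_le y).
  assert (B1 : Rabs (exp x) * (1 - cos y) <= r ^ 2).
  { apply Rle_trans with (2 * (Rabs y ^ 2 / 2))%R; [|lra].
    apply Rmult_le_compat; [apply Rabs_pos| lra | lra | lra]. }
  assert (B3 : Rabs (exp x - 1) * Rabs (sin y) <= 2 * r ^ 2).
  { apply Rle_trans with (2 * Rabs x * Rabs y)%R; [|lra].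
    apply Rmult_le_compat; [apply Rabs_pos| apply Rabs_pos | lra | lra]. }
  change (r * (r * 1))%R with (r ^ 2)%R. lra.
Qed.

(** The plane cut along (-oo, 0], where the principal logarithm is analytic. *)
Definition slit (z : C) : Prop := (0 < Re z) \/ Im z <> 0%R.

Lemma slit_neq_0 (z : C) : slit z -> z <> 0.
Proof. intros [H|H] ->; simpl in H; lra. Qed.

Lemma Re_Cmod_bound (z : C) : z <> 0 -> -1 <= Re z / Cmod z <= 1.
Proof.
  intros H. apply Cmod_gt_0 in H. assert (R := re_le_Cmod z).
  apply Rabs_le_between in R.
  split; [apply Rle_div_r | apply Rle_div_l]; lra.
Qed.

Lemma Carg_bound (z : C) : z <> 0 -> - PI <= Carg z <= PI.
Proof.
  intros H. unfold Carg. assert (B := acos_bound (Re z / Cmod z)).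
  destruct (Rle_dec 0 (Im z)); lra.
Qed.

Lemma Carg_nonneg (z : C) : (0 <= Im z -> 0 <= Carg z).
Proof.
  intros H. unfold Carg. assert (B := acos_bound (Re z / Cmod z)).
  destruct (Rle_dec 0 (Im z)); lra.
Qed.

Lemma Carg_nonpos (z : C) : (Im z < 0 -> Carg z <= 0).
Proof.
  intros H. unfold Carg. assert (B := acos_bound (Re z / Cmod z)).
  destruct (Rle_dec 0 (Im z)); lra.
Qed.

Lemma Cexp_Clog (z : C) : z <> 0 -> Cexp (Clog z) = z.
Proof.
  intros Hz. assert (B := Re_Cmod_bound z Hz). apply Cmod_gt_0 in Hz.
  assert (S : sqrt (1 - (Re z / Cmod z)²) = (Rabs (Im z) / Cmod z)%R).
  { rewrite <- (sqrt_Rsqr (Rabs (Im z) / Cmod z)).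
    - f_equal. assert (E := Cmod2_alt z). assert (A := pow2_abs (Im z)).
      unfold Rsqr. field_simplify; [|lra|lra]. rewrite E, A. f_equal. ring.
    - apply Rle_div_r; [lra|]. rewrite Rmult_0_l. apply Rabs_pos. }
  apply C_ext; unfold Cexp, Clog, Carg; simpl; rewrite exp_ln by assumption;
    destruct (Rle_dec 0 (Im z)) as [H|H].
  - rewrite cos_acos by assumption. field; lra.
  - rewrite cos_neg, cos_acos by assumption. field; lra.
  - rewrite sin_acos, S by assumption. rewrite Rabs_pos_eq by lra. field; lra.
  - rewrite sin_neg, sin_acos, S by assumption. rewrite Rabs_left by lra. field; lra.
Qed.

Lemma Clog_Cexp (w : C) : - PI < Im w <= PI -> Clog (Cexp w) = w.
Proof.
  intros H. assert (E := exp_pos (Re w)).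
  unfold Clog. rewrite Cmod_Cexp, ln_exp. apply C_ext; simpl; [reflexivity|].
  unfold Carg. rewrite Cmod_Cexp. unfold Cexp; simpl.
  replace (exp (Re w) * cos (Im w) / exp (Re w))%R with (cos (Im w)) by (field; lra).
  destruct (Rle_dec 0 (Im w)) as [P|P].
  - assert (Q : 0 <= sin (Im w)) by (apply sin_ge_0; lra).
    destruct (Rle_dec 0 (exp (Re w) * sin (Im w))) as [_|N]; [|nra].
    apply acos_cos; lra.
  - assert (Q : sin (Im w) < 0) by (apply sin_lt_0_var; lra).
    destruct (Rle_dec 0 (exp (Re w) * sin (Im w))) as [N|_]; [nra|].
    rewrite <- cos_neg, acos_cos; lra.
Qed.

(** Half-angle form, without the case distinction of [Carg]: it shows that the argument
    is continuous, and that it stays inside (-PI, PI). *)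
Lemma Carg_atan (z : C) :
  slit z -> Carg z = (2 * atan (Im z / (Cmod z + Re z)))%R.
Proof.
  intros Hz. assert (H0 := slit_neq_0 z Hz). apply Cmod_gt_0 in H0.
  assert (E := Cmod2_alt z).
  assert (P : 0 < Cmod z + Re z).
  { destruct Hz as [Hz|Hz]; [lra|].
    assert (0 < Im z ^ 2) by (apply pow2_gt_0; assumption). nra. }
  set (t := (Im z / (Cmod z + Re z))%R).
  assert (B := atan_bound t).
  assert (C1 : (cos (2 * atan t) = Re z / Cmod z)%R).
  { rewrite cos_2a. rewrite cos_atan, sin_atan.
    assert (Q : 0 < 1 + t²) by (unfold Rsqr; nra).
    assert (Q' := sqrt_lt_R0 _ Q). assert (S := sqrt_sqrt _ (Rlt_le _ _ Q)).
    replace (1 / sqrt (1 + t²) * (1 / sqrt (1 + t²)) -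
       t / sqrt (1 + t²) * (t / sqrt (1 + t²)))%R
      with ((1 - t * t) / (sqrt (1 + t²) * sqrt (1 + t²)))%R by (field; lra).
    rewrite S. unfold Rsqr, t.
    assert (E2 : (Im z ^ 2 = (Cmod z - Re z) * (Cmod z + Re z))%R) by lra.
    replace (1 - Im z / (Cmod z + Re z) * (Im z / (Cmod z + Re z)))%R
      with (1 - Im z ^ 2 / (Cmod z + Re z) ^ 2)%R by (field; lra).
    replace (1 + Im z / (Cmod z + Re z) * (Im z / (Cmod z + Re z)))%R
      with (1 + Im z ^ 2 / (Cmod z + Re z) ^ 2)%R by (field; lra).
    rewrite E2. field. lra. }
  assert (S1 : (sin (2 * atan t) = Im z / Cmod z)%R).
  { rewrite sin_2a. rewrite cos_atan, sin_atan.
    assert (Q : 0 < 1 + t²) by (unfold Rsqr; nra).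
    assert (Q' := sqrt_lt_R0 _ Q). assert (S := sqrt_sqrt _ (Rlt_le _ _ Q)).
    replace (2 * (t / sqrt (1 + t²)) * (1 / sqrt (1 + t²)))%R
      with (2 * t / (sqrt (1 + t²) * sqrt (1 + t²)))%R by (field; lra).
    rewrite S. unfold Rsqr, t.
    assert (E2 : (Im z ^ 2 = (Cmod z - Re z) * (Cmod z + Re z))%R) by lra.
    replace (1 + Im z / (Cmod z + Re z) * (Im z / (Cmod z + Re z)))%R
      with (1 + Im z ^ 2 / (Cmod z + Re z) ^ 2)%R by (field; lra).
    rewrite E2. field. lra. }
  assert (K : Clog (Cexp (ln (Cmod z), (2 * atan t)%R)) = (ln (Cmod z), (2 * atan t)%R))
    by (apply Clog_Cexp; simpl; lra).
  replace (Cexp (ln (Cmod z), (2 * atan t)%R)) with z in K.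
  - exact (f_equal Im K).
  - symmetry. apply C_ext; unfold Cexp; simpl; rewrite exp_ln by assumption;
      [rewrite C1 | rewrite S1]; field; lra.
Qed.

Lemma Carg_slit (z : C) : slit z -> - PI < Carg z < PI.
Proof.
  intros H. rewrite Carg_atan by assumption.
  assert (B := atan_bound (Im z / (Cmod z + Re z))). lra.
Qed.

Lemma slit_of_Carg (z : C) : z <> 0 -> Rabs (Carg z) < PI -> slit z.
Proof.
  intros H0 H. unfold slit.
  destruct (Req_dec (Im z) 0) as [E|E]; [left|right; exact E].
  destruct (Rlt_dec 0 (Re z)) as [P|P]; [exact P|exfalso].
  assert (E2 := Cmod2_alt z). rewrite E in E2.
  assert (M := Cmod_ge_0 z). apply Cmod_gt_0 in H0.
  assert (Cm : Cmod z = (- Re z)%R) by nra.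
  revert H. unfold Carg. rewrite E. destruct (Rle_dec 0 0); [|lra].
  rewrite Cm. replace (Re z / - Re z)%R with (-1)%R by (field; lra).
  replace (-1)%R with (- (1))%R by ring.
  rewrite acos_opp, acos_1, Rminus_0_r, Rabs_pos_eq; [lra|].
  left; apply PI_RGT_0.
Qed.

Lemma Clog_unique (z w : C) : - PI < Im w <= PI -> Cexp w = z -> Clog z = w.
Proof. intros H <-. now apply Clog_Cexp. Qed.

Lemma Cpower_neq_0 (z w : C) : Cpower z w <> 0.
Proof. apply Cexp_neq_0. Qed.

Lemma Cpower_add (z u v : C) : Cpower z (u + v) = Cpower z u * Cpower z v.
Proof. unfold Cpower. rewrite <- Cexp_add. f_equal; ring. Qed.

Lemma Cpower_opp (z w : C) : Cpower z (- w) = / Cpower z w.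
Proof. unfold Cpower. rewrite <- Cexp_opp. f_equal; ring. Qed.

Lemma Cpower_nat (z : C) (n : nat) : z <> 0 -> Cpower z (RtoC (INR n)) = z ^ n.
Proof. intros H. unfold Cpower. rewrite Cexp_nat, Cexp_Clog by assumption. reflexivity. Qed.

Lemma Cpower_1 (z : C) : z <> 0 -> Cpower z 1 = z.
Proof. intros H. rewrite <- (Cpow_1_r z) at 2. apply (Cpower_nat z 1 H). Qed.

Lemma Cpower_sub_nat (z w : C) (n : nat) :
  z <> 0 -> Cpower z (w - INR n) = Cpower z w / z ^ n.
Proof.
  intros H. unfold Cminus. now rewrite Cpower_add, Cpower_opp, Cpower_nat by exact H.
Qed.

(** * Sequences and series of complex numbers *)

Definition is_Clim (u : nat -> C) (l : C) : Prop :=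
  is_lim_seq (fun n => Cmod (u n - l)) 0%R.

Definition is_Cseries (u : nat -> C) (l : C) : Prop :=
  is_Clim (fun n => Csum n u) l.

Lemma is_Clim_squeeze (u : nat -> C) (l : C) (v : nat -> R) :
  eventually (fun n => Cmod (u n - l) <= v n) -> is_lim_seq v 0%R -> is_Clim u l.
Proof.
  intros H Hv. unfold is_Clim.
  apply is_lim_seq_le_le_loc with (fun _ => 0%R) v; auto using is_lim_seq_const.
  destruct H as [N H]. exists N. intros n Hn. split; [apply Cmod_ge_0 | auto].
Qed.

Lemma is_Clim_ext_loc (u v : nat -> C) (l : C) :
  eventually (fun n => u n = v n) -> is_Clim u l -> is_Clim v l.
Proof.
  intros [N H]. apply is_lim_seq_ext_loc. exists N. intros n Hn. now rewrite H.
Qed.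

Lemma is_Clim_ext (u v : nat -> C) (l : C) :
  (forall n, u n = v n) -> is_Clim u l -> is_Clim v l.
Proof. intros H. apply is_Clim_ext_loc. now exists O. Qed.

Lemma is_Clim_eq (u : nat -> C) (l m : C) : l = m -> is_Clim u l -> is_Clim u m.
Proof. now intros ->. Qed.

Lemma is_Clim_const (l : C) : is_Clim (fun _ => l) l.
Proof.
  apply is_lim_seq_ext with (fun _ => 0%R); [|apply is_lim_seq_const].
  intros _. replace (l - l) with (RtoC 0) by ring. now rewrite Cmod_0.
Qed.

Lemma is_Clim_eps (u : nat -> C) (l : C) :
  is_Clim u l <->
  forall e : R, 0 < e -> eventually (fun n => Cmod (u n - l) < e).
Proof.
  unfold is_Clim. rewrite <- is_lim_seq_spec. simpl. split; intros H e.
  - intros He. destruct (H (mkposreal e He)) as [N HN]. exists N. intros n Hn.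
    specialize (HN n Hn). simpl in HN.
    rewrite Rminus_0_r, Rabs_pos_eq in HN by apply Cmod_ge_0. exact HN.
  - destruct (H e (cond_pos e)) as [N HN]. exists N. intros n Hn.
    rewrite Rminus_0_r, Rabs_pos_eq by apply Cmod_ge_0. now apply HN.
Qed.

Lemma is_Clim_plus (u v : nat -> C) (l m : C) :
  is_Clim u l -> is_Clim v m -> is_Clim (fun n => u n + v n) (l + m).
Proof.
  intros Hu Hv.
  apply is_Clim_squeeze with (fun n => Cmod (u n - l) + Cmod (v n - m))%R.
  - exists O. intros n _. replace (u n + v n - (l + m)) with ((u n - l) + (v n - m)) by ring.
    apply Cmod_triangle.
  - replace 0%R with (0 + 0)%R by ring. now apply is_lim_seq_plus'.
Qed.

Lemma is_Clim_mult (u v : nat -> C) (l m : C) :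
  is_Clim u l -> is_Clim v m -> is_Clim (fun n => u n * v n) (l * m).
Proof.
  intros Hu Hv.
  apply is_Clim_squeeze with
    (fun n => Cmod (u n - l) * Cmod (v n - m)
              + (Cmod l * Cmod (v n - m) + Cmod m * Cmod (u n - l)))%R.
  - exists O. intros n _.
    replace (u n * v n - l * m)
      with ((u n - l) * (v n - m) + (l * (v n - m) + m * (u n - l))) by ring.
    eapply Rle_trans. apply Cmod_triangle. rewrite Cmod_mult.
    apply Rplus_le_compat_l.
    eapply Rle_trans. apply Cmod_triangle. rewrite !Cmod_mult. apply Rle_refl.
  - replace 0%R with (0 * 0 + (Cmod l * 0 + Cmod m * 0))%R by ring.
    apply is_lim_seq_plus'; [now apply is_lim_seq_mult'|].
    apply is_lim_seq_plus'; apply is_lim_seq_mult'; auto using is_lim_seq_const.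
Qed.

Lemma is_Clim_scal (c : C) (u : nat -> C) (l : C) :
  is_Clim u l -> is_Clim (fun n => c * u n) (c * l).
Proof. apply is_Clim_mult, is_Clim_const. Qed.

Lemma is_Clim_minus (u v : nat -> C) (l m : C) :
  is_Clim u l -> is_Clim v m -> is_Clim (fun n => u n - v n) (l - m).
Proof.
  intros Hu Hv.
  apply is_Clim_ext with (fun n => u n + -1 * v n); [intros; ring|].
  replace (l - m) with (l + -1 * m) by ring. auto using is_Clim_plus, is_Clim_scal.
Qed.

Lemma is_Clim_Cmod (u : nat -> C) (l : C) :
  is_Clim u l -> is_lim_seq (fun n => Cmod (u n)) (Cmod l).
Proof.
  intros H.
  apply is_lim_seq_ext with (fun n => Cmod l + (Cmod (u n) - Cmod l))%R; [intros; ring|].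
  replace (Finite (Cmod l)) with (Finite (Cmod l + 0)%R) by (f_equal; ring).
  apply is_lim_seq_plus'; [apply is_lim_seq_const|].
  apply is_lim_seq_abs_0.
  apply is_lim_seq_le_le with (fun _ => 0%R) (fun n => Cmod (u n - l));
    auto using is_lim_seq_const.
  intros n. split; [apply Rabs_pos|]. apply Rabs_le.
  assert (A := Cmod_triangle (u n - l) l). assert (B := Cmod_triangle (l - u n) (u n)).
  replace (u n - l + l) with (u n) in A by ring.
  replace (l - u n + u n) with l in B by ring.
  replace (l - u n) with (- (u n - l)) in B by ring. rewrite Cmod_opp in B. lra.
Qed.

Lemma is_Clim_inv (u : nat -> C) (l : C) :
  l <> 0 -> is_Clim u l -> is_Clim (fun n => / u n) (/ l).
Proof.
  intros Hl Hu. apply Cmod_gt_0 in Hl.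
  apply is_Clim_squeeze with (fun n => 2 / (Cmod l * Cmod l) * Cmod (u n - l))%R.
  - destruct (proj1 (is_Clim_eps u l) Hu (Cmod l / 2)%R ltac:(lra)) as [N HN].
    exists N. intros n Hn. specialize (HN n Hn).
    assert (T := Cmod_triangle (u n) (l - u n)).
    replace (u n + (l - u n)) with l in T by ring.
    replace (l - u n) with (- (u n - l)) in T by ring. rewrite Cmod_opp in T.
    assert (P : Cmod l / 2 <= Cmod (u n)) by lra.
    assert (Un : u n <> 0) by (apply Cmod_gt_0; lra).
    assert (Ul : l <> 0) by (apply Cmod_gt_0; lra).
    replace (/ u n - / l) with (- (u n - l) * / (u n * l)) by (field; auto).
    rewrite Cmod_mult, Cmod_opp, Cmod_inv, Cmod_mult by now apply Cmult_neq_0.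
    rewrite Rmult_comm. apply Rmult_le_compat_r; [apply Cmod_ge_0|].
    replace (2 / (Cmod l * Cmod l))%R with (/ (Cmod l / 2 * Cmod l))%R by (field; lra).
    apply Rinv_le_contravar; nra.
  - replace 0%R with (2 / (Cmod l * Cmod l) * 0)%R by ring.
    apply is_lim_seq_mult'; auto using is_lim_seq_const.
Qed.

Lemma is_Clim_unique (u : nat -> C) (l m : C) : is_Clim u l -> is_Clim u m -> l = m.
Proof.
  intros Hl Hm. assert (H := is_Clim_Cmod _ _ (is_Clim_minus _ _ _ _ Hl Hm)).
  apply is_lim_seq_ext with (v := fun _ => 0%R) in H.
  2:{ intros n. replace (u n - u n) with (RtoC 0) by ring. apply Cmod_0. }
  apply is_lim_seq_unique in H. rewrite Lim_seq_const in H. injection H as H.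
  symmetry in H. apply Cmod_eq_0 in H.
  replace l with ((l - m) + m) by ring. rewrite H. ring.
Qed.

Lemma is_Clim_bound (u : nat -> C) (l : C) (B : R) :
  eventually (fun n => Cmod (u n) <= B) -> is_Clim u l -> Cmod l <= B.
Proof.
  intros H Hu. apply is_Clim_Cmod in Hu.
  apply (is_lim_seq_le_loc (fun n => Cmod (u n)) (fun _ => B) (Cmod l) B); auto.
  apply is_lim_seq_const.
Qed.

Lemma is_Clim_incr (u : nat -> C) (l : C) (k : nat) :
  is_Clim u l <-> is_Clim (fun n => u (n + k)%nat) l.
Proof. apply (is_lim_seq_incr_n (fun n => Cmod (u n - l)) k). Qed.

Lemma filterlim_Clim (u : nat -> C) (l : C) :
  filterlim u eventually (locally (T := C_UniformSpace) l) <-> is_Clim u l.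
Proof.
  rewrite is_Clim_eps, filterlim_locally. split; intros H e.
  - intros He.
    assert (He2 : 0 < e / 2) by lra.
    destruct (H (mkposreal _ He2)) as [N HN]. exists N. intros n Hn.
    destruct (HN n Hn) as [H1 H2]. simpl in H1, H2.
    change (Rabs (Re (u n) - Re l) < e / 2) in H1.
    change (Rabs (Im (u n) - Im l) < e / 2) in H2.
    eapply Rle_lt_trans. apply Cmod_le_abs_add.
    unfold Cminus, Cplus, Copp; simpl. unfold Rminus in *. unfold Re, Im in *. lra.
  - destruct (H e (cond_pos e)) as [N HN]. exists N. intros n Hn.
    specialize (HN n Hn). split.
    + apply Rle_lt_trans with (2 := HN), (re_le_Cmod (u n - l)).
    + apply Rle_lt_trans with (2 := HN), (Im_le_Cmod (u n - l)).
Qed.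

Lemma CLim_unique (u : nat -> C) (l : C) : is_Clim u l -> CLim u = l.
Proof.
  intros H. unfold CLim. apply (iota_unique (V := C_CompleteNormedModule)).
  - intros m Hm. apply (is_Clim_unique u); [apply filterlim_Clim; exact Hm | exact H].
  - apply filterlim_Clim in H. exact H.
Qed.

Lemma sum_n_Csum (u : nat -> C) (n : nat) :
  sum_n (G := C_AbelianMonoid) u n = Csum (S n) u.
Proof.
  induction n as [|n IH].
  - rewrite sum_O. simpl. ring.
  - rewrite sum_Sn, IH. reflexivity.
Qed.

Lemma is_series_Cseries (u : nat -> C) (l : C) :
  is_series (V := C_NormedModule) u l <-> is_Cseries u l.
Proof.
  unfold is_Cseries. rewrite (is_Clim_incr _ _ 1).
  rewrite <- filterlim_Clim. unfold is_series.
  split; apply filterlim_ext; intros n; rewrite Nat.add_1_r;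
    [|symmetry]; apply sum_n_Csum.
Qed.

Lemma CSeries_unique (u : nat -> C) (l : C) : is_Cseries u l -> CSeries u = l.
Proof.
  intros H. unfold CSeries. apply (iota_unique (V := C_CompleteNormedModule)).
  - intros m Hm. apply (is_Clim_unique (fun n => Csum n u)); [|exact H].
    apply is_series_Cseries, Hm.
  - apply is_series_Cseries, H.
Qed.

(** * Finite sums *)

Lemma Csum_ext (n : nat) (u v : nat -> C) :
  (forall k, (k < n)%nat -> u k = v k) -> Csum n u = Csum n v.
Proof.
  induction n as [|n IH]; intros H; simpl; [reflexivity|].
  rewrite IH, (H n) by auto with arith. reflexivity.
Qed.

Lemma Csum_plus (n : nat) (u v : nat -> C) :
  Csum n (fun k => u k + v k) = Csum n u + Csum n v.
Proof. induction n as [|n IH]; simpl; [ring|]. rewrite IH. ring. Qed.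

Lemma Csum_scal (n : nat) (c : C) (u : nat -> C) :
  Csum n (fun k => c * u k) = c * Csum n u.
Proof. induction n as [|n IH]; simpl; [ring|]. rewrite IH. ring. Qed.

Lemma Csum_0 (n : nat) (u : nat -> C) :
  (forall k, (k < n)%nat -> u k = 0) -> Csum n u = 0.
Proof.
  induction n as [|n IH]; intros H; simpl; [reflexivity|].
  rewrite IH, (H n) by auto with arith. ring.
Qed.

Lemma Csum_Sl (n : nat) (u : nat -> C) :
  Csum (S n) u = u O + Csum n (fun k => u (S k)).
Proof.
  induction n as [|n IH]; [simpl; ring|].
  change (Csum (S (S n)) u) with (Csum (S n) u + u (S n)). rewrite IH. simpl. ring.
Qed.

Lemma Csum_exchange (n p : nat) (t : nat -> nat -> C) :
  Csum n (fun i => Csum p (t i)) = Csum p (fun j => Csum n (fun i => t i j)).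
Proof.
  induction n as [|n IH]; simpl.
  - symmetry. now apply Csum_0.
  - rewrite IH, <- Csum_plus. reflexivity.
Qed.

Fixpoint Rsum (n : nat) (g : nat -> R) : R :=
  match n with O => 0%R | S p => (Rsum p g + g p)%R end.

Lemma Csum_bound (n : nat) (u : nat -> C) (g : nat -> R) :
  (forall k, (k < n)%nat -> Cmod (u k) <= g k) -> Cmod (Csum n u) <= Rsum n g.
Proof.
  induction n as [|n IH]; intros H; simpl.
  - rewrite Cmod_0. lra.
  - eapply Rle_trans. apply Cmod_triangle.
    apply Rplus_le_compat; [apply IH; auto with arith | apply H; auto].
Qed.

(** * Absolute convergence *)

(** Phrased through partial sums, so that a dominating series is used by an upper bound
    for its sum alone. *)
Definition summable (g : nat -> R) (G : R) : Prop :=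
  (forall n, 0 <= g n) /\ (forall n, (Rsum n g <= G)).

Lemma Rsum_incr (g : nat -> R) (n m : nat) :
  (forall k, 0 <= g k) -> (n <= m)%nat -> Rsum n g <= Rsum m g.
Proof.
  intros Hg. induction 1; [lra|]. simpl. specialize (Hg m). lra.
Qed.

Lemma Rsum_ext_le (g h : nat -> R) (n : nat) :
  (forall k, (k < n)%nat -> g k <= h k) -> Rsum n g <= Rsum n h.
Proof.
  induction n as [|n IH]; intros H; simpl; [lra|].
  assert (A := IH (fun k Hk => H k ltac:(lia))). assert (B := H n ltac:(lia)). lra.
Qed.

Lemma Rsum_scal (g : nat -> R) (c : R) (n : nat) :
  Rsum n (fun k => c * g k)%R = (c * Rsum n g)%R.
Proof. induction n as [|n IH]; simpl; [ring|]. rewrite IH; ring. Qed.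

Lemma summable_nonneg (g : nat -> R) (G : R) : summable g G -> 0 <= G.
Proof. intros [_ H]. exact (H O). Qed.

Lemma summable_scal (g : nat -> R) (G c : R) :
  (0 <= c) -> summable g G -> summable (fun n => c * g n)%R (c * G).
Proof.
  intros Hc [H1 H2]. split; intros n.
  - now apply Rmult_le_pos.
  - rewrite Rsum_scal. now apply Rmult_le_compat_l.
Qed.

Lemma summable_le (g h : nat -> R) (G : R) :
  (forall n, 0 <= h n <= g n) -> summable g G -> summable h G.
Proof.
  intros H [H1 H2]. split; [apply H|]. intros n.
  apply Rle_trans with (2 := H2 n), Rsum_ext_le. intros; apply H.
Qed.

Lemma summable_geom (q : R) : 0 <= q < 1 -> summable (fun n => q ^ n)%R (/ (1 - q)).
Proof.
  intros Hq. split; intros n; [apply pow_le; lra|].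
  assert (E : (Rsum n (fun n => q ^ n) * (1 - q) = 1 - q ^ n)%R).
  { induction n as [|n IH]; simpl; [ring|]. rewrite Rmult_plus_distr_r, IH. ring. }
  assert (P := pow_le q n ltac:(lra)).
  apply Rmult_le_reg_r with (1 - q)%R; [lra|]. rewrite E, Rinv_l; lra.
Qed.

Lemma summable_cv (g : nat -> R) (G : R) :
  summable g G -> exists L : R, is_lim_seq (fun n => Rsum n g) L /\ L <= G /\
    forall n, Rsum n g <= L.
Proof.
  intros [H1 H2].
  destruct (ex_finite_lim_seq_incr (fun n => Rsum n g) G) as [L HL].
  - intros n. apply Rsum_incr; auto.
  - exact H2.
  - exists L. split; [exact HL|]. split.
    + apply (is_lim_seq_le (fun n => Rsum n g) (fun _ => G) L G); auto.
      apply is_lim_seq_const.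
    + apply is_lim_seq_incr_compare; [exact HL|]. intros n; apply Rsum_incr; auto.
Qed.

Lemma Csum_diff_bound (u : nat -> C) (g : nat -> R) (n m : nat) :
  (forall k, Cmod (u k) <= g k) -> (n <= m)%nat ->
  (Cmod (Csum m u - Csum n u) <= Rsum m g - Rsum n g).
Proof.
  intros H. induction 1 as [|m Hm IH].
  - replace (Csum n u - Csum n u) with (RtoC 0) by ring. rewrite Cmod_0. lra.
  - simpl. replace (Csum m u + u m - Csum n u) with ((Csum m u - Csum n u) + u m) by ring.
    eapply Rle_trans. apply Cmod_triangle. specialize (H m). lra.
Qed.

Lemma is_Cseries_Cauchy (u : nat -> C) :
  (forall e : R, 0 < e -> exists N, forall n m, (N <= n)%nat -> (n <= m)%nat ->
     (Cmod (Csum m u - Csum n u) < e)) -> exists l, is_Cseries u l.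
Proof.
  intros H.
  assert (W : forall e : R, 0 < e -> exists N, forall n m, (N <= n)%nat -> (N <= m)%nat ->
     (Cmod (Csum m u - Csum n u) < e)).
  { intros e He. destruct (H e He) as [N HN]. exists N. intros n m Hn Hm.
    destruct (Nat.le_ge_cases n m); [now apply HN|].
    replace (Csum m u - Csum n u) with (- (Csum n u - Csum m u)) by ring.
    rewrite Cmod_opp. now apply HN. }
  assert (HR : ex_finite_lim_seq (fun n => Re (Csum n u))).
  { apply ex_lim_seq_cauchy_corr. intros e. destruct (W e (cond_pos e)) as [N HN].
    exists N. intros n m Hn Hm.
    eapply Rle_lt_trans; [|apply (HN m n Hm Hn)]. apply (re_le_Cmod (Csum n u - Csum m u)). }
  assert (HI : ex_finite_lim_seq (fun n => Im (Csum n u))).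
  { apply ex_lim_seq_cauchy_corr. intros e. destruct (W e (cond_pos e)) as [N HN].
    exists N. intros n m Hn Hm.
    eapply Rle_lt_trans; [|apply (HN m n Hm Hn)]. apply (Im_le_Cmod (Csum n u - Csum m u)). }
  destruct HR as [x Hx], HI as [y Hy]. exists (x, y).
  apply is_Clim_squeeze with
    (fun n => Rabs (Re (Csum n u) - x) + Rabs (Im (Csum n u) - y))%R.
  - exists O. intros n _. apply (Cmod_le_abs_add (Csum n u - (x, y))).
  - replace 0%R with (Rabs (x - x) + Rabs (y - y))%R
      by (rewrite !Rminus_diag, Rabs_R0; ring).
    apply is_lim_seq_plus'; apply (is_lim_seq_abs _ (Finite _));
      apply is_lim_seq_minus'; auto using is_lim_seq_const.
Qed.

Lemma is_Cseries_dominated (u : nat -> C) (g : nat -> R) (G : R) :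
  summable g G -> (forall k, (Cmod (u k) <= g k)) -> exists l, is_Cseries u l.
Proof.
  intros Hg Hu. destruct (summable_cv g G Hg) as (L & HL & _ & HB).
  apply is_Cseries_Cauchy. intros e He.
  apply is_lim_seq_spec in HL. destruct (HL (mkposreal e He)) as [N HN].
  exists N. intros n m Hn Hm.
  eapply Rle_lt_trans. apply (Csum_diff_bound u g n m Hu Hm).
  specialize (HN n Hn). simpl in HN. apply Rabs_def2 in HN. specialize (HB m). lra.
Qed.

Lemma is_Cseries_bound (u : nat -> C) (l : C) (g : nat -> R) (G : R) :
  summable g G -> (forall k, (Cmod (u k) <= g k)) -> is_Cseries u l -> Cmod l <= G.
Proof.
  intros Hg Hu. apply is_Clim_bound. exists O. intros n _.
  apply Rle_trans with (2 := proj2 Hg n). apply Csum_bound. auto.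
Qed.

Lemma is_Cseries_tail (u : nat -> C) (l : C) (g : nat -> R) (L : R) (n : nat) :
  is_lim_seq (fun n => Rsum n g) L -> (forall k, (Cmod (u k) <= g k)) -> is_Cseries u l ->
  (Cmod (l - Csum n u) <= L - Rsum n g).
Proof.
  intros HL Hu Hl.
  assert (A : is_Clim (fun m => Csum m u - Csum n u) (l - Csum n u))
    by (apply is_Clim_minus; auto using is_Clim_const).
  apply is_Clim_Cmod in A.
  apply (is_lim_seq_le_loc (fun m => Cmod (Csum m u - Csum n u))
           (fun m => Rsum m g - Rsum n g)%R (Cmod (l - Csum n u)) (L - Rsum n g)%R); auto.
  - exists n. intros m Hm. now apply Csum_diff_bound.
  - apply is_lim_seq_minus'; auto using is_lim_seq_const.
Qed.

Lemma is_Cseries_ext (u v : nat -> C) (l : C) :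
  (forall n, u n = v n) -> is_Cseries u l -> is_Cseries v l.
Proof. intros H. apply is_Clim_ext. intros n. now apply Csum_ext. Qed.

Lemma is_Cseries_unique (u : nat -> C) (l m : C) : is_Cseries u l -> is_Cseries u m -> l = m.
Proof. apply is_Clim_unique. Qed.

Lemma is_Cseries_plus (u v : nat -> C) (l m : C) :
  is_Cseries u l -> is_Cseries v m -> is_Cseries (fun n => u n + v n) (l + m).
Proof.
  intros Hu Hv. eapply is_Clim_ext; [|apply (is_Clim_plus _ _ _ _ Hu Hv)].
  intros n. symmetry. apply Csum_plus.
Qed.

Lemma is_Cseries_scal (c : C) (u : nat -> C) (l : C) :
  is_Cseries u l -> is_Cseries (fun n => c * u n) (c * l).
Proof.
  intros Hu. eapply is_Clim_ext; [|apply (is_Clim_scal c _ _ Hu)].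
  intros n. symmetry. apply Csum_scal.
Qed.

Lemma is_Cseries_minus (u v : nat -> C) (l m : C) :
  is_Cseries u l -> is_Cseries v m -> is_Cseries (fun n => u n - v n) (l - m).
Proof.
  intros Hu Hv. apply is_Cseries_ext with (fun n => u n + -1 * v n); [intros; ring|].
  replace (l - m) with (l + -1 * m) by ring. auto using is_Cseries_plus, is_Cseries_scal.
Qed.

Lemma is_Cseries_Sl (u : nat -> C) (l : C) :
  is_Cseries (fun n => u (S n)) l <-> is_Cseries u (u O + l).
Proof.
  unfold is_Cseries at 2. rewrite (is_Clim_incr _ _ 1). split; intros H.
  - eapply is_Clim_ext; [|apply (is_Clim_plus _ _ _ _ (is_Clim_const (u O)) H)].
    intros n. rewrite Nat.add_1_r. symmetry; apply Csum_Sl.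
  - replace l with (u O + l - u O) by ring.
    eapply is_Clim_ext; [|apply (is_Clim_minus _ _ _ _ H (is_Clim_const (u O)))].
    intros n. simpl. rewrite Nat.add_1_r, Csum_Sl. ring.
Qed.

Lemma is_Cseries_finite (u : nat -> C) (N : nat) :
  (forall n, (N <= n)%nat -> u n = 0) -> is_Cseries u (Csum N u).
Proof.
  intros H. apply is_Clim_ext_loc with (fun _ => Csum N u); [|apply is_Clim_const].
  exists N. induction 1 as [|m Hm IH]; [reflexivity|]. simpl.
  rewrite <- IH, H by exact Hm. ring.
Qed.

(** Dominated convergence for series: the tails are uniformly small, and each partial
    sum converges. *)
Lemma Tannery (t : nat -> nat -> C) (S tau : nat -> C) (T : C) (g : nat -> R) (G : R) :
  summable g G -> (forall n k, (Cmod (t n k) <= g k)) ->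
  (forall n, is_Cseries (t n) (S n)) ->
  (forall k, is_Clim (fun n => t n k) (tau k)) ->
  is_Cseries tau T -> is_Clim S T.
Proof.
  intros Hg Ht HS Htau HT.
  assert (Htau' : forall k, Cmod (tau k) <= g k).
  { intros k. apply is_Clim_bound with (2 := Htau k). exists O. auto. }
  destruct (summable_cv g G Hg) as (L & HL & _ & HB).
  apply is_Clim_eps. intros e He.
  assert (HL' := HL). apply is_lim_seq_spec in HL'.
  destruct (HL' (mkposreal (e / 3)%R ltac:(lra))) as [K HK].
  specialize (HK K (le_n K)). simpl in HK. apply Rabs_def2 in HK.
  assert (A : is_Clim (fun n => Csum K (t n)) (Csum K tau)).
  { clear - Htau. induction K as [|K IH]; simpl; [apply is_Clim_const|].
    now apply is_Clim_plus. }
  destruct (proj1 (is_Clim_eps _ _) A (e / 3)%R ltac:(lra)) as [N HN].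
  exists N. intros n Hn. specialize (HN n Hn).
  assert (B1 := is_Cseries_tail _ _ g L K HL (Ht n) (HS n)).
  assert (B2 := is_Cseries_tail _ _ g L K HL Htau' HT).
  replace (S n - T)
    with ((S n - Csum K (t n)) + ((Csum K (t n) - Csum K tau) + - (T - Csum K tau))) by ring.
  eapply Rle_lt_trans. apply Cmod_triangle.
  assert (B3 := Cmod_triangle (Csum K (t n) - Csum K tau) (- (T - Csum K tau))).
  rewrite Cmod_opp in B3. lra.
Qed.

(** The row sums up to n form a series in the column index, to which [Tannery] applies. *)
Lemma is_Cseries_Fubini (t : nat -> nat -> C) (s u : nat -> C) (g h : nat -> R) (G H : R) :
  summable g G -> summable h H ->
  (forall n k, Cmod (t n k) <= g n * h k) ->
  (forall n, is_Cseries (t n) (s n)) ->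
  (forall k, is_Cseries (fun n => t n k) (u k)) ->
  exists S, is_Cseries s S /\ is_Cseries u S.
Proof.
  intros Hg Hh Ht Hs Hu.
  assert (G0 := summable_nonneg g G Hg).
  assert (Hgh : summable (fun k => G * h k)%R (G * H)) by now apply summable_scal.
  assert (P : forall n k, (Cmod (Csum n (fun i => t i k)) <= G * h k)).
  { intros n k. eapply Rle_trans. apply Csum_bound with (g := fun i => (h k * g i)%R).
    - intros i _. rewrite Rmult_comm. apply Ht.
    - rewrite Rsum_scal, Rmult_comm. apply Rmult_le_compat_r; [apply Hh | apply Hg]. }
  assert (Hu' : forall k, Cmod (u k) <= G * h k).
  { intros k. apply is_Clim_bound with (2 := Hu k). exists O. auto. }
  destruct (is_Cseries_dominated u _ _ Hgh Hu') as [S HS]. exists S. split; [|exact HS].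
  apply Tannery with (t := fun n k => Csum n (fun i => t i k)) (tau := u)
    (g := fun k => (G * h k)%R) (G := (G * H)%R); auto.
  intros n. clear - Hs. induction n as [|n IH]; simpl.
  - apply (is_Cseries_finite _ 0). reflexivity.
  - now apply is_Cseries_plus.
Qed.

(** * Complex derivatives *)

Definition Cdiff (f : C -> C) (z l : C) : Prop :=
  forall e : R, 0 < e -> exists d : R, 0 < d /\
    forall h : C, Cmod h < d -> (Cmod (f (z + h)%C - f z - l * h) <= e * Cmod h).

Definition Ccontinuous (f : C -> C) (z : C) : Prop :=
  forall e : R, 0 < e -> exists d : R, 0 < d /\
    forall h : C, Cmod h < d -> (Cmod (f (z + h)%C - f z) < e).

Lemma Cdiff_continuous (f : C -> C) (z l : C) : Cdiff f z l -> Ccontinuous f z.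
Proof.
  intros H e He. destruct (H 1%R Rlt_0_1) as (d & Hd & P).
  assert (L := Cmod_ge_0 l).
  assert (Q : 0 < e / (2 + Cmod l)) by (apply Rdiv_lt_0_compat; lra).
  exists (Rmin d (e / (2 + Cmod l))). split; [now apply Rmin_pos|].
  intros h Hh. assert (H1 := Rlt_le_trans _ _ _ Hh (Rmin_l _ _)).
  assert (H2 := Rlt_le_trans _ _ _ Hh (Rmin_r _ _)).
  specialize (P h H1).
  replace (f (z + h)%C - f z) with ((f (z + h)%C - f z - l * h) + l * h) by ring.
  eapply Rle_lt_trans. apply Cmod_triangle. rewrite Cmod_mult.
  apply Rlt_div_r in H2; [|lra]. assert (M := Cmod_ge_0 h). nra.
Qed.

Lemma Cdiff_eq (f : C -> C) (z l m : C) : l = m -> Cdiff f z l -> Cdiff f z m.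
Proof. now intros ->. Qed.

Lemma Cdiff_const (c z : C) : Cdiff (fun _ => c) z 0.
Proof.
  intros e He. exists 1%R. split; [lra|]. intros h _.
  replace (c - c - 0 * h) with (RtoC 0) by ring. rewrite Cmod_0.
  apply Rmult_le_pos; [lra | apply Cmod_ge_0].
Qed.

Lemma Cdiff_id (z : C) : Cdiff (fun t => t) z 1.
Proof.
  intros e He. exists 1%R. split; [lra|]. intros h _.
  replace (z + h - z - 1 * h) with (RtoC 0) by ring. rewrite Cmod_0.
  apply Rmult_le_pos; [lra | apply Cmod_ge_0].
Qed.

Lemma Cdiff_plus (f g : C -> C) (z l m : C) :
  Cdiff f z l -> Cdiff g z m -> Cdiff (fun t => f t + g t) z (l + m).
Proof.
  intros Hf Hg e He.
  destruct (Hf (e / 2)%R ltac:(lra)) as (d1 & D1 & P1).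
  destruct (Hg (e / 2)%R ltac:(lra)) as (d2 & D2 & P2).
  exists (Rmin d1 d2). split; [now apply Rmin_pos|]. intros h Hh.
  specialize (P1 h (Rlt_le_trans _ _ _ Hh (Rmin_l _ _))).
  specialize (P2 h (Rlt_le_trans _ _ _ Hh (Rmin_r _ _))).
  replace (f (z + h) + g (z + h) - (f z + g z) - (l + m) * h)
    with ((f (z + h)%C - f z - l * h) + (g (z + h) - g z - m * h)) by ring.
  eapply Rle_trans. apply Cmod_triangle. lra.
Qed.

Lemma Cdiff_comp (f g : C -> C) (z l m : C) :
  Cdiff f z l -> Cdiff g (f z) m -> Cdiff (fun t => g (f t)) z (m * l).
Proof.
  intros Hf Hg e He.
  assert (L := Cmod_ge_0 l). assert (M := Cmod_ge_0 m).
  set (a := (e / (2 * (1 + Cmod l)))%R). set (b := Rmin 1 (e / (2 * (1 + Cmod m)))).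
  assert (A : 0 < a) by (apply Rdiv_lt_0_compat; lra).
  assert (B : 0 < b) by (apply Rmin_pos; [lra | apply Rdiv_lt_0_compat; lra]).
  destruct (Hg a A) as (d1 & D1 & P1). destruct (Hf b B) as (d2 & D2 & P2).
  destruct (Cdiff_continuous f z l Hf d1 D1) as (d3 & D3 & P3).
  exists (Rmin d2 d3). split; [now apply Rmin_pos|]. intros h Hh.
  specialize (P2 h (Rlt_le_trans _ _ _ Hh (Rmin_l _ _))).
  specialize (P3 h (Rlt_le_trans _ _ _ Hh (Rmin_r _ _))).
  set (k := f (z + h)%C - f z) in *. specialize (P1 k P3).
  replace (f z + k) with (f (z + h)) in P1 by (unfold k; ring).
  replace (g (f (z + h)) - g (f z) - m * l * h)
    with ((g (f (z + h)) - g (f z) - m * k) + m * (k - l * h)) by ring.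
  eapply Rle_trans. apply Cmod_triangle. rewrite Cmod_mult.
  assert (K : Cmod k <= (1 + Cmod l) * Cmod h).
  { replace k with ((k - l * h) + l * h) by ring.
    eapply Rle_trans. apply Cmod_triangle. rewrite Cmod_mult.
    assert (b <= 1) by apply Rmin_l. assert (Hh0 := Cmod_ge_0 h). nra. }
  assert (A' : (a * (1 + Cmod l) = e / 2)%R) by (unfold a; field; lra).
  assert (B' : Cmod m * b <= e / 2).
  { apply Rle_trans with (Cmod m * (e / (2 * (1 + Cmod m))))%R.
    - apply Rmult_le_compat_l; [lra | apply Rmin_r].
    - apply Rle_trans with ((1 + Cmod m) * (e / (2 * (1 + Cmod m))))%R.
      + apply Rmult_le_compat_r; [|lra]. apply Rlt_le, Rdiv_lt_0_compat; lra.
      + right. field. lra. }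
  assert (Hh0 := Cmod_ge_0 h).
  apply Rle_trans with (a * ((1 + Cmod l) * Cmod h) + Cmod m * (b * Cmod h))%R.
  - apply Rplus_le_compat.
    + apply Rle_trans with (1 := P1). apply Rmult_le_compat_l; lra.
    + apply Rmult_le_compat_l; lra.
  - nra.
Qed.

Lemma Cdiff_sqr (z : C) : Cdiff (fun t => t * t) z (2 * z).
Proof.
  intros e He. exists e. split; [exact He|]. intros h Hh.
  replace ((z + h) * (z + h) - z * z - 2 * z * h) with (h * h) by ring.
  rewrite Cmod_mult. apply Rmult_le_compat_r; [apply Cmod_ge_0 | lra].
Qed.

Lemma Cdiff_scal (c : C) (f : C -> C) (z l : C) :
  Cdiff f z l -> Cdiff (fun t => c * f t) z (c * l).
Proof.
  intros H. apply (Cdiff_comp f (fun t => c * t)); [exact H|].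
  intros e He. exists 1%R. split; [lra|]. intros h _.
  replace (c * (f z + h) - c * f z - c * h) with (RtoC 0) by ring. rewrite Cmod_0.
  apply Rmult_le_pos; [lra | apply Cmod_ge_0].
Qed.

Lemma Cdiff_ext (f g : C -> C) (z l : C) :
  (forall t, f t = g t) -> Cdiff f z l -> Cdiff g z l.
Proof.
  intros E H e He. destruct (H e He) as (d & D & P). exists d. split; [exact D|].
  intros h Hh. rewrite <- !E. now apply P.
Qed.

(* The product rule by polarization: fg = ((f+g)^2 - (f-g)^2) / 4. *)
Lemma Cdiff_mult (f g : C -> C) (z l m : C) :
  Cdiff f z l -> Cdiff g z m -> Cdiff (fun t => f t * g t) z (l * g z + f z * m).
Proof.
  intros Hf Hg.
  assert (Hn := Cdiff_scal (-1) g z m Hg).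
  assert (P := Cdiff_comp _ _ _ _ _ (Cdiff_plus _ _ _ _ _ Hf Hg) (Cdiff_sqr _)).
  assert (Q := Cdiff_comp _ _ _ _ _ (Cdiff_plus _ _ _ _ _ Hf Hn) (Cdiff_sqr _)).
  assert (R := Cdiff_scal (/ 4) _ _ _ (Cdiff_plus _ _ _ _ _ P (Cdiff_scal (-1) _ _ _ Q))).
  cbv beta in R.
  eapply Cdiff_ext; [|eapply Cdiff_eq; [|exact R]].
  - intros t. cbv beta. field.
  - field.
Qed.

Lemma Cdiff_Cexp (z : C) : Cdiff Cexp z (Cexp z).
Proof.
  intros e He. assert (P := exp_pos (Re z)).
  set (d := Rmin (1 / 2) (e / (8 * exp (Re z)))).
  exists d. split; [apply Rmin_pos; [lra | apply Rdiv_lt_0_compat; lra]|].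
  intros h Hh. assert (H1 := Rlt_le_trans _ _ _ Hh (Rmin_l _ _)).
  assert (H2 := Rlt_le_trans _ _ _ Hh (Rmin_r _ _)).
  rewrite Cexp_add.
  replace (Cexp z * Cexp h - Cexp z - Cexp z * h) with (Cexp z * (Cexp h - 1 - h)) by ring.
  rewrite Cmod_mult, Cmod_Cexp.
  assert (T := Cexp_taylor1 h ltac:(lra)). assert (M := Cmod_ge_0 h).
  apply Rlt_div_r in H2; [|lra].
  apply Rle_trans with (exp (Re z) * (8 * Cmod h ^ 2))%R.
  - apply Rmult_le_compat_l; lra.
  - nra.
Qed.

Lemma Cmod_continuous (z : C) :
  continuous (T := C_UniformSpace) (U := R_UniformSpace) Cmod z.
Proof. apply (filterlim_norm (V := C_NormedModule)). Qed.

Lemma Re_continuous (z : C) : continuous (T := C_UniformSpace) (U := R_UniformSpace) Re z.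
Proof. apply (continuous_fst (U := R_UniformSpace) (V := R_UniformSpace)). Qed.

Lemma Im_continuous (z : C) : continuous (T := C_UniformSpace) (U := R_UniformSpace) Im z.
Proof. apply (continuous_snd (U := R_UniformSpace) (V := R_UniformSpace)). Qed.

Lemma slit_Cmod_Re (z : C) : slit z -> 0 < Cmod z + Re z.
Proof.
  intros Hz. assert (H0 := slit_neq_0 z Hz). apply Cmod_gt_0 in H0.
  assert (E := Cmod2_alt z). destruct Hz as [Hz|Hz]; [lra|].
  assert (0 < Im z ^ 2) by (apply pow2_gt_0; assumption). nra.
Qed.

Lemma slit_open (z : C) : slit z -> locally (T := C_UniformSpace) z slit.
Proof.
  intros [H|H].
  - apply filter_imp with (fun w : C => 0 < Re w); [now left|].
    apply (Re_continuous z (fun x => 0 < x)).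
    exists (mkposreal _ H). intros y Hy. apply Rabs_def2 in Hy. simpl in Hy.
    unfold minus, plus, opp in Hy; simpl in Hy. lra.
  - apply filter_imp with (fun w : C => Im w <> 0%R); [now right|].
    apply (Im_continuous z (fun x => x <> 0%R)).
    assert (P : 0 < Rabs (Im z)) by now apply Rabs_pos_lt.
    exists (mkposreal _ P). intros y Hy E. change (Rabs (y - Im z) < Rabs (Im z)) in Hy.
    rewrite E, Rminus_0_l, Rabs_Ropp in Hy. lra.
Qed.

Lemma Carg_continuous (z : C) :
  slit z -> continuous (T := C_UniformSpace) (U := R_UniformSpace) Carg z.
Proof.
  intros H.
  apply continuous_ext_loc with (fun w : C => 2 * atan (Im w / (Cmod w + Re w)))%R.
  - apply filter_imp with slit; [|now apply slit_open].
    intros w Hw. symmetry. now apply Carg_atan.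
  - apply (continuous_mult (K := R_AbsRing)); [apply continuous_const|].
    apply (continuous_comp (fun w : C => (Im w / (Cmod w + Re w))%R) atan).
    + apply (continuous_mult (K := R_AbsRing)); [apply Im_continuous|].
      apply (continuous_comp (fun w : C => (Cmod w + Re w)%R) Rinv).
      * apply (continuous_plus (V := R_NormedModule)); [apply Cmod_continuous | apply Re_continuous].
      * apply continuous_Rinv. assert (P := slit_Cmod_Re z H). lra.
    + apply continuity_pt_filterlim, derivable_continuous_pt, derivable_pt_atan.
Qed.

Lemma continuous_C_eps (f : C -> R) (z : C) :
  continuous (T := C_UniformSpace) (U := R_UniformSpace) f z ->
  forall e : R, 0 < e -> exists d : R, 0 < d /\
    forall h : C, Cmod h < d -> (Rabs (f (z + h)%C - f z) < e).
Proof.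
  intros H e He.
  destruct (proj1 (filterlim_locally _ _) H (mkposreal e He)) as [d Hd].
  exists d. split; [apply cond_pos|]. intros h Hh. apply (Hd (z + h)).
  split; simpl.
  - change (Rabs (Re z + Re h - Re z) < d).
    replace (Re z + Re h - Re z)%R with (Re h) by ring.
    apply Rle_lt_trans with (2 := Hh), re_le_Cmod.
  - change (Rabs (Im z + Im h - Im z) < d).
    replace (Im z + Im h - Im z)%R with (Im h) by ring.
    apply Rle_lt_trans with (2 := Hh), Im_le_Cmod.
Qed.

Lemma Clog_continuous (z : C) : slit z -> Ccontinuous Clog z.
Proof.
  intros H e He.
  assert (Hz := slit_neq_0 z H). apply Cmod_gt_0 in Hz.
  assert (L : continuous (T := C_UniformSpace) (U := R_UniformSpace) (fun w : C => ln (Cmod w)) z).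
  { apply (continuous_comp (fun w : C => Cmod w) ln); [apply Cmod_continuous|].
    apply continuity_pt_filterlim, derivable_continuous_pt.
    exists (/ Cmod z)%R. now apply derivable_pt_lim_ln. }
  destruct (continuous_C_eps _ z L (e / 2)%R ltac:(lra)) as (d1 & D1 & P1).
  destruct (continuous_C_eps _ z (Carg_continuous z H) (e / 2)%R ltac:(lra)) as (d2 & D2 & P2).
  exists (Rmin d1 d2). split; [now apply Rmin_pos|]. intros h Hh.
  specialize (P1 h (Rlt_le_trans _ _ _ Hh (Rmin_l _ _))).
  specialize (P2 h (Rlt_le_trans _ _ _ Hh (Rmin_r _ _))).
  eapply Rle_lt_trans. apply Cmod_le_abs_add. unfold Clog; simpl.
  unfold Rminus in P1, P2. lra.
Qed.

(** With k the increment of the logarithm, h / z = Cexp k - 1 = k + O(k^2), and k tends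
    to 0 by continuity. *)
Lemma Cdiff_Clog (z : C) : slit z -> Cdiff Clog z (/ z).
Proof.
  intros H e He. assert (Hz := slit_neq_0 z H). assert (Mz := proj1 (Cmod_gt_0 z) Hz).
  set (eta := Rmin (1 / 16) (e * Cmod z / 16)).
  assert (Heta : 0 < eta).
  { apply Rmin_pos; [lra|]. apply Rdiv_lt_0_compat; [|lra]. now apply Rmult_lt_0_compat. }
  destruct (Clog_continuous z H eta Heta) as (d & D & P).
  exists (Rmin d (Cmod z)). split; [now apply Rmin_pos|]. intros h Hh.
  assert (H1 := Rlt_le_trans _ _ _ Hh (Rmin_l _ _)).
  assert (H2 := Rlt_le_trans _ _ _ Hh (Rmin_r _ _)). specialize (P h H1).
  assert (Hzh : z + h <> 0).
  { intros E. replace h with (- z) in H2 by (replace (- z) with (z + h - z) by (rewrite E; ring); ring).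
    rewrite Cmod_opp in H2. lra. }
  set (k := Clog (z + h) - Clog z) in *.
  assert (E : z + h = z * Cexp k).
  { unfold k. rewrite <- (Cexp_Clog z) at 2 by exact Hz. rewrite <- Cexp_add.
    rewrite <- (Cexp_Clog (z + h)) at 1 by exact Hzh. f_equal. ring. }
  assert (E' : h / z = Cexp k - 1).
  { replace h with (z + h - z) by ring. rewrite E. field. exact Hz. }
  assert (Eta1 : eta <= 1 / 16) by apply Rmin_l.
  assert (Eta2 : eta <= e * Cmod z / 16) by apply Rmin_r.
  assert (T := Cexp_taylor1 k ltac:(lra)).
  rewrite <- E' in T. assert (K0 := Cmod_ge_0 k).
  assert (T' : Cmod (h / z - k) <= 8 * eta * Cmod k) by nra.
  assert (K : Cmod k <= 2 * (Cmod h / Cmod z)).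
  { assert (A := Cmod_triangle (h / z) (- (h / z - k))).
    replace (h / z + - (h / z - k)) with k in A by ring.
    rewrite Cmod_opp, Cmod_div in A by exact Hz. nra. }
  replace (k - / z * h) with (- (h / z - k)) by (field; exact Hz).
  rewrite Cmod_opp. apply Rle_trans with (1 := T').
  assert (Hh0 := Cmod_ge_0 h).
  assert (W : 0 <= Cmod h / Cmod z) by (apply Rle_div_r; lra).
  apply Rle_trans with (8 * (e * Cmod z / 16) * (2 * (Cmod h / Cmod z)))%R.
  - apply Rmult_le_compat; lra.
  - right. field. lra.
Qed.

Lemma Cdiff_Cpower (z w : C) : slit z -> Cdiff (fun t => Cpower t w) z (w * Cpower z w / z).
Proof.
  intros H. unfold Cpower.
  eapply Cdiff_eq; [|apply (Cdiff_comp (fun t => w * Clog t) Cexp);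
    [apply Cdiff_scal, (Cdiff_Clog z H) | apply Cdiff_Cexp]].
  cbv beta. field. now apply slit_neq_0.
Qed.

Lemma Cdiff_0_segment (f : C -> C) (z0 z1 : C) :
  (forall tau : R, 0 <= tau <= 1 -> Cdiff f (z0 + RtoC tau * (z1 - z0)) 0) ->
  f z1 = f z0.
Proof.
  intros H.
  set (w := z1 - z0) in *.
  assert (M : 0 < Cmod w + 1) by (assert (A := Cmod_ge_0 w); lra).
  assert (D : forall p : C -> R, (forall u v : C, p (u - v)%C = p u - p v)%R ->
            (forall u : C, Rabs (p u) <= Cmod u) -> p (f (z0 + RtoC 0 * w)) = p (f (z0 + RtoC 1 * w))).
  { intros p Hp Hb.
    apply (eq_is_derive (V := R_NormedModule) (fun t => p (f (z0 + RtoC t * w)))); [|lra].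
    intros t Ht. apply is_derive_Reals. intros e He.
    assert (He' : 0 < e / (2 * (Cmod w + 1))) by (apply Rdiv_lt_0_compat; lra).
    destruct (H t Ht _ He') as (d & Dd & P).
    assert (Hd : 0 < d / (Cmod w + 1)) by (apply Rdiv_lt_0_compat; lra).
    exists (mkposreal _ Hd). intros h Hh0 Hh. simpl in Hh.
    change (zero : R_NormedModule) with 0%R. rewrite Rminus_0_r.
    assert (Hh' : Cmod (RtoC h * w) < d).
    { rewrite Cmod_mult, Cmod_R. apply Rlt_div_r in Hh; [|lra].
      assert (A := Rabs_pos h). nra. }
    specialize (P _ Hh').
    replace (z0 + RtoC t * w + RtoC h * w) with (z0 + RtoC (t + h) * w) in P
      by (rewrite RtoC_plus; ring).
    rewrite Cmult_0_l in P.
    replace (f (z0 + RtoC (t + h) * w) - f (z0 + RtoC t * w) - 0)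
      with (f (z0 + RtoC (t + h) * w) - f (z0 + RtoC t * w)) in P by ring.
    rewrite <- Hp. unfold Rdiv. rewrite Rabs_mult, Rabs_inv.
    assert (Hh1 := Rabs_pos_lt h Hh0).
    apply Rlt_div_l; [exact Hh1|].
    eapply Rle_lt_trans. apply Hb. eapply Rle_lt_trans. apply P.
    rewrite Cmod_mult, Cmod_R.
    replace (e / (2 * (Cmod w + 1)) * (Rabs h * Cmod w))%R
      with (e * Rabs h * (Cmod w / (2 * (Cmod w + 1))))%R by (field; lra).
    rewrite <- (Rmult_1_r (e * Rabs h)) at 2.
    apply Rmult_lt_compat_l; [now apply Rmult_lt_0_compat|].
    apply Rlt_div_l; lra. }
  assert (E0 : z0 + RtoC 0 * w = z0) by ring.
  assert (E1 : z0 + RtoC 1 * w = z1) by (unfold w; ring).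
  rewrite E0, E1 in D. apply C_ext; symmetry; apply D; auto using re_le_Cmod, Im_le_Cmod.
Qed.

(** * Power series and the binomial series *)

(** Induction on n works because the right side satisfies, with equality, the recurrence
    that the triangle inequality gives for the left side. *)
Lemma pow_taylor1 (z h : C) (d : R) (n : nat) :
  (0 < d) -> Cmod h <= d ->
  (Cmod ((z + h) ^ n - z ^ n - INR n * z ^ (pred n) * h)
   <= (Cmod h / d) ^ 2 *
      ((Cmod z + d) ^ n - Cmod z ^ n - INR n * Cmod z ^ (pred n) * d)).
Proof.
  intros Hd Hh. assert (Z := Cmod_ge_0 z). assert (H0 := Cmod_ge_0 h).
  induction n as [|n IH].
  - simpl. replace (1 - 1 - 0 * 1 * h) with (RtoC 0) by ring. rewrite Cmod_0. right; ring.
  - assert (Hp : z * z ^ pred n * INR n = z ^ n * INR n).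
    { destruct n; simpl; ring. }
    assert (Hp' : (Cmod z * Cmod z ^ pred n * INR n = Cmod z ^ n * INR n)%R).
    { destruct n; simpl; ring. }
    rewrite S_INR, RtoC_plus. simpl pred.
    replace ((z + h) ^ S n - z ^ S n - (RtoC (INR n) + 1) * z ^ n * h)
      with ((z + h) * ((z + h) ^ n - z ^ n - INR n * z ^ pred n * h)
            + (z * z ^ pred n * INR n - z ^ n * INR n) * h
            + INR n * z ^ pred n * h * h) by (simpl; ring).
    rewrite Hp.
    replace ((Cmod z + d) ^ S n - Cmod z ^ S n - (INR n + 1) * Cmod z ^ n * d)%R
      with ((Cmod z + d) * ((Cmod z + d) ^ n - Cmod z ^ n - INR n * Cmod z ^ pred n * d)
            + (Cmod z * Cmod z ^ pred n * INR n - Cmod z ^ n * INR n) * d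
            + INR n * Cmod z ^ pred n * d * d)%R by (simpl; ring).
    rewrite Hp'. set (F := ((Cmod z + d) ^ n - _ - _)%R) in *.
    set (E := (z + h) ^ n - _ - _) in *.
    replace ((z + h) * E + (z ^ n * INR n - z ^ n * INR n) * h
       + INR n * z ^ pred n * h * h)
      with ((z + h) * E + INR n * z ^ pred n * h * h) by ring.
    eapply Rle_trans. apply Cmod_triangle.
    rewrite !Cmod_mult, Cmod_pow, Cmod_R, (Rabs_pos_eq (INR n)) by apply pos_INR.
    replace ((Cmod h / d) ^ 2 * ((Cmod z + d) * F
        + (Cmod z ^ n * INR n - Cmod z ^ n * INR n) * d + INR n * Cmod z ^ pred n * d * d))%R
      with ((Cmod z + d) * ((Cmod h / d) ^ 2 * F) + INR n * Cmod z ^ pred n * Cmod h * Cmod h)%R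
      by (field; lra).
    apply Rplus_le_compat_r. apply Rmult_le_compat; auto using Cmod_ge_0.
    eapply Rle_trans. apply Cmod_triangle. lra.
Qed.

Lemma pow_bernoulli (x d : R) (n : nat) :
  (0 <= x) -> 0 <= d -> x ^ n + INR n * x ^ pred n * d <= (x + d) ^ n.
Proof.
  intros Hx Hd. induction n as [|n IH]; [simpl; lra|].
  assert (Hp' : (x * x ^ pred n * INR n = x ^ n * INR n)%R) by (destruct n; simpl; ring).
  rewrite S_INR. simpl pred. simpl pow.
  apply Rle_trans with ((x + d) * (x ^ n + INR n * x ^ pred n * d))%R.
  - assert (0 <= INR n * x ^ pred n * d * d).
    { repeat apply Rmult_le_pos; auto using pos_INR, pow_le. }
    nra.
  - apply Rmult_le_compat_l; lra.
Qed.

(** By [pow_taylor1] the second-order remainder of each monomial is at most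
    |h / d|^2 (|z| + d)^n, which is summable against the coefficients if |z| + d < r. *)
Lemma Cdiff_power_series (c : nat -> C) (f : C -> C) (r M : R) (z : C) :
  (forall n, Cmod (c n) * r ^ n <= M) ->
  (forall w, Cmod w < r -> is_Cseries (fun n => c n * w ^ n) (f w)) ->
  (Cmod z < r) ->
  exists l, is_Cseries (fun n => RtoC (INR n) * c n * z ^ (pred n)) l /\ Cdiff f z l.
Proof.
  intros HM Hf Hz. assert (Z := Cmod_ge_0 z).
  set (d := ((r - Cmod z) / 2)%R). assert (Hd : 0 < d) by (unfold d; lra).
  set (q := ((Cmod z + d) / r)%R).
  assert (Hq : 0 <= q < 1).
  { unfold q, d. split; [apply Rle_div_r; lra | apply Rlt_div_l; lra]. }
  assert (HM0 : 0 <= M).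
  { apply Rle_trans with (2 := HM O). rewrite pow_O, Rmult_1_r. apply Cmod_ge_0. }
  set (G := (M * / (1 - q))%R).
  assert (HG : summable (fun n => Cmod (c n) * (Cmod z + d) ^ n)%R G).
  { apply summable_le with (fun n => M * q ^ n)%R.
    - intros n. split; [apply Rmult_le_pos; [apply Cmod_ge_0 | apply pow_le; lra]|].
      unfold q, Rdiv. rewrite Rpow_mult_distr, pow_inv.
      assert (P : 0 < r ^ n) by (apply pow_lt; lra).
      replace (Cmod (c n) * (Cmod z + d) ^ n)%R
        with ((Cmod (c n) * r ^ n) * ((Cmod z + d) ^ n * / r ^ n))%R by (field; lra).
      apply Rmult_le_compat_r; [|apply HM].
      apply Rmult_le_pos; [apply pow_le; lra | left; now apply Rinv_0_lt_compat].
    - apply summable_scal; auto using summable_geom. }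
  destruct (is_Cseries_dominated (fun n => RtoC (INR n) * c n * z ^ (pred n))
              (fun n => / d * (Cmod (c n) * (Cmod z + d) ^ n))%R (/ d * G)) as [l Hl].
  { apply summable_scal; [left; now apply Rinv_0_lt_compat | exact HG]. }
  { intros n. rewrite !Cmod_mult, Cmod_pow, Cmod_R, (Rabs_pos_eq (INR n)) by apply pos_INR.
    replace (INR n * Cmod (c n) * Cmod z ^ pred n)%R
      with (/ d * (Cmod (c n) * (INR n * Cmod z ^ pred n * d)))%R by (field; lra).
    apply Rmult_le_compat_l; [left; now apply Rinv_0_lt_compat|].
    apply Rmult_le_compat_l; [apply Cmod_ge_0|].
    assert (B := pow_bernoulli (Cmod z) d n Z ltac:(lra)).
    assert (P := pow_le (Cmod z) n Z). lra. }
  exists l. split; [exact Hl|].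
  assert (HG0 := summable_nonneg _ _ HG).
  intros e He.
  set (d' := (e * d ^ 2 / (G + 1))%R).
  assert (Hd' : 0 < d').
  { apply Rdiv_lt_0_compat; [|lra]. apply Rmult_lt_0_compat; [lra|]. now apply pow_lt. }
  exists (Rmin d d'). split; [now apply Rmin_pos|]. intros h Hh.
  assert (H1 := Rlt_le_trans _ _ _ Hh (Rmin_l _ _)).
  assert (H2 := Rlt_le_trans _ _ _ Hh (Rmin_r _ _)).
  assert (Hh0 := Cmod_ge_0 h).
  assert (Hzh : Cmod (z + h) < r).
  { eapply Rle_lt_trans. apply Cmod_triangle. unfold d in H1. lra. }
  assert (S := is_Cseries_minus _ _ _ _
    (is_Cseries_minus _ _ _ _ (Hf _ Hzh) (Hf _ Hz)) (is_Cseries_scal h _ _ Hl)).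
  cbv beta in S.
  apply Rle_trans with ((Cmod h / d) ^ 2 * G)%R.
  - rewrite (Cmult_comm l h).
    eapply (is_Cseries_bound _ _ (fun n => (Cmod h / d) ^ 2 * (Cmod (c n) * (Cmod z + d) ^ n))%R);
      [| |exact S].
    + apply summable_scal; [|exact HG]. apply pow2_ge_0.
    + intros n. cbv beta.
      replace (c n * (z + h) ^ n - c n * z ^ n - h * (RtoC (INR n) * c n * z ^ pred n))
        with (c n * ((z + h) ^ n - z ^ n - INR n * z ^ pred n * h)) by ring.
      rewrite Cmod_mult.
      replace ((Cmod h / d) ^ 2 * (Cmod (c n) * (Cmod z + d) ^ n))%R
        with (Cmod (c n) * ((Cmod h / d) ^ 2 * (Cmod z + d) ^ n))%R by ring.
      apply Rmult_le_compat_l; [apply Cmod_ge_0|].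
      eapply Rle_trans; [apply (pow_taylor1 z h d n Hd); lra|].
      apply Rmult_le_compat_l; [apply pow2_ge_0|].
      assert (P := pow_le (Cmod z) n Z).
      assert (0 <= INR n * Cmod z ^ pred n * d).
      { apply Rmult_le_pos; [apply Rmult_le_pos; [apply pos_INR | now apply pow_le] | lra]. }
      lra.
  - unfold d' in H2. apply Rlt_div_r in H2; [|lra].
    replace ((Cmod h / d) ^ 2 * G)%R with ((Cmod h * G) * Cmod h / d ^ 2)%R by (field; lra).
    apply Rle_div_l; [apply Rlt_gt, pow_lt; lra|]. nra.
Qed.

(** Crude growth bounds of this kind are all that is needed of the coefficients at
    infinity, since |x| may be taken large. *)
Lemma geometric_bound (g : nat -> C) (L : R) (n0 : nat) :
  (0 < L) -> (forall n, (n0 <= n)%nat -> Cmod (g (S n)) <= L * Cmod (g n)) ->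
  exists M, 0 < M /\ forall n, Cmod (g n) <= M * L ^ n.
Proof.
  intros HL H.
  assert (A : forall n, exists M, 0 < M /\ forall k, (k <= n)%nat -> Cmod (g k) <= M * L ^ k).
  { induction n as [|n (M & HM & IH)].
    - exists (Cmod (g O) + 1)%R. assert (P := Cmod_ge_0 (g O)). split; [lra|].
      intros k Hk. replace k with O by lia. simpl. lra.
    - assert (P := pow_lt L (S n) HL). set (x := (Cmod (g (S n)) / L ^ S n)%R).
      exists (Rmax M x). split; [eapply Rlt_le_trans; [exact HM | apply Rmax_l]|].
      intros k Hk. destruct (Nat.eq_dec k (S n)) as [->|Hk'].
      + apply Rle_trans with (x * L ^ S n)%R.
        * right. unfold x. field. lra.
        * apply Rmult_le_compat_r; [lra | apply Rmax_r].
      + eapply Rle_trans; [apply IH; lia|].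
        apply Rmult_le_compat_r; [apply pow_le; lra | apply Rmax_l]. }
  destruct (A n0) as (M & HM & B). exists M. split; [exact HM|]. intros n.
  destruct (Nat.le_gt_cases n n0) as [Hn|Hn]; [now apply B|].
  induction n as [|n IH]; [lia|].
  destruct (Nat.eq_dec n n0) as [->|E].
  - eapply Rle_trans; [apply H; lia|]. simpl. specialize (B n0 (le_n _)). nra.
  - eapply Rle_trans; [apply H; lia|]. simpl. specialize (IH ltac:(lia)). nra.
Qed.

(** The coefficient of z^n in (1 - z)^(-b). *)
Definition binom_coef (b : C) (n : nat) : C := pochn b n / INR (fact n).

Lemma INR_fact_C (n : nat) : RtoC (INR (fact n)) <> 0.
Proof. intros H. apply (INR_fact_neq_0 n). now injection H. Qed.

Lemma RtoC_INR_S (n : nat) : RtoC (INR (S n)) <> 0.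
Proof. intros H. apply (not_0_INR (S n)); [lia|]. now injection H. Qed.

Lemma binom_coef_S (b : C) (n : nat) :
  RtoC (INR (S n)) * binom_coef b (S n) = (b + INR n) * binom_coef b n.
Proof.
  unfold binom_coef. rewrite fact_simpl, mult_INR, RtoC_mult. simpl pochn.
  field. split; [apply INR_fact_C | apply RtoC_INR_S].
Qed.

Lemma binom_coef_ratio (b : C) (L : R) :
  (1 < L) -> exists n0, forall n, (n0 <= n)%nat ->
    (Cmod (b + INR n) <= L * INR (S n)).
Proof.
  intros HL. destruct (INR_unbounded (Cmod b / (L - 1))) as [n0 Hn0].
  exists n0. intros n Hn. apply le_INR in Hn.
  apply Rlt_div_l in Hn0; [|lra].
  eapply Rle_trans. apply Cmod_triangle.
  rewrite Cmod_R, Rabs_pos_eq by apply pos_INR. rewrite S_INR. nra.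
Qed.

Lemma binom_coef_bound (b : C) (L : R) :
  (1 < L) -> exists M, 0 < M /\ forall n, Cmod (binom_coef b n) <= M * L ^ n.
Proof.
  intros HL. destruct (binom_coef_ratio b L HL) as [n0 H].
  apply geometric_bound with n0; [lra|]. intros n Hn. specialize (H n Hn).
  assert (P := lt_0_INR (S n) ltac:(lia)).
  assert (E := f_equal Cmod (binom_coef_S b n)).
  rewrite !Cmod_mult, Cmod_R, Rabs_pos_eq in E by lra.
  apply Rmult_le_reg_l with (INR (S n)); [exact P|]. rewrite E.
  replace (INR (S n) * (L * Cmod (binom_coef b n)))%R
    with (L * INR (S n) * Cmod (binom_coef b n))%R by ring.
  apply Rmult_le_compat_r; [apply Cmod_ge_0 | exact H].
Qed.

Lemma binom_coef_summable (b : C) (q : R) :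
  (0 <= q < 1) -> exists G, summable (fun n => Cmod (binom_coef b n) * q ^ n)%R G.
Proof.
  intros Hq. set (L := (2 / (1 + q))%R).
  assert (HL : 1 < L) by (apply Rlt_div_r; lra).
  assert (HLq : 0 <= L * q < 1).
  { split; [apply Rmult_le_pos; lra|]. unfold L.
    replace (2 / (1 + q) * q)%R with (2 * q / (1 + q))%R by (field; lra).
    apply Rlt_div_l; lra. }
  destruct (binom_coef_bound b L HL) as (M & HM & B).
  exists (M * / (1 - L * q))%R. apply summable_le with (fun n => M * (L * q) ^ n)%R.
  - intros n. assert (P := pow_le q n ltac:(lra)).
    split; [apply Rmult_le_pos; [apply Cmod_ge_0 | exact P]|].
    rewrite Rpow_mult_distr, <- Rmult_assoc. now apply Rmult_le_compat_r.
  - apply summable_scal; [lra | now apply summable_geom].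
Qed.

Lemma binom_series_cv (b z : C) :
  (Cmod z < 1) -> exists l, is_Cseries (fun n => binom_coef b n * z ^ n) l.
Proof.
  intros Hz. assert (Z := Cmod_ge_0 z).
  destruct (binom_coef_summable b (Cmod z) ltac:(lra)) as [G HG].
  apply (is_Cseries_dominated _ _ _ HG). intros n.
  rewrite Cmod_mult, Cmod_pow. lra.
Qed.

(** The binomial series, for the principal power and any base point u: both sides
    solve (u - z) y' = b y along the segment from 0 to z. *)
Lemma binomial_series (b u z : C) :
  (Cmod z < Cmod u) ->
  (forall tau : R, 0 <= tau <= 1 -> slit (u - RtoC tau * z)) ->
  is_Cseries (fun n => Cpower u (- b) * (binom_coef b n * (z / u) ^ n)) (Cpower (u - z) (- b)).
Proof.
  intros Hzu Hs. assert (Z := Cmod_ge_0 z).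
  assert (Hu : u <> 0) by (apply Cmod_gt_0; lra).
  set (f := fun w => CSeries (fun n => binom_coef b n * w ^ n)).
  assert (Hf : forall w, Cmod w < 1 -> is_Cseries (fun n => binom_coef b n * w ^ n) (f w)).
  { intros w Hw. destruct (binom_series_cv b w Hw) as [l Hl].
    unfold f. now rewrite (CSeries_unique _ _ Hl). }
  assert (Df : forall w, Cmod w < 1 -> exists l, (1 - w) * l = b * f w /\ Cdiff f w l).
  { intros w Hw. assert (W := Cmod_ge_0 w). set (r := ((1 + Cmod w) / 2)%R).
    assert (Hr : 0 < r < 1) by (unfold r; lra).
    destruct (binom_coef_bound b (/ r)) as (M & HM & B).
    { rewrite <- Rinv_1. apply Rinv_lt_contravar; lra. }
    destruct (Cdiff_power_series (binom_coef b) f r M w) as (l & Hl & D).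
    - intros n. assert (P := pow_lt r n ltac:(lra)).
      apply Rle_trans with (M * (/ r) ^ n * r ^ n)%R.
      + apply Rmult_le_compat_r; [lra | apply B].
      + rewrite pow_inv. right. field. lra.
    - intros v Hv. apply Hf. lra.
    - unfold r. lra.
    - exists l. split; [|exact D].
      assert (H1 : is_Cseries (fun n => RtoC (INR (S n)) * binom_coef b (S n) * w ^ n) l).
      { apply (is_Cseries_Sl (fun n => RtoC (INR n) * binom_coef b n * w ^ pred n)).
        replace (_ + l) with l by (simpl; ring). exact Hl. }
      assert (H2 := is_Cseries_scal w _ _ Hl).
      assert (H3 := is_Cseries_minus _ _ _ _ H1 H2). cbv beta in H3.
      replace ((1 - w) * l) with (l - w * l) by ring.
      apply (is_Cseries_unique _ _ _ H3).
      eapply is_Cseries_ext; [|apply (is_Cseries_scal b _ _ (Hf w Hw))].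
      intros n. cbv beta. rewrite binom_coef_S.
      destruct n; simpl pred; [simpl; ring|]. rewrite Cpow_S. ring. }
  assert (E : Cpower (u - z) b * f (z / u) = Cpower (u - 0) b * f (0 / u)).
  { apply (Cdiff_0_segment (fun v => Cpower (u - v) b * f (v / u))).
    intros tau Ht. replace (0 + RtoC tau * (z - 0)) with (RtoC tau * z) by ring.
    set (v := RtoC tau * z).
    assert (Hv : slit (u - v)) by now apply Hs.
    assert (Hw : Cmod (v / u) < 1).
    { rewrite Cmod_div by exact Hu. apply Rlt_div_l; [lra|]. unfold v.
      rewrite Cmod_mult, Cmod_R, Rabs_pos_eq by lra. nra. }
    destruct (Df _ Hw) as (l & El & Dl).
    assert (D1 : Cdiff (fun t => Cpower (u - t) b) v (b * Cpower (u - v) b / (u - v) * -1)).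
    { apply (Cdiff_comp (fun t => u - t) (fun t => Cpower t b)); [|now apply Cdiff_Cpower].
      eapply Cdiff_ext; [|eapply Cdiff_eq;
        [|apply (Cdiff_plus _ _ _ _ _ (Cdiff_const u v) (Cdiff_scal (-1) _ _ _ (Cdiff_id v)))]].
      - intros t; simpl; ring.
      - ring. }
    assert (D2 : Cdiff (fun t => f (t / u)) v (l * / u)).
    { apply (Cdiff_comp (fun t => t / u) f); [|exact Dl].
      eapply Cdiff_ext; [|eapply Cdiff_eq; [|apply (Cdiff_scal (/ u) _ _ _ (Cdiff_id v))]].
      - intros t; simpl; unfold Cdiv; ring.
      - ring. }
    eapply Cdiff_eq; [|apply (Cdiff_mult _ _ _ _ _ D1 D2)]. cbv beta.
    assert (Huv : u - v <> 0) by now apply slit_neq_0.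
    assert (El' : l = b * f (v / u) * u / (u - v)).
    { replace l with ((1 - v / u) * l * (u / (u - v))) by (field; auto).
      rewrite El. field; auto. }
    rewrite El'. field; auto. }
  assert (F0 : f (0 / u) = 1).
  { replace (0 / u) with (RtoC 0) by (field; auto).
    apply (is_Cseries_unique (fun n => binom_coef b n * 0 ^ n)); [apply Hf; rewrite Cmod_0; lra|].
    replace (RtoC 1) with (Csum 1 (fun n => binom_coef b n * 0 ^ n))
      by (unfold binom_coef; simpl; field).
    apply is_Cseries_finite. intros n Hn. destruct n; [lia|]. simpl. ring. }
  rewrite F0, Cmult_1_r in E. replace (u - 0) with u in E by ring.
  assert (Hw : Cmod (z / u) < 1).
  { rewrite Cmod_div by exact Hu. apply Rlt_div_l; lra. }
  replace (Cpower (u - z) (- b)) with (Cpower u (- b) * f (z / u)).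
  - apply is_Cseries_scal, Hf, Hw.
  - assert (N1 := Cpower_neq_0 (u - z) b). assert (N2 := Cpower_neq_0 u b).
    replace (f (z / u)) with (Cpower u b / Cpower (u - z) b) by (rewrite <- E; field; auto).
    rewrite !Cpower_opp. field; auto.
Qed.

(** * The reciprocal Gamma function *)

Definition nonpole (z : C) : Prop := forall k : nat, z <> RtoC (- INR k)%R.

Lemma nonpole_add (z : C) (k : nat) : nonpole z -> z + INR k <> 0.
Proof.
  intros H E. apply (H k). rewrite RtoC_opp.
  replace z with (z + INR k - INR k) by ring. rewrite E. ring.
Qed.

Lemma nonpole_neq_0 (z : C) : nonpole z -> z <> 0.
Proof. intros H. assert (A := nonpole_add z 0 H). simpl in A. now rewrite Cplus_0_r in A. Qed.

Lemma nonpole_shift (z : C) (n : nat) : nonpole z -> nonpole (z + INR n).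
Proof.
  intros H k E. apply (H (n + k)%nat).
  replace z with (z + INR n - INR n) by ring.
  rewrite E, plus_INR, <- RtoC_minus. f_equal. ring.
Qed.

Lemma nonpole_S (z : C) : nonpole z -> nonpole (z + 1).
Proof. apply (nonpole_shift z 1). Qed.

Lemma nonpole_Re (z : C) : 0 < Re z -> nonpole z.
Proof. intros H k ->. simpl in H. assert (P := pos_INR k). lra. Qed.

Lemma nonint_nonpole (z : C) : ~ Cint z -> nonpole z.
Proof.
  intros H k E. apply H. exists (- Z.of_nat k)%Z. rewrite E, opp_IZR, INR_IZR_INZ. reflexivity.
Qed.

Lemma nonint_shift (z : C) (j : Z) : ~ Cint z -> ~ Cint (z + RtoC (IZR j)).
Proof.
  intros H [k E]. apply H. exists (k - j)%Z. rewrite minus_IZR, RtoC_minus, <- E. ring.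
Qed.

Lemma nonint_opp (z : C) : ~ Cint z -> ~ Cint (- z).
Proof. intros H [k E]. apply H. exists (- k)%Z. rewrite opp_IZR, RtoC_opp, <- E. ring. Qed.

Lemma Cinv_neq_0 (z : C) : z <> 0 -> / z <> 0.
Proof.
  intros H E. assert (A := Cinv_r z H). rewrite E, Cmult_0_r in A. injection A; lra.
Qed.

Lemma pochn_add (z : C) (n m : nat) :
  pochn z (n + m) = pochn z n * pochn (z + INR n) m.
Proof.
  induction m as [|m IH]; [rewrite Nat.add_0_r; simpl; ring|].
  rewrite Nat.add_succ_r. simpl pochn. rewrite IH, plus_INR, RtoC_plus. ring.
Qed.

Lemma pochn_Sl (z : C) (n : nat) : pochn z (S n) = z * pochn (z + 1) n.
Proof. change (S n) with (1 + n)%nat. rewrite pochn_add. simpl. ring. Qed.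

Lemma pochn_neq_0 (z : C) (n : nat) : nonpole z -> pochn z n <> 0.
Proof.
  intros H. induction n as [|n IH]; simpl.
  - intros E; injection E; lra.
  - apply Cmult_neq_0; [exact IH | now apply nonpole_add].
Qed.

Lemma Clog_pos (x : R) : 0 < x -> Clog (RtoC x) = RtoC (ln x).
Proof.
  intros H. apply Clog_unique.
  - simpl. assert (P := PI_RGT_0). lra.
  - apply C_ext; unfold Cexp; simpl; rewrite ?cos_0, ?sin_0, exp_ln by assumption;
      (apply Rmult_1_r || apply Rmult_0_r).
Qed.

Lemma Cmod_Cpower_pos (x : R) (z : C) :
  (0 < x) -> Cmod (Cpower (RtoC x) z) = Rpower x (Re z).
Proof.
  intros H. unfold Cpower. rewrite Clog_pos, Cmod_Cexp by assumption.
  unfold Rpower. now rewrite re_scal_r.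
Qed.

Lemma summable_inv_prod : summable (fun k => / (INR (S k) * INR (S (S k))))%R 1.
Proof.
  assert (P : forall k, 0 < INR (S k)) by (intros; apply lt_0_INR; lia).
  split; intros n.
  - left. apply Rinv_0_lt_compat, Rmult_lt_0_compat; auto.
  - assert (E : Rsum n (fun k => / (INR (S k) * INR (S (S k))))%R = (1 - / INR (S n))%R).
    { induction n as [|n IH]; [simpl; field|]. cbn [Rsum]. rewrite IH.
      rewrite (S_INR (S n)). assert (Q := P n). field. lra. }
    rewrite E. assert (Q := Rinv_0_lt_compat _ (P n)). lra.
Qed.

Lemma inv_prod_telescope (n : nat) : (1 <= n)%nat ->
  (/ (INR n * INR (S n)) = / INR n - / INR (S n))%R.
Proof.
  intros H. assert (P : 0 < INR n) by (apply lt_0_INR; lia).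
  rewrite S_INR. field. lra.
Qed.

(** The growth factors exp (K / (n (n+1))) telescope, so the sequence is bounded and
    its increments are O(1/n^2). *)
Lemma near_one_ratio_cv (g : nat -> C) (K : R) (n0 : nat) :
  (1 <= n0)%nat -> 0 <= K ->
  (forall n, (n0 <= n)%nat ->
     (Cmod (g (S n) - g n) <= K * / (INR n * INR (S n)) * Cmod (g n))) ->
  exists l, is_Clim g l.
Proof.
  intros Hn0 HK H.
  assert (Pn : forall n, (n0 <= n)%nat -> 0 < INR n) by (intros; apply lt_0_INR; lia).
  assert (Up : forall n, (n0 <= n)%nat ->
    (Cmod (g n) <= Cmod (g n0) * exp (K * (/ INR n0 - / INR n)))).
  { induction 1 as [|n Hn IH].
    - rewrite Rminus_diag, Rmult_0_r, exp_0. lra.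
    - specialize (H n Hn). rewrite inv_prod_telescope in H by lia.
      set (t := (K * (/ INR n - / INR (S n)))%R) in *.
      replace (K * (/ INR n0 - / INR (S n)))%R with (K * (/ INR n0 - / INR n) + t)%R
        by (unfold t; ring).
      rewrite exp_plus. assert (E := exp_ineq1_le t).
      assert (T := Cmod_triangle (g (S n) - g n) (g n)).
      replace (g (S n) - g n + g n) with (g (S n)) in T by ring.
      assert (G0 := Cmod_ge_0 (g n)). assert (E0 := exp_pos t).
      apply Rle_trans with (Cmod (g n) * exp t)%R; [nra|].
      rewrite <- Rmult_assoc. apply Rmult_le_compat_r; lra. }
  set (B := (Cmod (g n0) * exp K)%R).
  assert (HB : 0 <= B) by (apply Rmult_le_pos; [apply Cmod_ge_0 | left; apply exp_pos]).
  assert (Up' : forall n, (n0 <= n)%nat -> Cmod (g n) <= B).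
  { intros n Hn. eapply Rle_trans; [now apply Up|].
    apply Rmult_le_compat_l; [apply Cmod_ge_0|].
    assert (I1 := Rinv_0_lt_compat _ (Pn n Hn)).
    assert (I2 : / INR n0 <= 1).
    { rewrite <- Rinv_1. apply Rinv_le_contravar; [lra|]. now apply (le_INR 1). }
    destruct (Req_dec (K * (/ INR n0 - / INR n)) K) as [->|Hne]; [lra|].
    left. apply exp_increasing. nra. }
  destruct (is_Cseries_dominated (fun k => g (S (n0 + k)) - g (n0 + k)%nat)
              (fun k => (K * B) * / (INR (S k) * INR (S (S k))))%R (K * B * 1)) as [l Hl].
  { apply summable_scal; [now apply Rmult_le_pos | apply summable_inv_prod]. }
  { intros k. eapply Rle_trans; [apply H; lia|].
    replace (K * B * / (INR (S k) * INR (S (S k))))%R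
      with (K * / (INR (S k) * INR (S (S k))) * B)%R by ring.
    assert (Q1 := lt_0_INR (S k) ltac:(lia)). assert (Q2 := lt_0_INR (S (S k)) ltac:(lia)).
    assert (Q3 : INR (S k) <= INR (n0 + k)) by (apply le_INR; lia).
    assert (Q4 : INR (S (S k)) <= INR (S (n0 + k))) by (apply le_INR; lia).
    apply Rmult_le_compat; [|apply Cmod_ge_0| |apply Up'; lia].
    - apply Rmult_le_pos; [exact HK|]. left. apply Rinv_0_lt_compat, Rmult_lt_0_compat; lra.
    - apply Rmult_le_compat_l; [exact HK|]. apply Rinv_le_contravar.
      + apply Rmult_lt_0_compat; lra.
      + apply Rmult_le_compat; lra. }
  exists (g n0 + l).
  apply (is_Clim_incr _ _ n0).
  eapply is_Clim_ext; [|apply (is_Clim_plus _ _ _ _ (is_Clim_const (g n0)) Hl)].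
  intros n. cbv beta.
  induction n as [|n IH]; simpl Csum.
  - rewrite Nat.add_0_l. ring.
  - replace (S n + n0)%nat with (S (n0 + n))%nat by lia.
    rewrite Cplus_assoc, IH. replace (n + n0)%nat with (n0 + n)%nat by lia. ring.
Qed.

Definition gauss (z : C) (n : nat) : C :=
  pochn z (S n) / (RtoC (INR (fact n)) * Cpower (RtoC (INR n)) z).

Lemma RtoC_INR_pos (n : nat) : (1 <= n)%nat -> RtoC (INR n) <> 0.
Proof. intros H. destruct n; [lia|]. apply RtoC_INR_S. Qed.

Lemma gauss_ratio (z : C) (n : nat) : (1 <= n)%nat ->
  gauss z (S n) = gauss z n *
    ((1 + z / INR (S n)) * Cexp (z * RtoC (ln (INR n) - ln (INR (S n))))).
Proof.
  intros Hn. unfold gauss, Cpower.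
  rewrite !Clog_pos by (apply lt_0_INR; lia).
  rewrite fact_simpl, mult_INR, RtoC_mult, RtoC_minus.
  replace (z * (RtoC (ln (INR n)) - RtoC (ln (INR (S n)))))
    with (z * RtoC (ln (INR n)) + - (z * RtoC (ln (INR (S n))))) by ring.
  rewrite Cexp_add, Cexp_opp. change (pochn z (S (S n))) with (pochn z (S n) * (z + INR (S n))).
  field. repeat split; auto using INR_fact_C, RtoC_INR_S, Cexp_neq_0.
Qed.

(** The ratio of consecutive terms is (1 + z/(n+1)) (n/(n+1))^z = 1 + O(1/n^2). *)
Lemma gauss_cv (z : C) :
  exists l, is_Clim (gauss z) l.
Proof.
  assert (Z0 := Cmod_ge_0 z).
  destruct (INR_unbounded (2 * Cmod z)) as [m Hm].
  set (K := (Cmod z + Cmod z ^ 2 + 16 * (1 + Cmod z) * Cmod z ^ 2)%R).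
  apply (near_one_ratio_cv (gauss z) K (S m)).
  - lia.
  - unfold K. nra.
  - intros n Hn. rewrite gauss_ratio by lia.
    assert (Pn : 1 <= INR n) by (apply (le_INR 1); lia).
    assert (Pm : INR m <= INR n) by (apply le_INR; lia).
    set (lam := (ln (INR n) - ln (INR (S n)))%R).
    assert (L1 : lam <= - / INR (S n)).
    { assert (A := exp_ineq1_le lam). unfold lam in A at 2.
      replace (ln (INR n) - ln (INR (S n)))%R with (ln (INR n) + - ln (INR (S n)))%R in A by ring.
      rewrite exp_plus, exp_Ropp, !exp_ln in A by (rewrite ?S_INR; lra).
      rewrite S_INR in *.
      replace (INR n * / (INR n + 1))%R with (1 - / (INR n + 1))%R in A by (field; lra). lra. }
    assert (L2 : - / INR n <= lam).
    { assert (A := exp_ineq1_le (- lam)). unfold lam in A at 2.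
      replace (- (ln (INR n) - ln (INR (S n))))%R with (ln (INR (S n)) + - ln (INR n))%R in A by ring.
      rewrite exp_plus, exp_Ropp, !exp_ln in A by (rewrite ?S_INR; lra).
      rewrite S_INR in *.
      replace ((INR n + 1) * / INR n)%R with (1 + / INR n)%R in A by (field; lra). lra. }
    set (u := z * RtoC lam).
    assert (In0 := Rinv_0_lt_compat (INR n) ltac:(lra)).
    assert (Im0 := Rinv_0_lt_compat (INR (S n)) ltac:(rewrite S_INR; lra)).
    assert (Hu : Cmod u <= Cmod z * / INR n).
    { unfold u. rewrite Cmod_mult, Cmod_R. apply Rmult_le_compat_l; [exact Z0|].
      rewrite Rabs_left1; lra. }
    assert (Hu2 : Cmod u <= 1 / 2).
    { eapply Rle_trans; [exact Hu|]. apply Rle_div_l; lra. }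
    assert (T := Cexp_taylor1 u Hu2). set (E := Cexp u - 1 - u) in *.
    replace (gauss z n * ((1 + z / INR (S n)) * Cexp u) - gauss z n)
      with (((z / INR (S n) + u) + (z / INR (S n)) * u
             + (1 + z / INR (S n)) * E) * gauss z n)
      by (unfold E; ring).
    rewrite Cmod_mult. apply Rmult_le_compat_r; [apply Cmod_ge_0|].
    assert (Tel := inv_prod_telescope n ltac:(lia)).
    set (p := (/ (INR n * INR (S n)))%R) in *.
    assert (B0 : (Cmod (z / INR (S n)) = Cmod z * / INR (S n))%R).
    { rewrite Cmod_div by apply RtoC_INR_S.
      rewrite Cmod_R, Rabs_pos_eq by apply pos_INR. reflexivity. }
    assert (B1 : Cmod (z / INR (S n) + u) <= Cmod z * p).
    { replace (z / INR (S n) + u) with (z * RtoC (/ INR (S n) + lam)).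
      - rewrite Cmod_mult, Cmod_R. apply Rmult_le_compat_l; [exact Z0|].
        rewrite Rabs_left1 by lra. lra.
      - unfold u. rewrite RtoC_plus, RtoC_inv by (rewrite S_INR; lra). unfold Cdiv. ring. }
    assert (Ep : (p = / INR n * / INR (S n))%R).
    { unfold p. rewrite Rinv_mult. reflexivity. }
    assert (B2 : Cmod (z / INR (S n) * u) <= Cmod z ^ 2 * p).
    { rewrite Cmod_mult, B0, Ep.
      replace (Cmod z ^ 2 * (/ INR n * / INR (S n)))%R
        with (Cmod z * / INR (S n) * (Cmod z * / INR n))%R by ring.
      apply Rmult_le_compat_l; [|exact Hu]. apply Rmult_le_pos; lra. }
    assert (Ip : / INR n * / INR n <= 2 * p).
    { rewrite Ep. assert (A : / INR n <= 2 * / INR (S n)).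
      { rewrite S_INR. apply Rmult_le_reg_r with (INR n * (INR n + 1))%R; [nra|].
        field_simplify; lra. }
      nra. }
    assert (B3 : Cmod ((1 + z / INR (S n)) * E) <= 16 * (1 + Cmod z) * Cmod z ^ 2 * p).
    { rewrite Cmod_mult.
      assert (A : Cmod (1 + z / INR (S n)) <= 1 + Cmod z).
      { eapply Rle_trans. apply Cmod_triangle. rewrite B0, Cmod_1.
        assert (/ INR (S n) <= 1).
        { rewrite <- Rinv_1. apply Rinv_le_contravar; [lra|]. rewrite S_INR; lra. }
        nra. }
      assert (A' : Cmod E <= 16 * Cmod z ^ 2 * p).
      { apply Rle_trans with (1 := T). assert (U0 := Cmod_ge_0 u).
        assert (Cmod u ^ 2 <= Cmod z ^ 2 * (/ INR n * / INR n)).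
        { replace (Cmod z ^ 2 * (/ INR n * / INR n))%R with ((Cmod z * / INR n) ^ 2)%R by ring.
          apply pow_incr. lra. }
        assert (Cmod z ^ 2 * (/ INR n * / INR n) <= Cmod z ^ 2 * (2 * p)).
        { apply Rmult_le_compat_l; [apply pow2_ge_0 | exact Ip]. }
        lra. }
      replace (16 * (1 + Cmod z) * Cmod z ^ 2 * p)%R
        with ((1 + Cmod z) * (16 * Cmod z ^ 2 * p))%R by ring.
      apply Rmult_le_compat; auto using Cmod_ge_0. }
    assert (C1 := Cmod_triangle (z / INR (S n) + u + z / INR (S n) * u)
                    ((1 + z / INR (S n)) * E)).
    assert (C2 := Cmod_triangle (z / INR (S n) + u) (z / INR (S n) * u)).
    unfold K. lra.
Qed.

Lemma rGamma_lim (z : C) : is_Clim (gauss z) (rGamma z).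
Proof.
  destruct (gauss_cv z) as (l & Hl). unfold rGamma. fold (gauss z).
  change (is_Clim (gauss z) (CLim (gauss z))). now rewrite (CLim_unique _ _ Hl).
Qed.

Lemma is_Clim_inv_INR : is_Clim (fun n => / INR n) 0.
Proof.
  apply is_Clim_squeeze with (fun n => / INR n)%R.
  - exists 1%nat. intros n Hn. replace (/ INR n - 0) with (RtoC (/ INR n)).
    + rewrite Cmod_R, Rabs_pos_eq; [lra|]. left. apply Rinv_0_lt_compat, lt_0_INR. lia.
    + rewrite RtoC_inv by (apply not_0_INR; lia). ring.
  - replace (Finite 0) with (Rbar_inv p_infty) by reflexivity.
    apply is_lim_seq_inv; [apply is_lim_seq_INR | discriminate].
Qed.

Lemma is_Clim_shift_ratio (u v : C) :
  is_Clim (fun n => (u + INR n) / (v + INR n)) 1.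
Proof.
  assert (A : forall w, is_Clim (fun n => w * / INR n + 1) 1).
  { intros w. apply (is_Clim_eq _ (w * 0 + 1)); [ring|].
    apply is_Clim_plus; [apply is_Clim_scal, is_Clim_inv_INR | apply is_Clim_const]. }
  destruct (INR_unbounded (Cmod v)) as [m Hm].
  apply is_Clim_ext_loc with
    (fun n => (u * / INR n + 1) * / (v * / INR n + 1)).
  - exists (S m). intros n Hn. assert (Hn' := RtoC_INR_pos n ltac:(lia)).
    assert (Hv : v + INR n <> 0).
    { intros E. replace v with (- INR n) in Hm
        by (replace v with (v + INR n - INR n) by ring; rewrite E; ring).
      rewrite Cmod_opp, Cmod_R, Rabs_pos_eq in Hm by apply pos_INR.
      apply INR_lt in Hm. lia. }
    field. auto.
  - apply (is_Clim_eq _ (1 * / 1)); [field|].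
    apply is_Clim_mult; [apply A|]. apply is_Clim_inv; [|apply A].
    intros E; injection E; lra.
Qed.

Lemma rGamma_rec (z : C) : rGamma z = z * rGamma (z + 1).
Proof.
  apply (is_Clim_unique (fun n => z * gauss (z + 1) n));
    [|apply is_Clim_scal, rGamma_lim].
  apply is_Clim_ext_loc with
    (fun n => gauss z n * ((z + 1 + INR n) / (0 + INR n))).
  - exists 1%nat. intros n Hn. assert (Hn' := RtoC_INR_pos n Hn). unfold gauss.
    rewrite Cpower_add, Cpower_1 by exact Hn'.
    replace (pochn (z + 1) (S n)) with (pochn (z + 1) n * (z + 1 + INR n)) by reflexivity.
    rewrite pochn_Sl, Cplus_0_l.
    field. repeat split; auto using INR_fact_C, Cpower_neq_0.
  - apply (is_Clim_eq _ (rGamma z * 1)); [ring|].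
    apply is_Clim_mult; [apply rGamma_lim | apply is_Clim_shift_ratio].
Qed.

Lemma rGamma_shift (z : C) (n : nat) : rGamma z = pochn z n * rGamma (z + INR n).
Proof.
  induction n as [|n IH]; [simpl; rewrite Cplus_0_r; ring|].
  rewrite IH, (rGamma_rec (z + INR n)), S_INR, RtoC_plus, Cplus_assoc.
  simpl. ring.
Qed.

(** * Partial fractions of the Beta function *)

Lemma binom_coef_0 (b : C) : binom_coef b 0 = 1.
Proof. unfold binom_coef; simpl. field. Qed.

Lemma binom_convolution (p : C) (n : nat) :
  Csum (S n) (fun k => binom_coef (1 - p) k * binom_coef p (n - k)) = 1.
Proof.
  set (d := binom_coef (1 - p)). set (e := binom_coef p).
  assert (D : forall k, RtoC (INR (S k)) * d (S k) = (1 - p + INR k) * d k)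
    by apply binom_coef_S.
  assert (E : forall k, RtoC (INR (S k)) * e (S k) = (p + INR k) * e k)
    by apply binom_coef_S.
  induction n as [|n IH].
  - simpl. unfold d, e. rewrite !binom_coef_0. ring.
  - assert (Q : RtoC (INR (S n)) * Csum (S (S n)) (fun k => d k * e (S n - k)%nat)
                = RtoC (INR (S n)) * 1).
    { rewrite <- IH. rewrite <- !Csum_scal.
      transitivity (Csum (S (S n)) (fun k => RtoC (INR k) * d k * e (S n - k)%nat)
                    + Csum (S (S n)) (fun k => d k * (RtoC (INR (S n - k)) * e (S n - k)%nat))).
      { rewrite <- Csum_plus. apply Csum_ext. intros k Hk.
        rewrite (minus_INR (S n) k) by lia. rewrite RtoC_minus. ring. }
      rewrite Csum_Sl.
      replace (Csum (S (S n)) (fun k => d k * (RtoC (INR (S n - k)) * e (S n - k)%nat)))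
        with (Csum (S n) (fun k => d k * (RtoC (INR (S n - k)) * e (S n - k)%nat))).
      2:{ change (Csum (S (S n)) (fun k => d k * (RtoC (INR (S n - k)) * e (S n - k)%nat)))
            with (Csum (S n) (fun k => d k * (RtoC (INR (S n - k)) * e (S n - k)%nat))
                  + d (S n) * (RtoC (INR (S n - S n)) * e (S n - S n)%nat)).
          rewrite Nat.sub_diag. simpl. ring. }
      replace (RtoC (INR 0) * d O * e (S n - 0)%nat) with (RtoC 0) by (simpl; ring).
      rewrite Cplus_0_l, <- Csum_plus. apply Csum_ext. intros k Hk.
      rewrite D. replace (S n - S k)%nat with (n - k)%nat by lia.
      replace (S n - k)%nat with (S (n - k)) by lia. rewrite E.
      rewrite (minus_INR n k) by lia. rewrite S_INR, RtoC_minus, RtoC_plus. ring. }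
    assert (N := RtoC_INR_S n).
    assert (Q' := f_equal (fun t => / INR (S n) * t) Q). cbv beta in Q'.
    rewrite !Cmult_assoc, Cinv_l, !Cmult_1_l in Q' by exact N. exact Q'.
Qed.

(** Partial fractions in z of (z + p)_n / (z)_(n+1). Both sides satisfy the same
    first-order recurrence in n; for the left side this is where
    [binom_convolution], the case (1 - t)^(p-1) (1 - t)^(-p) = (1 - t)^(-1), enters. *)
Lemma beta_partial_fractions (p z : C) (n : nat) : nonpole z ->
  Csum (S n) (fun k => binom_coef (1 - p) k * binom_coef p (n - k) / (z + INR k))
  = pochn (z + p) n / pochn z (S n).
Proof.
  intros Hz. assert (Hk := fun k => nonpole_add z k Hz).
  set (d := binom_coef (1 - p)). set (e := binom_coef p).
  assert (E : forall k, RtoC (INR (S k)) * e (S k) = (p + INR k) * e k)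
    by apply binom_coef_S.
  set (T := fun n => Csum (S n) (fun k => d k * e (n - k)%nat / (z + INR k))).
  change (T n = pochn (z + p) n / pochn z (S n)).
  induction n as [|n IH].
  - unfold T. simpl. unfold d, e. rewrite !binom_coef_0. field. now apply nonpole_neq_0.
  - assert (Q : (z + INR (S n)) * T (S n) - (z + p + INR n) * T n
                = Csum (S (S n)) (fun k => d k * e (S n - k)%nat)
                  - Csum (S n) (fun k => d k * e (n - k)%nat)).
    { unfold T.
      change (Csum (S (S n)) (fun k => d k * e (S n - k)%nat / (z + INR k)))
        with (Csum (S n) (fun k => d k * e (S n - k)%nat / (z + INR k))
              + d (S n) * e (S n - S n)%nat / (z + INR (S n))).
      change (Csum (S (S n)) (fun k => d k * e (S n - k)%nat))
        with (Csum (S n) (fun k => d k * e (S n - k)%nat) + d (S n) * e (S n - S n)%nat).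
      set (X := d (S n) * e (S n - S n)%nat).
      replace ((z + INR (S n)) *
        (Csum (S n) (fun k => d k * e (S n - k)%nat / (z + INR k))
         + X / (z + INR (S n))))
      with ((z + INR (S n)) *
        Csum (S n) (fun k => d k * e (S n - k)%nat / (z + INR k)) + X)
        by (field; apply Hk).
      assert (W : (z + INR (S n)) *
          Csum (S n) (fun k => d k * e (S n - k)%nat / (z + INR k))
        + -1 * ((z + p + INR n) * Csum (S n) (fun k => d k * e (n - k)%nat / (z + INR k)))
        = Csum (S n) (fun k => d k * e (S n - k)%nat)
          + -1 * Csum (S n) (fun k => d k * e (n - k)%nat)).
      { rewrite <- !Csum_scal, <- !Csum_plus. apply Csum_ext. intros k Hkn.
        assert (En := E (n - k)%nat). replace (S (n - k)) with (S n - k)%nat in En by lia.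
        rewrite (minus_INR (S n) k), (minus_INR n k) in En by lia.
        rewrite !RtoC_minus in En.
        assert (Hzk := Hk k).
        replace ((z + INR (S n)) * (d k * e (S n - k)%nat / (z + INR k)) +
          -1 * ((z + p + INR n) * (d k * e (n - k)%nat / (z + INR k))))
        with (d k * e (S n - k)%nat + -1 * (d k * e (n - k)%nat)
              + d k / (z + INR k) *
                ((RtoC (INR (S n)) - INR k) * e (S n - k)%nat
                 - (p + (RtoC (INR n) - INR k)) * e (n - k)%nat)) by (field; exact Hzk).
        rewrite En. ring. }
      match goal with |- ?a + X - ?b = ?c + X - ?d' =>
        replace (a + X - b) with ((a + -1 * b) + X) by ring end.
      rewrite W. ring. }
    unfold d, e in Q. rewrite !binom_convolution in Q.
    assert (Q' : T (S n) = (z + p + INR n) * T n / (z + INR (S n))).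
    { assert (N := Hk (S n)).
      replace (T (S n)) with ((((z + INR (S n)) * T (S n) - (z + p + INR n) * T n)
         + (z + p + INR n) * T n) / (z + INR (S n))) by (field; exact N).
      rewrite Q. field. exact N. }
    rewrite Q', IH. change (pochn z (S (S n))) with (pochn z (S n) * (z + INR (S n))).
    simpl pochn at 3. field. split; [apply Hk | now apply (pochn_neq_0 z (S n))].
Qed.

Lemma summable_S (g : nat -> R) (G : R) :
  (0 <= g O) -> summable (fun n => g (S n)) G -> summable g (g O + G).
Proof.
  intros H0 [H1 H2].
  assert (P : forall n, 0 <= g n) by (intros [|n]; auto). split; [exact P|].
  intros n. apply Rle_trans with (Rsum (S n) g); [apply Rsum_incr; auto with arith|].
  replace (Rsum (S n) g) with (g O + Rsum n (fun n => g (S n)))%R; [specialize (H2 n); lra|].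
  clear. induction n as [|n IH]; simpl in *; lra.
Qed.

(** (1 - p)_k / k! is k^(-p) times a convergent Gauss product, hence O(1/k^2). *)
Lemma binom_coef_summable_1 (p : C) :
  (2 <= Re p) -> exists G, summable (fun k => Cmod (binom_coef (1 - p) k)) G.
Proof.
  intros Hp. set (w := 1 - p).
  destruct (proj1 (is_Clim_eps _ _) (rGamma_lim w) 1%R Rlt_0_1) as [N HN].
  set (B := (Cmod (rGamma w) + 1)%R). assert (B0 : 0 <= B).
  { unfold B. assert (A := Cmod_ge_0 (rGamma w)). lra. }
  assert (HB : forall n, (N <= n)%nat -> (1 <= n)%nat ->
    (Cmod (binom_coef w (S n)) <= B * / (INR n * INR (S n)))).
  { intros n Hn Hn1. specialize (HN n Hn).
    assert (G : Cmod (gauss w n) <= B).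
    { replace (gauss w n) with (gauss w n - rGamma w + rGamma w) by ring.
      eapply Rle_trans. apply Cmod_triangle. unfold B. lra. }
    assert (P1 : 1 <= INR n) by (apply (le_INR 1); lia).
    replace (binom_coef w (S n))
      with (gauss w n * (Cpower (RtoC (INR n)) w * / INR (S n))).
    2:{ unfold gauss, binom_coef. rewrite fact_simpl, mult_INR, RtoC_mult.
        field. repeat split; auto using INR_fact_C, RtoC_INR_S, Cpower_neq_0. }
    rewrite Cmod_mult. apply Rmult_le_compat; auto using Cmod_ge_0.
    rewrite Cmod_mult, Cmod_inv, Cmod_R, Rabs_pos_eq, Rinv_mult
      by first [apply RtoC_INR_S | apply pos_INR].
    apply Rmult_le_compat_r; [left; apply Rinv_0_lt_compat, lt_0_INR; lia|].
    rewrite Cmod_Cpower_pos by lra.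
    rewrite <- (Rpower_1 (INR n)) at 2 by lra. rewrite <- Rpower_Ropp.
    apply Rle_Rpower; [lra|]. replace (Re w) with (1 - Re p)%R by reflexivity. lra. }
  assert (A : forall m g, (forall k, (0 <= g k)) ->
    (exists G, summable (fun n => g (m + n)%nat) G) -> exists G, summable g G).
  { clear. induction m as [|m IH]; intros g Hg [G HG]; [now exists G|].
    apply IH; [exact Hg|]. exists (g (m + 0)%nat + G)%R.
    apply (summable_S (fun n => g (m + n)%nat)); [apply Hg|].
    destruct HG as [H1 H2]. split; [intros; apply Hg|]. intros n.
    eapply Rle_trans; [|apply (H2 n)]. apply Rsum_ext_le.
    intros k _. rewrite Nat.add_succ_r. right. reflexivity. }
  apply (A (S (S N))); [intros; apply Cmod_ge_0|].
  exists (B * 1)%R.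
  apply summable_le with (fun k => B * / (INR (S k) * INR (S (S k))))%R.
  - intros n. split; [apply Cmod_ge_0|].
    change (S (S N) + n)%nat with (S (S (N + n))).
    eapply Rle_trans; [apply HB; lia|]. apply Rmult_le_compat_l; [exact B0|].
    apply Rinv_le_contravar.
    + apply Rmult_lt_0_compat; apply lt_0_INR; lia.
    + apply Rmult_le_compat; try apply pos_INR; apply le_INR; lia.
  - apply summable_scal; [exact B0 | apply summable_inv_prod].
Qed.

Lemma inv_shift_bound (z : C) : nonpole z ->
  exists M, 0 < M /\ forall k, Cmod (/ (z + INR k)) <= M.
Proof.
  intros Hz.
  destruct (INR_unbounded (Cmod z + 1)) as [m Hm].
  assert (A : forall n, exists M, 1 <= M /\
     forall k, (k < n)%nat -> Cmod (/ (z + INR k)) <= M).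
  { induction n as [|n (M & HM & IH)].
    - exists 1%R. split; [lra | intros; lia].
    - exists (Rmax M (Cmod (/ (z + INR n)))). split.
      + eapply Rle_trans; [exact HM | apply Rmax_l].
      + intros k Hk. destruct (Nat.eq_dec k n) as [->|Hne]; [apply Rmax_r|].
        eapply Rle_trans; [apply IH; lia | apply Rmax_l]. }
  destruct (A m) as (M & HM & H). exists M. split; [lra|]. intros k.
  destruct (Nat.lt_ge_cases k m) as [Hk|Hk]; [now apply H|].
  apply le_INR in Hk. apply Rle_trans with (2 := HM).
  rewrite Cmod_inv by now apply nonpole_add.
  assert (T := Cmod_triangle (z + INR k) (- z)). rewrite Cmod_opp in T.
  replace (z + INR k + - z) with (RtoC (INR k)) in T by ring.
  rewrite Cmod_R, Rabs_pos_eq in T by apply pos_INR.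
  rewrite <- Rinv_1. apply Rinv_le_contravar; lra.
Qed.

(** The Beta integral of t^(z-1) (1-t)^(p-1), expanded in powers of t; the formula
    continues it to every z that is not a pole. Dividing the finite partial fraction
    identity by (p)_n / n! makes its left side dominated (as Re p >= 1) and its right
    side a quotient of Gauss products. *)
Lemma beta_series_mul (p z : C) : 2 <= Re p -> nonpole z ->
  exists T, is_Cseries (fun k => binom_coef (1 - p) k / (z + INR k)) T /\
    T * (rGamma z * rGamma p) = rGamma (z + p).
Proof.
  intros Hp Hz.
  assert (Hp' : nonpole p) by (apply nonpole_Re; lra).
  destruct (binom_coef_summable_1 p Hp) as [G HG].
  destruct (inv_shift_bound z Hz) as (M & HM & BM).
  set (d := binom_coef (1 - p)) in *. set (e := binom_coef p).
  assert (Ne : forall n, e n <> 0).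
  { intros n. apply Cmult_neq_0; [now apply pochn_neq_0 | apply Cinv_neq_0, INR_fact_C]. }
  assert (E : forall k, RtoC (INR (S k)) * e (S k) = (p + INR k) * e k)
    by apply binom_coef_S.
  assert (Er : forall n, e n / e (S n) = RtoC (INR (S n)) / (p + INR n)).
  { intros n. assert (Nn := nonpole_add p n Hp'). assert (A := RtoC_INR_S n).
    assert (B := Ne (S n)).
    replace (e n) with (RtoC (INR (S n)) * e (S n) / (p + INR n))
      by (rewrite E; field; auto).
    field; auto. }
  assert (Hsum : summable (fun k => M * Cmod (d k))%R (M * G)) by (apply summable_scal; [lra | exact HG]).
  assert (Hd : forall k, Cmod (d k / (z + INR k)) <= M * Cmod (d k)).
  { intros k. unfold Cdiv. rewrite Cmod_mult, Rmult_comm.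
    apply Rmult_le_compat_r; [apply Cmod_ge_0 | apply BM]. }
  destruct (is_Cseries_dominated _ _ _ Hsum Hd) as [T HT].
  exists T. split; [exact HT|].
  apply (is_Clim_unique (fun n => pochn (z + p) n / pochn z (S n) / e n * (gauss z n * gauss p n))).
  - apply is_Clim_mult; [|apply is_Clim_mult; apply rGamma_lim].
    apply (Tannery (fun n k => if (k <=? n)%nat then d k / (z + INR k) * (e (n - k)%nat / e n) else 0)
             _ (fun k => d k / (z + INR k)) _ _ _ Hsum).
    + intros n k. destruct (Nat.leb_spec k n) as [Hk|Hk].
      * rewrite Cmod_mult, <- (Rmult_1_r (M * _)).
        apply Rmult_le_compat; auto using Cmod_ge_0.
        replace n with ((n - k) + k)%nat at 2 by lia.
        generalize (n - k)%nat as m. clear n Hk. induction k as [|k IH]; intros m.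
        { rewrite Nat.add_0_r. replace (e m / e m) with (RtoC 1) by (field; apply Ne).
          rewrite Cmod_1. lra. }
        rewrite Nat.add_succ_r.
        replace (e m / e (S (m + k))) with (e m / e (m + k)%nat * (e (m + k)%nat / e (S (m + k))))
          by (field; auto).
        rewrite Cmod_mult, Er.
        rewrite <- (Rmult_1_r 1). apply Rmult_le_compat; auto using Cmod_ge_0.
        assert (Nn := nonpole_add p (m + k) Hp').
        rewrite Cmod_div, Cmod_R, Rabs_pos_eq by (try exact Nn; apply pos_INR).
        apply Cmod_gt_0 in Nn. apply Rle_div_l; [exact Nn|].
        rewrite Rmult_1_l. eapply Rle_trans; [|apply re_le_Cmod].
        rewrite S_INR. eapply Rle_trans; [|apply Rle_abs].
        replace (Re (p + INR (m + k))) with (Re p + INR (m + k))%R by reflexivity. lra.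
      * rewrite Cmod_0. apply Rmult_le_pos; [lra | apply Cmod_ge_0].
    + intros n. rewrite <- (beta_partial_fractions p z n Hz). fold d e.
      set (t := fun k => if (k <=? n)%nat then d k / (z + INR k) * (e (n - k)%nat / e n) else 0).
      replace (Csum (S n) (fun k => d k * e (n - k)%nat / (z + INR k)) / e n)
        with (Csum (S n) t).
      * apply is_Cseries_finite. intros k Hk. unfold t.
        destruct (Nat.leb_spec k n); [lia | reflexivity].
      * unfold Cdiv at 1. rewrite (Cmult_comm _ (/ e n)), <- Csum_scal. apply Csum_ext.
        intros k Hk. unfold t. destruct (Nat.leb_spec k n); [|lia]. unfold Cdiv. ring.
    + intros k. apply is_Clim_ext_loc with (fun n => d k / (z + INR k) * (e (n - k)%nat / e n)).
      { exists k. intros n Hn. destruct (Nat.leb_spec k n); [reflexivity | lia]. }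
      apply (is_Clim_eq _ (d k / (z + INR k) * 1)); [ring|].
      apply is_Clim_scal. apply (is_Clim_incr _ _ k).
      apply is_Clim_ext with (fun m => e m / e (m + k)%nat).
      { intros m. now replace (m + k - k)%nat with m by lia. }
      induction k as [|k IH].
      * apply is_Clim_ext with (fun _ => RtoC 1); [|apply is_Clim_const].
        intros m. rewrite Nat.add_0_r. field. apply Ne.
      * apply is_Clim_ext with
          (fun m => e m / e (m + k)%nat * ((1 + INR (m + k)) / (p + INR (m + k)))).
        { intros m. rewrite Nat.add_succ_r, (Cplus_comm 1), <- RtoC_plus, <- S_INR, <- Er.
          field; auto. }
        apply (is_Clim_eq _ (1 * 1)); [ring|]. apply is_Clim_mult; [exact IH|].
        apply (is_Clim_incr (fun m => (1 + INR m) / (p + INR m)) _ k).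
        apply is_Clim_shift_ratio.
    + exact HT.
  - destruct (INR_unbounded (Cmod (z + p))) as [m Hm].
    apply is_Clim_ext_loc with
      (fun n => gauss (z + p) n * ((p + INR n) / (z + p + INR n))).
    + exists (S m). intros n Hn.
      assert (Nzp : z + p + INR n <> 0).
      { intros Z0. replace (z + p) with (- INR n) in Hm
          by (replace (z + p) with (z + p + INR n - INR n) by ring; rewrite Z0; ring).
        rewrite Cmod_opp, Cmod_R, Rabs_pos_eq in Hm by apply pos_INR.
        apply INR_lt in Hm. lia. }
      assert (Np := nonpole_add p n Hp').
      assert (N1 := pochn_neq_0 z (S n) Hz). assert (N2 := pochn_neq_0 p n Hp').
      unfold gauss, e, binom_coef. rewrite Cpower_add.
      change (pochn (z + p) (S n)) with (pochn (z + p) n * (z + p + INR n)).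
      change (pochn p (S n)) with (pochn p n * (p + INR n)).
      field. repeat split; auto using INR_fact_C, Cpower_neq_0.
    + apply (is_Clim_eq _ (rGamma (z + p) * 1)); [ring|].
      apply is_Clim_mult; [apply rGamma_lim | apply is_Clim_shift_ratio].
Qed.

Lemma rGamma_1 : rGamma 1 = 1.
Proof.
  apply (is_Clim_unique (gauss 1)); [apply rGamma_lim|].
  apply is_Clim_ext_loc with (fun n => (1 + INR n) / (0 + INR n)); [|apply is_Clim_shift_ratio].
  exists 1%nat. intros n Hn. unfold gauss.
  assert (F : forall k, pochn 1 k = RtoC (INR (fact k))).
  { induction k as [|k IH]; [reflexivity|].
    rewrite fact_simpl, mult_INR, S_INR, RtoC_mult, RtoC_plus. simpl. rewrite IH. ring. }
  assert (Nn := RtoC_INR_pos n Hn).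
  simpl pochn. rewrite F, Cpower_1 by exact Nn. field. auto using INR_fact_C.
Qed.

(** As rGamma z is a factor of rGamma (z + p), it suffices to choose p with z + p a
    positive integer. *)
Lemma rGamma_neq_0 (z : C) : nonpole z -> rGamma z <> 0.
Proof.
  intros Hz. destruct (INR_unbounded (2 + Re z)) as [m Hm].
  destruct (beta_series_mul (1 + INR m - z) z) as (T & _ & E); [|exact Hz|].
  { change (2 <= 1 + INR m - Re z). lra. }
  replace (z + (1 + INR m - z)) with (1 + INR m) in E by ring.
  intros Z. rewrite Z, Cmult_0_l, Cmult_0_r in E.
  assert (S := rGamma_shift 1 m). rewrite rGamma_1, <- E, Cmult_0_r in S. injection S. lra.
Qed.

Lemma beta_series (p z : C) : 2 <= Re p -> nonpole z ->
  is_Cseries (fun k => binom_coef (1 - p) k / (z + INR k))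
    (rGamma (z + p) / (rGamma z * rGamma p)).
Proof.
  intros Hp Hz. destruct (beta_series_mul p z Hp Hz) as (T & HT & E).
  rewrite <- E. replace (T * (rGamma z * rGamma p) / (rGamma z * rGamma p)) with T; [exact HT|].
  field. split; apply rGamma_neq_0; [apply nonpole_Re; lra | exact Hz].
Qed.

(** * Integrals of complex-valued functions on a segment *)

Definition RCcontinuous (f : R -> C) (t : R) : Prop :=
  continuous (fun u => Re (f u)) t /\ continuous (fun u => Im (f u)) t.

Definition RCderiv (f : R -> C) (t : R) (l : C) : Prop :=
  is_derive (fun u => Re (f u)) t (Re l) /\ is_derive (fun u => Im (f u)) t (Im l).

Definition CRInt (f : R -> C) (a b : R) : C :=
  (RInt (fun t => Re (f t)) a b, RInt (fun t => Im (f t)) a b).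

Lemma RCcontinuous_eps (f : R -> C) (t : R) :
  (forall e : R, 0 < e -> exists d : R, 0 < d /\
     forall u : R, Rabs (u - t) < d -> Cmod (f u - f t) < e) ->
  RCcontinuous f t.
Proof.
  intros H. split; apply filterlim_locally; intros e;
    destruct (H e (cond_pos e)) as (d & D & P); exists (mkposreal d D);
    intros u Hu; specialize (P u Hu); eapply Rle_lt_trans; [|exact P| |exact P].
  - apply (re_le_Cmod (f u - f t)).
  - apply (Im_le_Cmod (f u - f t)).
Qed.

Lemma RCcontinuous_eps_inv (f : R -> C) (t : R) : RCcontinuous f t ->
  forall e : R, 0 < e -> exists d : R, 0 < d /\
     forall u : R, Rabs (u - t) < d -> Cmod (f u - f t) < e.
Proof.
  intros [H1 H2] e He.
  assert (He2 : 0 < e / 2) by lra.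
  destruct (proj1 (filterlim_locally _ _) H1 (mkposreal _ He2)) as [d1 P1].
  destruct (proj1 (filterlim_locally _ _) H2 (mkposreal _ He2)) as [d2 P2].
  exists (Rmin d1 d2). split; [apply Rmin_pos; apply cond_pos|]. intros u Hu.
  specialize (P1 u (Rlt_le_trans _ _ _ Hu (Rmin_l _ _))).
  specialize (P2 u (Rlt_le_trans _ _ _ Hu (Rmin_r _ _))).
  change (Rabs (Re (f u) - Re (f t)) < e / 2) in P1.
  change (Rabs (Im (f u) - Im (f t)) < e / 2) in P2.
  eapply Rle_lt_trans. apply Cmod_le_abs_add.
  replace (Re (f u - f t)) with (Re (f u) - Re (f t))%R by reflexivity.
  replace (Im (f u - f t)) with (Im (f u) - Im (f t))%R by reflexivity. lra.
Qed.

Lemma RCcontinuous_const (c : C) (t : R) : RCcontinuous (fun _ => c) t.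
Proof. split; apply continuous_const. Qed.

Lemma RCcontinuous_RtoC (f : R -> R) (t : R) :
  continuous f t -> RCcontinuous (fun u => RtoC (f u)) t.
Proof. intros H. split; [exact H | apply continuous_const]. Qed.

Lemma RCcontinuous_id (t : R) : RCcontinuous RtoC t.
Proof. apply (RCcontinuous_RtoC (fun u => u)), continuous_id. Qed.

Lemma RCcontinuous_plus (f g : R -> C) (t : R) :
  RCcontinuous f t -> RCcontinuous g t -> RCcontinuous (fun u => f u + g u) t.
Proof.
  intros [F1 F2] [G1 G2].
  split; now apply (continuous_plus (V := R_NormedModule)).
Qed.

Lemma RCcontinuous_mult (f g : R -> C) (t : R) :
  RCcontinuous f t -> RCcontinuous g t -> RCcontinuous (fun u => f u * g u) t.
Proof.
  intros [F1 F2] [G1 G2]. split.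
  - apply (continuous_minus (V := R_NormedModule)); now apply (continuous_mult (K := R_AbsRing)).
  - apply (continuous_plus (V := R_NormedModule)); now apply (continuous_mult (K := R_AbsRing)).
Qed.

Lemma RCcontinuous_pow (f : R -> C) (n : nat) (t : R) :
  RCcontinuous f t -> RCcontinuous (fun u => f u ^ n) t.
Proof.
  intros H. induction n as [|n IH]; [apply RCcontinuous_const|].
  simpl. now apply RCcontinuous_mult.
Qed.

Lemma RCcontinuous_comp (f : R -> C) (g : C -> C) (t : R) :
  RCcontinuous f t -> Ccontinuous g (f t) -> RCcontinuous (fun u => g (f u)) t.
Proof.
  intros Hf Hg. apply RCcontinuous_eps. intros e He.
  destruct (Hg e He) as (d & D & P).
  destruct (RCcontinuous_eps_inv f t Hf d D) as (d' & D' & P').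
  exists d'. split; [exact D'|]. intros u Hu. specialize (P _ (P' u Hu)).
  now replace (f t + (f u - f t)) with (f u) in P by ring.
Qed.

Lemma Csum_continuous (f : nat -> R -> C) (n : nat) (t : R) :
  (forall k, RCcontinuous (f k) t) -> RCcontinuous (fun u => Csum n (fun k => f k u)) t.
Proof.
  intros H. induction n as [|n IH]; [apply RCcontinuous_const|].
  simpl. now apply RCcontinuous_plus.
Qed.

Section Segment.

Variables a b : R.
Hypothesis Hab : a <= b.

Let on_segment (P : R -> Prop) := forall t, a <= t <= b -> P t.

Lemma RCcontinuous_ex_RInt (f : R -> C) : on_segment (RCcontinuous f) ->
  ex_RInt (fun t => Re (f t)) a b /\ ex_RInt (fun t => Im (f t)) a b.
Proof.
  intros H. split; apply (ex_RInt_continuous (V := R_CompleteNormedModule)); intros t Ht;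
    rewrite Rmin_left, Rmax_right in Ht by exact Hab; apply (H t Ht).
Qed.

Lemma CRInt_ext (f g : R -> C) :
  (forall t, a < t < b -> f t = g t) -> CRInt f a b = CRInt g a b.
Proof.
  intros H. unfold CRInt. f_equal; apply RInt_ext; intros t Ht;
    rewrite Rmin_left, Rmax_right in Ht by exact Hab; now rewrite H.
Qed.

Lemma CRInt_plus (f g : R -> C) :
  on_segment (RCcontinuous f) -> on_segment (RCcontinuous g) ->
  CRInt (fun t => f t + g t) a b = CRInt f a b + CRInt g a b.
Proof.
  intros Hf Hg. destruct (RCcontinuous_ex_RInt f Hf), (RCcontinuous_ex_RInt g Hg).
  apply C_ext; simpl; now apply (RInt_plus (V := R_CompleteNormedModule)).
Qed.

Lemma CRInt_scal (c : C) (f : R -> C) :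
  on_segment (RCcontinuous f) ->
  CRInt (fun t => c * f t) a b = c * CRInt f a b.
Proof.
  intros Hf. destruct (RCcontinuous_ex_RInt f Hf) as [H1 H2].
  assert (S : forall k (g : R -> R), ex_RInt g a b ->
     RInt (fun t => (k * g t)%R) a b = (k * RInt g a b)%R /\ ex_RInt (fun t => (k * g t)%R) a b).
  { intros k g Hg. split; [now apply (RInt_scal (V := R_CompleteNormedModule))|].
    now apply (ex_RInt_scal (V := R_NormedModule)). }
  destruct (S (Re c) _ H1) as [A1 A2], (S (Re c) _ H2) as [A3 A4],
    (S (Im c) _ H1) as [A5 A6], (S (Im c) _ H2) as [A7 A8].
  apply C_ext.
  - change (RInt (fun t => (Re c * Re (f t) - Im c * Im (f t))%R) a b
      = (Re c * RInt (fun t => Re (f t)) a b - Im c * RInt (fun t => Im (f t)) a b)%R).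
    rewrite <- A1, <- A7. now apply (RInt_minus (V := R_CompleteNormedModule)).
  - change (RInt (fun t => (Re c * Im (f t) + Im c * Re (f t))%R) a b
      = (Re c * RInt (fun t => Im (f t)) a b + Im c * RInt (fun t => Re (f t)) a b)%R).
    rewrite <- A3, <- A5. now apply (RInt_plus (V := R_CompleteNormedModule)).
Qed.

Lemma CRInt_Csum (f : nat -> R -> C) (n : nat) :
  (forall k, on_segment (RCcontinuous (f k))) ->
  CRInt (fun t => Csum n (fun k => f k t)) a b = Csum n (fun k => CRInt (f k) a b).
Proof.
  intros H. induction n as [|n IH]; simpl.
  - apply C_ext; simpl; rewrite RInt_const; unfold scal; simpl; unfold mult; simpl; ring.
  - rewrite <- IH. apply CRInt_plus; [|apply H].
    intros t Ht. apply Csum_continuous. intros k. now apply H.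
Qed.

(* The factor 2 accounts for real and imaginary parts being bounded separately. *)
Lemma CRInt_bound (f : R -> C) (B : R) :
  on_segment (RCcontinuous f) ->
  (forall t, a < t < b -> Cmod (f t) <= B) ->
  (Cmod (CRInt f a b) <= 2 * (b - a) * B).
Proof.
  intros Hf HB. destruct (RCcontinuous_ex_RInt f Hf) as [H1 H2].
  assert (P : forall g : R -> R, ex_RInt g a b ->
     (forall t, a < t < b -> Rabs (g t) <= B) -> Rabs (RInt g a b) <= (b - a) * B).
  { intros g Hg Hb.
    assert (C1 : forall k, RInt (fun _ => k) a b = ((b - a) * k)%R)
      by (intros k; now rewrite RInt_const).
    assert (E : forall k : R, ex_RInt (fun _ => k) a b)
      by (intros k; apply (ex_RInt_const (V := R_NormedModule))).
    apply Rabs_le. replace (- ((b - a) * B))%R with ((b - a) * - B)%R by ring.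
    rewrite <- !C1. split; apply RInt_le; auto; intros t Ht; specialize (Hb t Ht);
      apply Rabs_le_between in Hb; lra. }
  eapply Rle_trans; [apply Cmod_le_abs_add|]. simpl.
  assert (Q1 := P _ H1 (fun t Ht => Rle_trans _ _ _ (re_le_Cmod (f t)) (HB t Ht))).
  assert (Q2 := P _ H2 (fun t Ht => Rle_trans _ _ _ (Im_le_Cmod (f t)) (HB t Ht))).
  lra.
Qed.

(** Continuity of the sum is an assumption, as the sums of interest are explicit. *)
Lemma CRInt_series (f : nat -> R -> C) (F : R -> C) (g : nat -> R) (G : R) :
  (forall k, on_segment (RCcontinuous (f k))) -> on_segment (RCcontinuous F) ->
  summable g G ->
  (forall k t, a < t < b -> Cmod (f k t) <= g k) ->
  (forall t, a < t < b -> is_Cseries (fun k => f k t) (F t)) ->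
  is_Cseries (fun k => CRInt (f k) a b) (CRInt F a b).
Proof.
  intros Hf HF Hg Hfg HS.
  destruct (summable_cv g G Hg) as (L & HL & _ & _).
  apply is_Clim_squeeze with (fun n => 2 * (b - a) * (L - Rsum n g))%R.
  - exists O. intros n _.
    rewrite <- CRInt_Csum by exact Hf.
    replace (CRInt (fun t => Csum n (fun k => f k t)) a b - CRInt F a b)
      with (CRInt (fun t => Csum n (fun k => f k t)) a b + (-1) * CRInt F a b) by ring.
    assert (HC : on_segment (RCcontinuous (fun t => Csum n (fun k => f k t)))).
    { intros t Ht. apply Csum_continuous. intros k. now apply Hf. }
    assert (HN : on_segment (RCcontinuous (fun t => (-1) * F t))).
    { intros t Ht. apply RCcontinuous_mult; [apply RCcontinuous_const | now apply HF]. }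
    rewrite <- CRInt_scal, <- CRInt_plus by assumption.
    apply CRInt_bound.
    + intros t Ht. apply RCcontinuous_plus; auto.
    + intros t Ht.
      replace (Csum n (fun k => f k t) + (-1) * F t)
        with (- (F t - Csum n (fun k => f k t))) by ring.
      rewrite Cmod_opp. apply (is_Cseries_tail _ _ g L n HL); auto.
  - replace 0%R with (2 * (b - a) * (L - L))%R by ring.
    apply is_lim_seq_mult'; [apply is_lim_seq_const|].
    apply is_lim_seq_minus'; [apply is_lim_seq_const | exact HL].
Qed.

Lemma CRInt_derive (F f : R -> C) :
  on_segment (fun t => RCderiv F t (f t)) -> on_segment (RCcontinuous f) ->
  CRInt f a b = F b - F a.
Proof.
  intros HF Hf.
  apply C_ext; simpl; apply is_RInt_unique.
  - apply (is_RInt_derive (fun t => Re (F t))); intros t Ht;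
      rewrite Rmin_left, Rmax_right in Ht by exact Hab; [apply (HF t Ht) | apply (Hf t Ht)].
  - apply (is_RInt_derive (fun t => Im (F t))); intros t Ht;
      rewrite Rmin_left, Rmax_right in Ht by exact Hab; [apply (HF t Ht) | apply (Hf t Ht)].
Qed.

End Segment.

Lemma RCderiv_eps (f : R -> C) (t : R) (l : C) :
  (forall e : R, 0 < e -> exists d : R, 0 < d /\ forall h : R, Rabs h < d ->
     (Cmod (f (t + h)%R - f t - l * RtoC h) <= e * Rabs h)) ->
  RCderiv f t l.
Proof.
  intros H.
  assert (P : forall p : C -> R, (forall u v : C, p (u - v)%C = p u - p v)%R ->
    (forall (u : C) (h : R), p (u * RtoC h)%C = p u * h)%R ->
    (forall u : C, Rabs (p u) <= Cmod u) -> is_derive (fun u => p (f u)) t (p l)).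
  { intros p P1 P2 P3. apply is_derive_Reals. intros e He.
    destruct (H (e / 2)%R ltac:(lra)) as (d & D & Q). exists (mkposreal d D).
    intros h Hh0 Hh. specialize (Q h Hh).
    assert (Hh1 := Rabs_pos_lt h Hh0).
    replace ((p (f (t + h)%R) - p (f t)) / h - p l)%R
      with (p (f (t + h)%R - f t - l * RtoC h)%C / h)%R
      by (rewrite !P1, P2; field; exact Hh0).
    unfold Rdiv. rewrite Rabs_mult, Rabs_inv. apply Rlt_div_l; [exact Hh1|].
    eapply Rle_lt_trans; [apply P3|]. eapply Rle_lt_trans; [exact Q|]. nra. }
  split; apply P; auto using re_le_Cmod, Im_le_Cmod.
  - intros; apply re_scal_r.
  - intros u h. rewrite im_mult. simpl. ring.
Qed.

Lemma RCderiv_Cdiff (f : C -> C) (t : R) (l : C) :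
  Cdiff f (RtoC t) l -> RCderiv (fun u => f (RtoC u)) t l.
Proof.
  intros H. apply RCderiv_eps. intros e He. destruct (H e He) as (d & D & P).
  exists d. split; [exact D|]. intros h Hh. rewrite <- Cmod_R.
  rewrite RtoC_plus. apply P. now rewrite Cmod_R.
Qed.

Lemma RCderiv_mult (f g : R -> C) (t : R) (l m : C) :
  RCderiv f t l -> RCderiv g t m -> RCderiv (fun u => f u * g u) t (l * g t + f t * m).
Proof.
  intros [F1 F2] [G1 G2].
  assert (M : forall (p q : R -> R) (x y : R), is_derive p t x -> is_derive q t y ->
     is_derive (fun u => (p u * q u)%R) t (x * q t + p t * y)%R).
  { intros p q x y Hp Hq. apply (is_derive_mult (K := R_AbsRing)); auto. apply Rmult_comm. }
  assert (A1 := M _ _ _ _ F1 G1). assert (A2 := M _ _ _ _ F2 G2).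
  assert (A3 := M _ _ _ _ F1 G2). assert (A4 := M _ _ _ _ F2 G1). split.
  - replace (Re (l * g t + f t * m)) with
      ((Re l * Re (g t) + Re (f t) * Re m) - (Im l * Im (g t) + Im (f t) * Im m))%R
      by (destruct l, m, (f t), (g t); simpl; ring).
    now apply (is_derive_minus (V := R_NormedModule)).
  - replace (Im (l * g t + f t * m)) with
      ((Re l * Im (g t) + Re (f t) * Im m) + (Im l * Re (g t) + Im (f t) * Re m))%R
      by (destruct l, m, (f t), (g t); simpl; ring).
    now apply (is_derive_plus (V := R_NormedModule)).
Qed.

Lemma RCderiv_ext_loc (f g : R -> C) (t : R) (l : C) :
  locally t (fun u => f u = g u) -> RCderiv f t l -> RCderiv g t l.
Proof.
  intros H [H1 H2]. split.
  - apply (is_derive_ext_loc (fun u => Re (f u))); [|exact H1].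
    revert H. apply filter_imp. now intros u ->.
  - apply (is_derive_ext_loc (fun u => Im (f u))); [|exact H2].
    revert H. apply filter_imp. now intros u ->.
Qed.

(** * Powers of a variable in [0, 1] *)

(** The power t^z, with value 0 for t <= 0, so that it is continuous at 0 if
    Re z >= 1. *)
Definition tpow (t : R) (z : C) : C :=
  if Rlt_dec 0 t then Cpower (RtoC t) z else 0.

Lemma tpow_pos (t : R) (z : C) : 0 < t -> tpow t z = Cpower (RtoC t) z.
Proof. intros H. unfold tpow. destruct (Rlt_dec 0 t); [reflexivity | lra]. Qed.

Lemma tpow_nonpos (t : R) (z : C) : t <= 0 -> tpow t z = 0.
Proof. intros H. unfold tpow. destruct (Rlt_dec 0 t); [lra | reflexivity]. Qed.

Lemma slit_pos (t : R) : 0 < t -> slit (RtoC t).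
Proof. now left. Qed.

Lemma RtoC_neq_0 (t : R) : 0 < t -> RtoC t <> 0.
Proof. intros H E. injection E. lra. Qed.

Lemma tpow_1 (z : C) : tpow 1 z = 1.
Proof.
  rewrite tpow_pos by lra. unfold Cpower. rewrite Clog_pos, ln_1 by lra.
  rewrite Cmult_0_r. apply Cexp_0.
Qed.

Lemma tpow_bound (t : R) (z : C) (n : nat) :
  (INR n <= Re z) -> t <= 1 -> Cmod (tpow t z) <= Rabs t ^ n.
Proof.
  intros Hz Ht. destruct (Rlt_dec 0 t) as [H|H].
  - rewrite tpow_pos, Cmod_Cpower_pos, Rabs_pos_eq by lra.
    rewrite <- Rpower_pow by exact H. unfold Rpower.
    assert (L : ln t <= 0) by (rewrite <- ln_1; apply ln_le; lra).
    destruct (Req_dec (Re z * ln t) (INR n * ln t)) as [->|E]; [lra|].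
    left. apply exp_increasing. nra.
  - rewrite tpow_nonpos, Cmod_0 by lra. apply pow_le, Rabs_pos.
Qed.

Lemma tpow_le_1 (t : R) (z : C) : 0 <= Re z -> t <= 1 -> Cmod (tpow t z) <= 1.
Proof. intros Hz Ht. apply (tpow_bound t z 0); simpl; lra. Qed.

Lemma tpow_mult_nat (t : R) (z : C) (n : nat) :
  tpow t z * RtoC t ^ n = tpow t (z + INR n).
Proof.
  destruct (Rlt_dec 0 t) as [H|H].
  - rewrite !tpow_pos, Cpower_add, Cpower_nat by auto using RtoC_neq_0. reflexivity.
  - rewrite !tpow_nonpos by lra. ring.
Qed.

Lemma tpow_continuous (z : C) (t : R) : 1 <= Re z -> RCcontinuous (fun u => tpow u z) t.
Proof.
  intros Hz. destruct (Rlt_dec 0 t) as [H|H].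
  - assert (D := RCcontinuous_comp RtoC _ t (RCcontinuous_id t)
        (Cdiff_continuous _ _ _ (Cdiff_Cpower (RtoC t) z (slit_pos t H)))).
    apply RCcontinuous_eps. intros e He.
    destruct (RCcontinuous_eps_inv _ _ D e He) as (d & Dd & P).
    exists (Rmin d t). split; [now apply Rmin_pos|]. intros u Hu.
    assert (H1 := Rlt_le_trans _ _ _ Hu (Rmin_l _ _)).
    assert (H2 := Rlt_le_trans _ _ _ Hu (Rmin_r _ _)). apply Rabs_def2 in H2.
    rewrite !tpow_pos by lra. now apply P.
  - apply RCcontinuous_eps. intros e He. exists (Rmin e 1).
    split; [apply Rmin_pos; lra|]. intros u Hu.
    assert (H1 := Rlt_le_trans _ _ _ Hu (Rmin_l _ _)).
    assert (H2 := Rlt_le_trans _ _ _ Hu (Rmin_r _ _)).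
    rewrite (tpow_nonpos t) by lra. replace (tpow u z - 0) with (tpow u z) by ring.
    destruct (Rlt_dec 0 u) as [U|U].
    + rewrite Rabs_pos_eq in H1, H2 by lra.
      eapply Rle_lt_trans; [apply (tpow_bound u z 1); simpl; lra|].
      rewrite pow_1, Rabs_pos_eq by lra. lra.
    + rewrite tpow_nonpos, Cmod_0 by lra. exact He.
Qed.

Lemma tpow_deriv (z : C) (t : R) :
  (2 <= Re z) -> 0 <= t -> RCderiv (fun u => tpow u z) t (z * tpow t (z - 1)).
Proof.
  intros Hz Ht. destruct (Rlt_dec 0 t) as [H|H].
  - apply (RCderiv_ext_loc (fun u => Cpower (RtoC u) z)).
    + exists (mkposreal t H). intros u Hu. apply Rabs_def2 in Hu. simpl in Hu.
      unfold minus, plus, opp in Hu; simpl in Hu. rewrite tpow_pos by lra. reflexivity.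
    + replace (z * tpow t (z - 1)) with (z * Cpower (RtoC t) z / RtoC t).
      * apply (RCderiv_Cdiff (fun w => Cpower w z)). now apply Cdiff_Cpower, slit_pos.
      * rewrite tpow_pos by exact H. unfold Cminus. rewrite Cpower_add, Cpower_opp, Cpower_1
          by now apply RtoC_neq_0. unfold Cdiv. ring.
  - replace t with 0%R by lra. rewrite (tpow_nonpos 0) by lra.
    apply RCderiv_eps. intros e He. exists (Rmin e 1).
    split; [apply Rmin_pos; lra|]. intros h Hh.
    assert (H1 := Rlt_le_trans _ _ _ Hh (Rmin_l _ _)).
    assert (H2 := Rlt_le_trans _ _ _ Hh (Rmin_r _ _)). apply Rabs_def2 in H2.
    rewrite Rplus_0_l, (tpow_nonpos 0) by lra.
    replace (tpow h z - 0 - z * 0 * RtoC h) with (tpow h z) by ring.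
    eapply Rle_trans; [apply (tpow_bound h z 2); simpl; lra|].
    simpl. rewrite Rmult_1_r. apply Rmult_le_compat_r; [apply Rabs_pos | lra].
Qed.

Lemma CRInt_tpow (z : C) : 1 <= Re z ->
  CRInt (fun t => tpow t z) 0 1 = / (z + 1).
Proof.
  intros Hz.
  assert (N : z + 1 <> 0).
  { intros E. apply (f_equal Re) in E. change (Re z + 1 = 0)%R in E. lra. }
  assert (H := CRInt_derive 0 1 ltac:(lra) (fun t => tpow t (z + 1)) (fun t => (z + 1) * tpow t z)).
  cbv beta in H. rewrite tpow_1, (tpow_nonpos 0) in H by lra.
  rewrite CRInt_scal in H by (try lra; intros; now apply tpow_continuous).
  replace (CRInt (fun t => tpow t z) 0 1)
    with ((z + 1) * CRInt (fun t => tpow t z) 0 1 / (z + 1)) by (field; exact N).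
  rewrite H.
  - field; exact N.
  - intros t Ht. replace (tpow t z) with (tpow t (z + 1 - 1)) by (f_equal; ring).
    apply tpow_deriv; [change (2 <= Re z + 1); lra | lra].
  - intros t Ht. apply RCcontinuous_mult; [apply RCcontinuous_const | now apply tpow_continuous].
Qed.

(** * Euler integrals as analytic functions on the cut plane *)

Lemma cut_plane_dist (x : C) : cut_plane x ->
  exists rho : R, 0 < rho /\ forall t : R, 0 <= t <= 1 -> rho <= Cmod (1 - x * RtoC t).
Proof.
  intros Hx. assert (X0 := Cmod_ge_0 x).
  destruct (Req_dec (Im x) 0) as [E|E].
  - assert (Hr : Re x < 1).
    { destruct (Rlt_dec (Re x) 1); [assumption|]. exfalso. apply Hx. split; [exact E | lra]. }
    exists (Rmin 1 (1 - Re x)). split; [apply Rmin_pos; lra|]. intros t Ht.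
    apply Rle_trans with (1 - Re x * t)%R.
    + destruct (Rle_dec 0 (Re x)).
      * eapply Rle_trans; [apply Rmin_r|]. nra.
      * eapply Rle_trans; [apply Rmin_l|]. nra.
    + eapply Rle_trans; [|apply re_le_Cmod]. eapply Rle_trans; [|apply Rle_abs].
      change (1 - Re x * t <= 1 - Re (x * RtoC t)). rewrite re_scal_r. lra.
  - assert (P := Rabs_pos_lt _ E).
    assert (Q : 0 < Rabs (Im x) / (2 * (Cmod x + 1))) by (apply Rdiv_lt_0_compat; lra).
    exists (Rmin (1 / 2) (Rabs (Im x) / (2 * (Cmod x + 1)))).
    split; [apply Rmin_pos; lra|]. intros t Ht.
    destruct (Rle_dec (Cmod x * t) (1 / 2)) as [H|H].
    + eapply Rle_trans; [apply Rmin_l|].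
      assert (T := Cmod_triangle (1 - x * RtoC t) (x * RtoC t)).
      replace (1 - x * RtoC t + x * RtoC t) with (RtoC 1) in T by ring.
      rewrite Cmod_1, Cmod_mult, Cmod_R, Rabs_pos_eq in T by lra. lra.
    + eapply Rle_trans; [apply Rmin_r|]. eapply Rle_trans; [|apply Im_le_Cmod].
      replace (Im (1 - x * RtoC t)) with (- (Im x * t))%R.
      * rewrite Rabs_Ropp, Rabs_mult, (Rabs_pos_eq t) by lra.
        apply Rle_div_l; nra.
      * change (- (Im x * t) = 0 - Im (x * RtoC t))%R. rewrite im_mult. simpl. ring.
Qed.

(** The distance from 1 - x t to the cut (-oo, 0] is controlled by the values of
    |1 - x t'|, because 1 + r - x t = (1 + r) (1 - x t / (1 + r)) for r >= 0. *)
Lemma slit_of_dist (x z : C) (rho t : R) :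
  (forall t : R, 0 <= t <= 1 -> rho <= Cmod (1 - x * RtoC t)) ->
  (0 <= t <= 1) -> Cmod z < rho -> slit (1 - x * RtoC t - z).
Proof.
  intros H Ht Hz. set (w := 1 - x * RtoC t - z).
  destruct (Req_dec (Im w) 0) as [E|E]; [left | right; exact E].
  destruct (Rlt_dec 0 (Re w)) as [P|P]; [exact P | exfalso].
  set (r := (- Re w)%R).
  assert (R0 : 0 < 1 + r) by (unfold r; lra).
  assert (Ew : w = - RtoC r) by (apply C_ext; [unfold r; simpl; ring | rewrite E; simpl; ring]).
  assert (Ez : z = RtoC (1 + r) * (1 - x * RtoC (t / (1 + r)))).
  { replace z with (1 - x * RtoC t - w) by (unfold w; ring). rewrite Ew.
    rewrite RtoC_div by lra. set (q := RtoC (1 + r)).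
    replace (RtoC r) with (q - 1) by (unfold q; rewrite RtoC_plus; ring).
    field. now apply RtoC_neq_0. }
  assert (T : 0 <= t / (1 + r) <= 1).
  { split; [apply Rle_div_r | apply Rle_div_l]; unfold r in *; lra. }
  specialize (H _ T). apply (f_equal Cmod) in Ez.
  rewrite Cmod_mult, Cmod_R, Rabs_pos_eq in Ez by lra.
  assert (M := Cmod_ge_0 z). unfold r in *. nra.
Qed.

Lemma cut_plane_slit (x : C) (t : R) : cut_plane x -> 0 <= t <= 1 -> slit (1 - x * RtoC t).
Proof.
  intros Hx Ht. destruct (cut_plane_dist x Hx) as (rho & R0 & H).
  replace (1 - x * RtoC t) with (1 - x * RtoC t - 0) by ring.
  apply (slit_of_dist x 0 rho t); auto. now rewrite Cmod_0.
Qed.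

Lemma Cmod_Cpower_le (u w : C) (r s : R) :
  (0 < r) -> r <= Cmod u <= s ->
  (Cmod (Cpower u w) <= exp (Rabs (Re w) * (Rabs (ln r) + Rabs (ln s)) + Rabs (Im w) * PI)).
Proof.
  intros Hr Hu. unfold Cpower. rewrite Cmod_Cexp.
  assert (L1 : ln r <= ln (Cmod u)) by (apply ln_le; lra).
  assert (L2 : ln (Cmod u) <= ln s) by (apply ln_le; lra).
  assert (A := Carg_bound u ltac:(apply Cmod_gt_0; lra)).
  rewrite re_mult. simpl.
  match goal with |- (exp ?p <= exp ?q) => assert (H : p <= q) end.
  { change (fst w) with (Re w). change (snd w) with (Im w).
    assert (B : Rabs (ln (Cmod u)) <= Rabs (ln r) + Rabs (ln s)).
    { apply Rabs_le. assert (X := Rle_abs (- ln r)). rewrite Rabs_Ropp in X.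
      assert (Y := Rle_abs (ln s)). assert (Z := Rabs_pos (ln r)).
      assert (W := Rabs_pos (ln s)). lra. }
    assert (B' : Rabs (Carg u) <= PI) by (apply Rabs_le; lra).
    assert (Q1 := Rle_abs (Re w * ln (Cmod u))).
    assert (Q2 := Rle_abs (- (Im w * Carg u))).
    rewrite Rabs_Ropp in Q2. rewrite Rabs_mult in Q1, Q2.
    assert (Q3 := Rmult_le_compat_l _ _ _ (Rabs_pos (Re w)) B).
    assert (Q4 := Rmult_le_compat_l _ _ _ (Rabs_pos (Im w)) B'). lra. }
  destruct (Rle_lt_or_eq_dec _ _ H) as [H'|H'].
  - left. now apply exp_increasing.
  - right. now rewrite H'.
Qed.

Definition euler_int (phi : R -> C) (b x : C) : C :=
  CRInt (fun t => phi t * Cpower (1 - x * RtoC t) (- b)) 0 1.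

Definition euler_term (phi : R -> C) (b x : C) (n : nat) (t : R) : C :=
  phi t * (binom_coef b n * (RtoC t ^ n * Cpower (1 - x * RtoC t) (- b - INR n))).

(** Taylor coefficient of [euler_int phi b] at x. *)
Definition euler_coef (phi : R -> C) (b x : C) (n : nat) : C :=
  CRInt (euler_term phi b x n) 0 1.

Section EulerIntegral.

Variables (phi : R -> C) (b : C) (B : R).
Hypothesis phi_continuous : forall t, 0 <= t <= 1 -> RCcontinuous phi t.
Hypothesis phi_bound : forall t, 0 <= t <= 1 -> Cmod (phi t) <= B.

Lemma affine_continuous (x : C) (t : R) : RCcontinuous (fun u => 1 - x * RtoC u) t.
Proof.
  apply RCcontinuous_plus; [apply RCcontinuous_const|].
  assert (H := RCcontinuous_mult _ _ t (RCcontinuous_const (- x) t) (RCcontinuous_id t)).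
  destruct H as [H1 H2]. split.
  - revert H1. apply continuous_ext. intros u. simpl. ring.
  - revert H2. apply continuous_ext. intros u. simpl. ring.
Qed.

Lemma kernel_continuous (w x : C) (t : R) : slit (1 - x * RtoC t) ->
  RCcontinuous (fun u => Cpower (1 - x * RtoC u) w) t.
Proof.
  intros H. apply (RCcontinuous_comp (fun u => 1 - x * RtoC u) (fun v => Cpower v w)).
  - apply affine_continuous.
  - eapply Cdiff_continuous. now apply Cdiff_Cpower.
Qed.

Lemma euler_integrand_continuous (w x : C) (t : R) :
  (0 <= t <= 1) -> slit (1 - x * RtoC t) ->
  RCcontinuous (fun u => phi u * Cpower (1 - x * RtoC u) w) t.
Proof.
  intros Ht H.
  apply RCcontinuous_mult; [now apply phi_continuous | now apply kernel_continuous].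
Qed.

Lemma euler_term_continuous (x : C) (n : nat) (t : R) :
  0 <= t <= 1 -> slit (1 - x * RtoC t) -> RCcontinuous (euler_term phi b x n) t.
Proof.
  intros Ht H. apply RCcontinuous_mult; [now apply phi_continuous|].
  apply RCcontinuous_mult; [apply RCcontinuous_const|].
  apply RCcontinuous_mult; [apply RCcontinuous_pow, RCcontinuous_id | now apply kernel_continuous].
Qed.

Lemma euler_term_bound (x : C) (rho : R) : 0 < rho ->
  (forall t : R, 0 <= t <= 1 -> rho <= Cmod (1 - x * RtoC t)) ->
  exists M, 0 <= M /\ forall n t, 0 <= t <= 1 ->
    Cmod (euler_term phi b x n t) <= M * Cmod (binom_coef b n) * (/ rho) ^ n.
Proof.
  intros R0 Hrho.
  set (E := exp (Rabs (Re (- b)) * (Rabs (ln rho) + Rabs (ln (1 + Cmod x)))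
               + Rabs (Im (- b)) * PI)).
  assert (E0 : 0 < E) by apply exp_pos.
  assert (B0 : 0 <= B).
  { eapply Rle_trans; [apply Cmod_ge_0 | apply (phi_bound 0); lra]. }
  exists (B * E)%R. split; [apply Rmult_le_pos; lra|]. intros n t Ht.
  specialize (Hrho t Ht). set (u := 1 - x * RtoC t) in *.
  assert (Hu : u <> 0) by (apply Cmod_gt_0; lra).
  assert (Hu2 : Cmod u <= 1 + Cmod x).
  { unfold u, Cminus. eapply Rle_trans; [apply Cmod_triangle|].
    rewrite Cmod_1, Cmod_opp, Cmod_mult, Cmod_R, Rabs_pos_eq by lra.
    assert (X := Cmod_ge_0 x). nra. }
  unfold euler_term. fold u. rewrite Cpower_sub_nat by exact Hu.
  rewrite !Cmod_mult, Cmod_div, !Cmod_pow, Cmod_R, Rabs_pos_eq by (try apply Cpow_nz; auto; lra).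
  assert (Tn : 0 <= t ^ n <= 1).
  { split; [apply pow_le; lra|]. rewrite <- (pow1 n). apply pow_incr. lra. }
  assert (Un : 0 <= / Cmod u ^ n <= (/ rho) ^ n).
  { assert (P := pow_lt rho n R0). rewrite pow_inv.
    assert (P2 : rho ^ n <= Cmod u ^ n) by (apply pow_incr; lra).
    split; [left; apply Rinv_0_lt_compat; lra | now apply Rinv_le_contravar]. }
  assert (K := Cmod_Cpower_le u (- b) rho (1 + Cmod x) R0 ltac:(lra)). fold E in K.
  assert (K0 := Cmod_ge_0 (Cpower u (- b))). assert (P0 := Cmod_ge_0 (phi t)).
  assert (b0 := Cmod_ge_0 (binom_coef b n)). specialize (phi_bound t Ht).
  apply Rle_trans with (B * (Cmod (binom_coef b n) * (1 * (E * (/ rho) ^ n))))%R;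
    [|right; ring].
  unfold Rdiv. apply Rmult_le_compat; [exact P0| |exact phi_bound|].
  - apply Rmult_le_pos; [exact b0|]. apply Rmult_le_pos; [lra|]. apply Rmult_le_pos; lra.
  - apply Rmult_le_compat_l; [exact b0|].
    apply Rmult_le_compat; [lra | apply Rmult_le_pos; lra | lra |].
    apply Rmult_le_compat; lra.
Qed.

(** Binomial expansion of (1 - x t - h t)^(-b) about 1 - x t, integrated term by term.
    This gives analyticity in the form required, a power series about each point. *)
Lemma euler_int_taylor (x : C) (rho : R) : 0 < rho ->
  (forall t : R, 0 <= t <= 1 -> rho <= Cmod (1 - x * RtoC t)) ->
  forall h : C, Cmod h < rho ->
  is_Cseries (fun n => euler_coef phi b x n * h ^ n) (euler_int phi b (x + h)).
Proof.
  intros R0 Hrho h Hh. assert (H0 := Cmod_ge_0 h).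
  destruct (euler_term_bound x rho R0 Hrho) as (M & M0 & HM).
  destruct (binom_coef_summable b (Cmod h / rho)) as [G HG].
  { split; [apply Rle_div_r; lra | apply Rlt_div_l; lra]. }
  assert (Sl : forall t z, 0 <= t <= 1 -> Cmod z < rho -> slit (1 - x * RtoC t - z))
    by (intros; now apply (slit_of_dist x z rho)).
  assert (Sl0 : forall t, 0 <= t <= 1 -> slit (1 - x * RtoC t)).
  { intros t Ht. replace (1 - x * RtoC t) with (1 - x * RtoC t - 0) by ring.
    apply Sl; [exact Ht | now rewrite Cmod_0]. }
  assert (Hht : forall t, 0 <= t <= 1 -> Cmod (h * RtoC t) <= Cmod h).
  { intros t Ht. rewrite Cmod_mult, Cmod_R, Rabs_pos_eq by lra. nra. }
  set (f := fun n t => h ^ n * euler_term phi b x n t).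
  assert (Hf : forall n t, 0 <= t <= 1 -> RCcontinuous (f n) t).
  { intros n t Ht. apply RCcontinuous_mult; [apply RCcontinuous_const|].
    apply euler_term_continuous; auto. }
  apply is_Cseries_ext with (fun n => CRInt (f n) 0 1).
  { intros n. unfold f, euler_coef. rewrite CRInt_scal; [ring | lra|].
    intros t Ht. apply euler_term_continuous; auto. }
  apply (CRInt_series 0 1 ltac:(lra) f _ (fun n => M * (Cmod (binom_coef b n) * (Cmod h / rho) ^ n))%R
           (M * G)%R).
  - exact Hf.
  - intros t Ht. apply euler_integrand_continuous; [exact Ht|].
    replace (1 - (x + h) * RtoC t) with (1 - x * RtoC t - h * RtoC t) by ring.
    apply Sl; [exact Ht|]. eapply Rle_lt_trans; [now apply Hht | exact Hh].
  - now apply summable_scal.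
  - intros n t Ht. unfold f. rewrite Cmod_mult, Cmod_pow.
    eapply Rle_trans.
    + apply Rmult_le_compat_l; [now apply pow_le | apply (HM n t); lra].
    + right. unfold Rdiv. rewrite Rpow_mult_distr. ring.
  - intros t Ht. assert (Ht' : 0 <= t <= 1) by lra.
    assert (Hu := slit_neq_0 _ (Sl0 t Ht')).
    replace (1 - (x + h) * RtoC t) with (1 - x * RtoC t - h * RtoC t) by ring.
    assert (S := binomial_series b (1 - x * RtoC t) (h * RtoC t)).
    apply (is_Cseries_scal (phi t)) in S.
    + eapply is_Cseries_ext; [|exact S]. intros n. unfold f, euler_term. cbv beta.
      rewrite Cpower_sub_nat by exact Hu. unfold Cdiv. rewrite !Cpow_mult_l, Cpow_inv by exact Hu. ring.
    + eapply Rle_lt_trans; [now apply Hht|]. eapply Rlt_le_trans; [exact Hh | now apply Hrho].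
    + intros tau Htau. apply Sl; [exact Ht'|].
      rewrite Cmod_mult, Cmod_R, Rabs_pos_eq by lra.
      specialize (Hht t Ht'). assert (Q := Cmod_ge_0 (h * RtoC t)). nra.
Qed.

Lemma euler_int_diff (x : C) : cut_plane x ->
  Cdiff (euler_int phi b) x (euler_coef phi b x 1).
Proof.
  intros Hx. destruct (cut_plane_dist x Hx) as (rho & R0 & Hrho).
  destruct (euler_term_bound x rho R0 Hrho) as (M & M0 & HM).
  destruct (binom_coef_bound b 2 ltac:(lra)) as (M' & M'0 & HM').
  assert (Sl0 : forall t, 0 <= t <= 1 -> slit (1 - x * RtoC t))
    by (intros; now apply cut_plane_slit).
  destruct (Cdiff_power_series (euler_coef phi b x) (fun h => euler_int phi b (x + h)) (rho / 2)
              (2 * (1 - 0) * (M * M')) 0) as (l & Hl & D).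
  - intros n.
    assert (P : 0 < (rho / 2) ^ n) by (apply pow_lt; lra).
    assert (I : 0 < / rho) by now apply Rinv_0_lt_compat.
    assert (Bd : Cmod (euler_coef phi b x n)
                  <= 2 * (1 - 0) * (M * Cmod (binom_coef b n) * (/ rho) ^ n)).
    { apply CRInt_bound; [lra| |].
      - intros t Ht. apply euler_term_continuous; auto.
      - intros t Ht. apply HM. lra. }
    eapply Rle_trans; [apply Rmult_le_compat_r; [lra | exact Bd]|].
    replace (2 * (1 - 0) * (M * Cmod (binom_coef b n) * (/ rho) ^ n) * (rho / 2) ^ n)%R
      with (2 * (1 - 0) * (M * (Cmod (binom_coef b n) * (/ 2) ^ n)))%R.
    + apply Rmult_le_compat_l; [lra|]. apply Rmult_le_compat_l; [exact M0|].
      specialize (HM' n). assert (P2 := pow_lt 2 n ltac:(lra)).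
      rewrite pow_inv. apply (Rle_div_l _ _ _ P2). exact HM'.
    + replace (rho / 2)%R with (rho * / 2)%R by reflexivity. rewrite Rpow_mult_distr, !pow_inv.
      assert (P3 := pow_lt rho n R0). assert (P2 := pow_lt 2 n ltac:(lra)). field. lra.
  - intros h Hh. apply (euler_int_taylor x rho); auto. lra.
  - rewrite Cmod_0. lra.
  - replace (euler_coef phi b x 1) with l.
    + intros e He. destruct (D e He) as (d & Dd & P). exists d. split; [exact Dd|].
      intros h Hh. specialize (P h Hh). cbv beta in P.
      now replace (x + (0 + h)) with (x + h) in P by ring; replace (x + 0) with x in P by ring.
    + apply (is_Cseries_unique _ _ _ Hl).
      replace (euler_coef phi b x 1)
        with (Csum 2 (fun n => RtoC (INR n) * euler_coef phi b x n * 0 ^ pred n))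
        by (simpl; ring).
      apply is_Cseries_finite. intros n Hn. destruct n as [|[|n]]; [lia | lia|].
      simpl pred. rewrite Cpow_S. ring.
Qed.

End EulerIntegral.

Lemma CRInt_comp (f : R -> C) (g dg : R -> R) (a b : R) :
  (forall t, Rmin a b <= t <= Rmax a b -> RCcontinuous f (g t)) ->
  (forall t, Rmin a b <= t <= Rmax a b -> is_derive g t (dg t) /\ continuous dg t) ->
  CRInt (fun t => RtoC (dg t) * f (g t)) a b = CRInt f (g a) (g b).
Proof.
  intros Hf Hg. apply C_ext; simpl.
  - rewrite <- (RInt_comp (V := R_CompleteNormedModule) (fun t => Re (f t)) g dg a b).
    + apply RInt_ext. intros t _. change (Re (RtoC (dg t) * f (g t)) = (dg t * Re (f (g t)))%R).
      now rewrite re_scal_l.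
    + intros t Ht. apply (Hf t Ht).
    + exact Hg.
  - rewrite <- (RInt_comp (V := R_CompleteNormedModule) (fun t => Im (f t)) g dg a b).
    + apply RInt_ext. intros t _. change (Im (RtoC (dg t) * f (g t)) = (dg t * Im (f (g t)))%R).
      rewrite im_mult. simpl. ring.
    + intros t Ht. apply (Hf t Ht).
    + exact Hg.
Qed.

Lemma CRInt_Chasles (f : R -> C) (a b c : R) :
  (a <= b <= c) -> (forall t, (a <= t <= c) -> RCcontinuous f t) ->
  CRInt f a b + CRInt f b c = CRInt f a c.
Proof.
  intros H Hf.
  destruct (RCcontinuous_ex_RInt a b ltac:(lra) f) as [A1 A2]; [intros t Ht; apply Hf; lra|].
  destruct (RCcontinuous_ex_RInt b c ltac:(lra) f) as [B1 B2]; [intros t Ht; apply Hf; lra|].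
  apply C_ext; simpl; now apply (RInt_Chasles (V := R_CompleteNormedModule)).
Qed.

Lemma CRInt_swap (f : R -> C) (a b : R) :
  (a <= b) -> (forall t, (a <= t <= b) -> RCcontinuous f t) ->
  CRInt f b a = - CRInt f a b.
Proof.
  intros H Hf. destruct (RCcontinuous_ex_RInt a b H f Hf) as [A1 A2].
  apply C_ext.
  - symmetry. exact (opp_RInt_swap (V := R_CompleteNormedModule) _ _ _ A1).
  - symmetry. exact (opp_RInt_swap (V := R_CompleteNormedModule) _ _ _ A2).
Qed.

(** * The Beta integral *)

Lemma Cpower_1_l (w : C) : Cpower 1 w = 1.
Proof. unfold Cpower. rewrite Clog_pos, ln_1 by lra. rewrite Cmult_0_r. apply Cexp_0. Qed.

Definition beta_integrand (s r : C) (v : R) : C := tpow v (s - 1) * tpow (1 - v) (r - 1).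

Lemma beta_integrand_continuous (s r : C) (v : R) :
  (2 <= Re s) -> 2 <= Re r -> RCcontinuous (beta_integrand s r) v.
Proof.
  intros Hs Hr.
  assert (A := tpow_continuous (s - 1) v ltac:(change (1 <= Re s - 1); lra)).
  assert (B := tpow_continuous (r - 1) (1 - v) ltac:(change (1 <= Re r - 1); lra)).
  apply RCcontinuous_mult; [exact A|].
  assert (L : continuous (fun u => 1 - u)%R v).
  { apply (continuous_minus (V := R_NormedModule)); [apply continuous_const | apply continuous_id]. }
  destruct B as [B1 B2]. split.
  - now apply (continuous_comp (fun u => 1 - u)%R (fun u => Re (tpow u (r - 1)))).
  - now apply (continuous_comp (fun u => 1 - u)%R (fun u => Im (tpow u (r - 1)))).
Qed.

Lemma binomial_series_real (r : C) (v : R) : 0 < v < 1 ->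
  is_Cseries (fun n => binom_coef (1 - r) n * RtoC v ^ n) (tpow (1 - v) (r - 1)).
Proof.
  intros Hv.
  assert (S := binomial_series (1 - r) 1 (RtoC v)).
  rewrite tpow_pos by lra. rewrite RtoC_minus.
  replace (r - 1) with (- (1 - r)) by ring.
  eapply is_Cseries_ext; [|apply S].
  - intros n. cbv beta. rewrite Cpower_1_l.
    replace (RtoC v / 1) with (RtoC v) by field. ring.
  - rewrite Cmod_1, Cmod_R, Rabs_pos_eq; lra.
  - intros tau Ht. left. simpl. nra.
Qed.

(** Expanding (1 - v)^(r-1) in powers of v and integrating gives the series summed in
    [beta_series]. *)
Lemma beta_integral (s r : C) : 2 <= Re s -> 2 <= Re r ->
  CRInt (beta_integrand s r) 0 1 = rGamma (s + r) / (rGamma s * rGamma r).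
Proof.
  intros Hs Hr. destruct (binom_coef_summable_1 r Hr) as [G HG].
  assert (Hs1 : forall n, 1 <= Re (s - 1 + INR n)).
  { intros n. change (1 <= Re s - 1 + INR n). assert (P := pos_INR n). lra. }
  apply (is_Cseries_unique (fun k => binom_coef (1 - r) k / (s + INR k)));
    [|apply beta_series; [exact Hr | apply nonpole_Re; lra]].
  apply is_Cseries_ext with
    (fun k => CRInt (fun v => binom_coef (1 - r) k * tpow v (s - 1 + INR k)) 0 1).
  { intros k. rewrite CRInt_scal by (try lra; intros; apply tpow_continuous, Hs1).
    rewrite CRInt_tpow by apply Hs1. unfold Cdiv. do 2 f_equal. ring. }
  apply (CRInt_series 0 1 ltac:(lra)
           (fun k v => binom_coef (1 - r) k * tpow v (s - 1 + INR k)) (beta_integrand s r)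
           (fun k => Cmod (binom_coef (1 - r) k)) G).
  - intros k t _. apply RCcontinuous_mult; [apply RCcontinuous_const | apply tpow_continuous, Hs1].
  - intros t _. now apply beta_integrand_continuous.
  - exact HG.
  - intros k t Ht. rewrite Cmod_mult.
    apply Rle_trans with (Cmod (binom_coef (1 - r) k) * 1)%R; [|lra].
    apply Rmult_le_compat_l; [apply Cmod_ge_0|].
    apply tpow_le_1; [specialize (Hs1 k); lra | lra].
  - intros t Ht.
    eapply is_Cseries_ext; [|apply (is_Cseries_scal (tpow t (s - 1)) _ _ (binomial_series_real r t Ht))].
    intros k. cbv beta. rewrite <- tpow_mult_nat. ring.
Qed.

Lemma Cpower_pos (x : R) (w : C) : 0 < x -> Cpower (RtoC x) w = Cexp (w * RtoC (ln x)).
Proof. intros H. unfold Cpower. now rewrite Clog_pos. Qed.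

Lemma inv_sqr_Cexp (L x : R) : 0 < x -> L = ln x -> RtoC (/ (x * x)) = Cexp (- 2 * RtoC L).
Proof.
  intros Hx ->. replace (-2 * RtoC (ln x)) with (- (RtoC (ln x) + RtoC (ln x))) by ring.
  rewrite Cexp_opp, Cexp_add. rewrite RtoC_inv by nra. rewrite RtoC_mult. f_equal.
  rewrite <- (Cmult_1_l (RtoC (ln x))), <- Cpower_pos, Cpower_1 by auto using RtoC_neq_0.
  reflexivity.
Qed.

(** The two halves of the Beta integral are mapped to [0, 1] by v = t/(1+t) and
    v = 1/(1+t), which turns both into Euler integrals at x = -1. *)
Lemma beta_integral_folded (s r : C) : 2 <= Re s -> 2 <= Re r ->
  euler_int (fun t => tpow t (s - 1)) (s + r) (- (1))
  + euler_int (fun t => tpow t (r - 1)) (s + r) (- (1))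
  = rGamma (s + r) / (rGamma s * rGamma r).
Proof.
  intros Hs Hr. rewrite <- beta_integral by assumption.
  assert (Cf := fun v => beta_integrand_continuous s r v Hs Hr).
  rewrite <- (CRInt_Chasles _ 0 (1 / 2) 1) by (try lra; intros; apply Cf).
  f_equal.
  - replace (CRInt (beta_integrand s r) 0 (1 / 2))
      with (CRInt (beta_integrand s r) (0 / (1 + 0)) (1 / (1 + 1))) by (f_equal; field).
    rewrite <- (CRInt_comp (beta_integrand s r) (fun t => t / (1 + t))%R
                  (fun t => / ((1 + t) * (1 + t)))%R).
    + apply CRInt_ext; [lra|]. intros t Ht. unfold beta_integrand.
      assert (P : 0 < t / (1 + t)) by (apply Rdiv_lt_0_compat; lra).
      replace (1 - t / (1 + t))%R with (/ (1 + t))%R by (field; lra).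
      assert (Q : 0 < / (1 + t)) by (apply Rinv_0_lt_compat; lra).
      rewrite !tpow_pos by lra.
      replace (1 - - (1) * RtoC t) with (RtoC (1 + t)) by (rewrite RtoC_plus; ring).
      rewrite !Cpower_pos by lra. rewrite (inv_sqr_Cexp (ln (1 + t))) by lra.
      rewrite <- !Cexp_add. f_equal. unfold Rdiv.
      rewrite ln_mult, ln_Rinv by lra. rewrite RtoC_plus, RtoC_opp. ring.
    + intros; apply Cf.
    + intros t Ht. rewrite Rmin_left, Rmax_right in Ht by lra. split.
      * auto_derive; [lra|]. field. lra.
      * apply continuity_pt_filterlim, derivable_continuous_pt.
        apply ex_derive_Reals_0. auto_derive. nra.
  - assert (E : CRInt (beta_integrand s r) (1 / 2) 1 = - CRInt (beta_integrand s r) 1 (1 / 2)).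
    { rewrite (CRInt_swap _ (1 / 2) 1) by (try lra; intros; apply Cf). ring. }
    rewrite E. replace (CRInt (beta_integrand s r) 1 (1 / 2))
      with (CRInt (beta_integrand s r) (/ (1 + 0)) (/ (1 + 1))) by (f_equal; field).
    rewrite <- (CRInt_comp (beta_integrand s r) (fun t => / (1 + t))%R
                  (fun t => - / ((1 + t) * (1 + t)))%R).
    + replace (- CRInt (fun t => RtoC (- / ((1 + t) * (1 + t))) * beta_integrand s r (/ (1 + t))) 0 1)
        with (-1 * CRInt (fun t => RtoC (- / ((1 + t) * (1 + t))) * beta_integrand s r (/ (1 + t))) 0 1)
        by ring.
      rewrite <- CRInt_scal; [|lra|].
      * apply CRInt_ext; [lra|]. intros t Ht. unfold beta_integrand.
        assert (Q : 0 < / (1 + t)) by (apply Rinv_0_lt_compat; lra).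
        replace (1 - / (1 + t))%R with (t / (1 + t))%R by (field; lra).
        assert (P : 0 < t / (1 + t)) by (apply Rdiv_lt_0_compat; lra).
        rewrite !tpow_pos by lra.
        replace (1 - - (1) * RtoC t) with (RtoC (1 + t)) by (rewrite RtoC_plus; ring).
        rewrite !Cpower_pos, RtoC_opp by lra. rewrite (inv_sqr_Cexp (ln (1 + t))) by lra.
        rewrite Cmult_assoc. replace (-1 * - Cexp (-2 * RtoC (ln (1 + t))))
          with (Cexp (-2 * RtoC (ln (1 + t)))) by ring.
        rewrite <- !Cexp_add. f_equal. unfold Rdiv.
        rewrite ln_mult, ln_Rinv by lra. rewrite RtoC_plus, RtoC_opp. ring.
      * intros t Ht. apply RCcontinuous_mult.
        -- apply RCcontinuous_RtoC, continuity_pt_filterlim, derivable_continuous_pt.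
           apply ex_derive_Reals_0. auto_derive. nra.
        -- destruct (Cf (/ (1 + t))%R) as [C1 C2].
           assert (L : continuous (fun u => / (1 + u))%R t).
           { apply continuity_pt_filterlim, derivable_continuous_pt.
             apply ex_derive_Reals_0. auto_derive. lra. }
           split.
           ++ now apply (continuous_comp (fun u => / (1 + u))%R (fun u => Re (beta_integrand s r u))).
           ++ now apply (continuous_comp (fun u => / (1 + u))%R (fun u => Im (beta_integrand s r u))).
    + intros; apply Cf.
    + intros t Ht. rewrite Rmin_left, Rmax_right in Ht by lra. split.
      * auto_derive; [lra|]. field. lra.
      * apply continuity_pt_filterlim, derivable_continuous_pt.
        apply ex_derive_Reals_0. auto_derive. nra.
Qed.

(** * Connection formula for the integrals of t^(s-1) (1 - x t)^(-b) *)

Definition ibeta (s b x : C) : C := euler_int (fun t => tpow t (s - 1)) b x.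

Lemma Re_plus_1 (s : C) : Re (s + 1) = (Re s + 1)%R.
Proof. reflexivity. Qed.

Section IBeta.

Variable s : C.
Hypothesis Hs : 2 <= Re s.

Lemma ibeta_phi_continuous (t : R) : 0 <= t <= 1 -> RCcontinuous (fun t => tpow t (s - 1)) t.
Proof. intros _. apply tpow_continuous. change (1 <= Re s - 1). lra. Qed.

Lemma ibeta_phi_bound (t : R) : 0 <= t <= 1 -> Cmod (tpow t (s - 1)) <= 1.
Proof. intros Ht. apply tpow_le_1; [change (0 <= Re s - 1); lra | lra]. Qed.

Lemma ibeta_series (b x : C) : Cmod x < 1 ->
  is_Cseries (fun n => binom_coef b n / (s + INR n) * x ^ n) (ibeta s b x).
Proof.
  intros Hx. unfold ibeta.
  assert (T := euler_int_taylor (fun t => tpow t (s - 1)) b 1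
    ibeta_phi_continuous ibeta_phi_bound 0 1 Rlt_0_1).
  specialize (fun H => T H x Hx). rewrite Cplus_0_l in T.
  eapply is_Cseries_ext; [|apply T].
  - intros n. cbv beta. f_equal. unfold euler_coef.
    transitivity (CRInt (fun t => binom_coef b n * tpow t (s - 1 + INR n)) 0 1).
    + apply CRInt_ext; [lra|]. intros t Ht. unfold euler_term. rewrite <- tpow_mult_nat.
      replace (1 - 0 * RtoC t) with (RtoC 1) by ring. rewrite Cpower_1_l. ring.
    + assert (Q : 1 <= Re (s - 1 + INR n)).
      { change (1 <= Re s - 1 + INR n). assert (P := pos_INR n). lra. }
      rewrite CRInt_scal by (try lra; intros; now apply tpow_continuous).
      rewrite CRInt_tpow by exact Q. unfold Cdiv. do 2 f_equal. ring.
  - intros t Ht. replace (1 - 0 * RtoC t) with (RtoC 1) by ring. rewrite Cmod_1. lra.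
Qed.

Lemma ibeta_integrand_continuous (x w : C) (t : R) : cut_plane x -> 0 <= t <= 1 ->
  RCcontinuous (fun t => tpow t (s - 1) * Cpower (1 - x * RtoC t) w) t.
Proof.
  intros Hx Ht. apply euler_integrand_continuous.
  - exact ibeta_phi_continuous.
  - exact Ht.
  - now apply cut_plane_slit.
Qed.

End IBeta.

Lemma ibeta_diff (s b x : C) : 2 <= Re s -> cut_plane x ->
  Cdiff (ibeta s b) x (b * ibeta (s + 1) (b + 1) x).
Proof.
  intros Hs Hx.
  eapply Cdiff_eq; [|apply (euler_int_diff _ b 1); auto using ibeta_phi_continuous, ibeta_phi_bound].
  unfold ibeta, euler_int, euler_coef.
  rewrite <- CRInt_scal; [|lra|].
  - apply CRInt_ext; [lra|]. intros t Ht.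
    assert (Hu := slit_neq_0 _ (cut_plane_slit x t Hx ltac:(lra))).
    replace (s + 1 - 1) with (s - 1 + INR 1) by (simpl; ring).
    rewrite <- tpow_mult_nat, Cpow_1_r. unfold euler_term, binom_coef.
    replace (- b - INR 1) with (- (b + 1)) by (simpl; ring). simpl. field.
  - intros t Ht. apply ibeta_integrand_continuous; auto. rewrite Re_plus_1. lra.
Qed.

(** Integration by parts; equivalently, the first-order equation
    x y' + s y = (1 - x)^(-b) for y = ibeta s b. *)
Lemma ibeta_parts (s b x : C) : 2 <= Re s -> cut_plane x ->
  s * ibeta s b x + b * x * ibeta (s + 1) (b + 1) x = Cpower (1 - x) (- b).
Proof.
  intros Hs Hx.
  assert (Hs' : 2 <= Re (s + 1)) by (rewrite Re_plus_1; lra).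
  assert (C1 := fun t Ht => ibeta_integrand_continuous s Hs x (- b) t Hx Ht).
  assert (C2 := fun t Ht => ibeta_integrand_continuous (s + 1) Hs' x (- (b + 1)) t Hx Ht).
  assert (CC : forall c (f : R -> C) t, RCcontinuous f t -> RCcontinuous (fun u => c * f u) t).
  { intros c f t H. apply RCcontinuous_mult; [apply RCcontinuous_const | exact H]. }
  unfold ibeta, euler_int.
  rewrite <- !CRInt_scal by (auto; lra).
  rewrite <- CRInt_plus by (try lra; intros; apply CC; auto).
  rewrite (CRInt_derive 0 1 ltac:(lra) (fun t => tpow t s * Cpower (1 - x * RtoC t) (- b))).
  - rewrite tpow_1, (tpow_nonpos 0), Cmult_1_l, Cmult_0_l, Cmult_1_r by lra. ring.
  - intros t Ht.
    assert (Hsl := cut_plane_slit x t Hx Ht). assert (Hu := slit_neq_0 _ Hsl).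
    assert (D : RCderiv (fun u => Cpower (1 - x * RtoC u) (- b)) t
                  (- b * Cpower (1 - x * RtoC t) (- b) / (1 - x * RtoC t) * - x)).
    { apply (RCderiv_Cdiff (fun w => Cpower (1 - x * w) (- b))).
      apply (Cdiff_comp (fun w => 1 - x * w) (fun w => Cpower w (- b)));
        [|now apply Cdiff_Cpower].
      eapply Cdiff_ext; [|eapply Cdiff_eq;
        [|apply (Cdiff_plus _ _ _ _ _ (Cdiff_const 1 (RtoC t))
            (Cdiff_scal (- x) _ _ _ (Cdiff_id (RtoC t))))]].
      - intros w; simpl; ring.
      - ring. }
    assert (P := RCderiv_mult _ _ _ _ _ (tpow_deriv s t Hs (proj1 Ht)) D).
    replace (s * (tpow t (s - 1) * Cpower (1 - x * RtoC t) (- b))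
      + b * x * (tpow t (s + 1 - 1) * Cpower (1 - x * RtoC t) (- (b + 1))))
      with (s * tpow t (s - 1) * Cpower (1 - x * RtoC t) (- b)
       + tpow t s * (- b * Cpower (1 - x * RtoC t) (- b) / (1 - x * RtoC t) * - x)); [exact P|].
    replace (- (b + 1)) with (- b + - (1)) by ring.
    replace (s + 1 - 1) with s by ring.
    rewrite (Cpower_add _ (- b)), (Cpower_opp _ 1), Cpower_1 by exact Hu. field. exact Hu.
  - intros t Ht. apply RCcontinuous_plus; apply CC; auto.
Qed.

(** Combines integration by parts with the identity obtained by writing
    (1 - x t)^(-b) = (1 - x t) (1 - x t)^(-b-1) under the integral. *)
Lemma ibeta_lower_b (s b x : C) : 2 <= Re s -> cut_plane x ->
  (b - s) * ibeta s b x = b * ibeta s (b + 1) x - Cpower (1 - x) (- b).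
Proof.
  intros Hs Hx. rewrite <- (ibeta_parts s b x Hs Hx).
  assert (Hs' : 2 <= Re (s + 1)) by (rewrite Re_plus_1; lra).
  assert (E : ibeta s b x = ibeta s (b + 1) x + - x * ibeta (s + 1) (b + 1) x).
  { unfold ibeta, euler_int.
    assert (C1 := fun t Ht => ibeta_integrand_continuous s Hs x (- (b + 1)) t Hx Ht).
    assert (C2 := fun t Ht => ibeta_integrand_continuous (s + 1) Hs' x (- (b + 1)) t Hx Ht).
    rewrite <- CRInt_scal by (auto; lra).
    rewrite <- CRInt_plus; [|lra|auto|].
    2:{ intros t Ht. apply RCcontinuous_mult; [apply RCcontinuous_const | auto]. }
    apply CRInt_ext; [lra|]. intros t Ht.
    assert (Hu := slit_neq_0 _ (cut_plane_slit x t Hx ltac:(lra))).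
    replace (s + 1 - 1) with (s - 1 + INR 1) by (simpl; ring).
    rewrite <- tpow_mult_nat, Cpow_1_r.
    replace (- b) with (- (b + 1) + 1) by ring.
    rewrite (Cpower_add _ _ 1), Cpower_1 by exact Hu. ring. }
  set (I1 := ibeta (s + 1) (b + 1) x) in *. set (I0 := ibeta s (b + 1) x) in *.
  replace (b * I0) with (b * (ibeta s b x + x * I1)) by (rewrite E; ring). ring.
Qed.

Lemma cut_plane_opp_Cexp (w : C) : - PI < Im w < PI -> cut_plane (- Cexp w).
Proof.
  intros Hw [H1 H2].
  change (- (exp (Re w) * sin (Im w)) = 0)%R in H1.
  change (1 <= - (exp (Re w) * cos (Im w))) in H2.
  assert (E := exp_pos (Re w)).
  assert (S : sin (Im w) = 0%R) by nra.
  destruct (Rtotal_order (Im w) 0) as [L|[L|L]].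
  - assert (X := sin_lt_0_var (Im w) ltac:(lra) L). lra.
  - rewrite L, cos_0 in H2. lra.
  - assert (X := sin_gt_0 (Im w) L ltac:(lra)). lra.
Qed.

(** Both sides are logarithms of 1 + e^w; they agree because the argument of 1 + e^(-w)
    has the sign opposite to Im w, so that the right side stays in the strip. *)
Lemma Clog_1_plus_Cexp (w : C) : - PI < Im w < PI ->
  Clog (1 + Cexp w) = w + Clog (1 + Cexp (- w)).
Proof.
  intros Hw.
  assert (Sl : forall v, - PI < Im v < PI -> slit (1 + Cexp v)).
  { intros v Hv. assert (H := cut_plane_slit _ 1 (cut_plane_opp_Cexp v Hv) ltac:(lra)).
    now replace (1 - - Cexp v * 1) with (1 + Cexp v) in H by ring. }
  assert (Hw' : - PI < Im (- w) < PI) by (change (Im (- w)) with (- Im w)%R; lra).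
  assert (S2 := Sl _ Hw').
  apply Clog_unique.
  - change (Im (w + Clog (1 + Cexp (- w)))) with (Im w + Carg (1 + Cexp (- w)))%R.
    assert (A := Carg_slit _ S2).
    assert (Ei : Im (1 + Cexp (- w)) = (- (exp (- Re w) * sin (Im w)))%R).
    { change (0 + exp (- Re w) * sin (- Im w) = - (exp (- Re w) * sin (Im w)))%R.
      rewrite sin_neg. ring. }
    assert (E := exp_pos (- Re w)).
    destruct (Rlt_dec 0 (Im w)) as [L|L].
    + assert (X := sin_gt_0 (Im w) L ltac:(lra)).
      assert (Y := Carg_nonpos (1 + Cexp (- w))). rewrite Ei in Y.
      specialize (Y ltac:(nra)). lra.
    + assert (X : sin (Im w) <= 0).
      { destruct (Req_dec (Im w) 0) as [->|Z]; [rewrite sin_0; lra|].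
        left. apply sin_lt_0_var; lra. }
      assert (Y := Carg_nonneg (1 + Cexp (- w))). rewrite Ei in Y.
      specialize (Y ltac:(nra)). lra.
  - rewrite Cexp_add, Cexp_Clog by now apply slit_neq_0.
    rewrite Cexp_opp. field. apply Cexp_neq_0.
Qed.

(** In the coordinate x = - e^w the derivatives of the two terms are
    +/- e^(s w) (1 + e^w)^(-s-r), so their sum is constant on the strip |Im w| < PI;
    at w = 0 it is the folded Beta integral. *)
Lemma ibeta_reflection (s r w : C) :
  (2 <= Re s) -> 2 <= Re r -> - PI < Im w < PI ->
  Cexp (s * w) * ibeta s (s + r) (- Cexp w) + Cexp (- r * w) * ibeta r (s + r) (- Cexp (- w))
  = rGamma (s + r) / (rGamma s * rGamma r).
Proof.
  intros Hs Hr Hw. rewrite <- beta_integral_folded by assumption.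
  set (b := s + r).
  assert (D : forall s', 2 <= Re s' -> forall v, - PI < Im v < PI ->
    Cdiff (fun v => Cexp (s' * v) * ibeta s' b (- Cexp v)) v
      (Cexp (s' * v) * Cpower (1 + Cexp v) (- b))).
  { intros s' Hs' v Hv. assert (Hx := cut_plane_opp_Cexp v Hv).
    assert (D1 : Cdiff (fun v => Cexp (s' * v)) v (Cexp (s' * v) * (s' * 1))).
    { apply (Cdiff_comp (fun v => s' * v) Cexp); [apply Cdiff_scal, Cdiff_id | apply Cdiff_Cexp]. }
    assert (D2 : Cdiff (fun v => ibeta s' b (- Cexp v)) v
              (b * ibeta (s' + 1) (b + 1) (- Cexp v) * (-1 * Cexp v))).
    { apply (Cdiff_comp (fun v => - Cexp v) (ibeta s' b)); [|now apply ibeta_diff].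
      eapply Cdiff_ext; [|apply (Cdiff_scal (-1) Cexp), Cdiff_Cexp].
      intros t; simpl; ring. }
    eapply Cdiff_eq; [|apply (Cdiff_mult _ _ _ _ _ D1 D2)]. cbv beta.
    assert (P := ibeta_parts s' b (- Cexp v) Hs' Hx).
    replace (1 - - Cexp v) with (1 + Cexp v) in P by ring. rewrite <- P. ring. }
  transitivity (Cexp (s * 0) * ibeta s b (- Cexp 0) + Cexp (- r * 0) * ibeta r b (- Cexp (- 0))).
  - apply (Cdiff_0_segment
      (fun v => Cexp (s * v) * ibeta s b (- Cexp v) + Cexp (- r * v) * ibeta r b (- Cexp (- v))) 0 w).
    intros tau Ht. replace (0 + RtoC tau * (w - 0)) with (RtoC tau * w) by ring.
    set (v := RtoC tau * w).
    assert (Hv : - PI < Im v < PI).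
    { unfold v. rewrite im_mult. simpl. change (snd w) with (Im w). assert (Pi := PI_RGT_0). nra. }
    assert (Hv' : - PI < Im (- v) < PI) by (change (Im (- v)) with (- Im v)%R; lra).
    assert (D1 := D s Hs v Hv).
    assert (Dn : Cdiff (fun v => - v) v (-1)).
    { eapply Cdiff_ext; [|eapply Cdiff_eq; [|apply (Cdiff_scal (-1) _ _ _ (Cdiff_id v))]];
        [intros t; simpl; ring | ring]. }
    assert (D2 := Cdiff_comp (fun v => - v) _ v _ _ Dn (D r Hr (- v) Hv')).
    eapply Cdiff_ext; [|eapply Cdiff_eq; [|apply (Cdiff_plus _ _ _ _ _ D1 D2)]].
    + intros u. cbv beta.
      now replace (r * - u) with (- r * u) by ring.
    + unfold Cpower. rewrite (Clog_1_plus_Cexp v Hv).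
      replace (- b * (v + Clog (1 + Cexp (- v))))
        with (- (s * v) + r * - v + - b * Clog (1 + Cexp (- v))) by (unfold b; ring).
      rewrite !Cexp_add, Cexp_opp. field. apply Cexp_neq_0.
  - rewrite !Cmult_0_r, Cexp_0. replace (- (0)) with (RtoC 0) by ring.
    rewrite Cexp_0. unfold ibeta. ring.
Qed.

Lemma cut_opp_slit (x : C) : cut_plane x -> 1 < Cmod x -> slit (- x).
Proof.
  intros Hx H1. unfold slit.
  change (Re (- x)) with (- Re x)%R. change (Im (- x)) with (- Im x)%R.
  destruct (Req_dec (Im x) 0) as [E|E]; [left | right; lra].
  assert (N : ~ (1 <= Re x)) by (intros N; now apply Hx).
  assert (M := Cmod2_alt x). rewrite E in M. nra.
Qed.

Lemma opp_power_series (b x : C) : cut_plane x -> 1 < Cmod x ->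
  is_Cseries (fun n => Cpower (- x) (- b) * (binom_coef b n * (/ x) ^ n)) (Cpower (1 - x) (- b)).
Proof.
  intros Hx H1. assert (Hs := cut_opp_slit x Hx H1).
  assert (X0 : x <> 0) by (apply Cmod_gt_0; lra).
  replace (1 - x) with (- x - -1) by ring.
  eapply is_Cseries_ext; [|apply (binomial_series b (- x) (-1))].
  - intros n. cbv beta. do 3 f_equal. field. exact X0.
  - rewrite Cmod_opp, Cmod_R, Rabs_left by lra. lra.
  - intros tau Ht. replace (- x - RtoC tau * -1) with (- x + RtoC tau) by ring.
    destruct Hs as [Hs|Hs]; [left | right].
    + change (0 < Re (- x) + tau). lra.
    + change (Im (- x) + 0 <> 0)%R. lra.
Qed.

(** Expansion of [ibeta] at infinity. For Re b large it is the reflection formula,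
    whose second integral is then a power series in 1/x; lowering b extends it. *)
Lemma ibeta_connection (s b x : C) :
  (2 <= Re s) -> ~ Cint (s - b) -> cut_plane x -> 1 < Cmod x ->
  exists J, is_Cseries (fun m => binom_coef b m / (s - b - INR m) * (/ x) ^ m) J /\
    ibeta s b x = rGamma b / (rGamma s * rGamma (b - s)) * Cpower (- x) (- s)
                  + Cpower (- x) (- b) * J.
Proof.
  intros Hs Hsb Hx H1.
  assert (X0 : x <> 0) by (apply Cmod_gt_0; lra).
  assert (Hsl := cut_opp_slit x Hx H1).
  destruct (INR_unbounded (Re s + 2 - Re b)) as [n Hn].
  revert b Hsb Hn. induction n as [|n IH]; intros b Hsb Hn.
  - simpl in Hn. set (r := b - s).
    assert (Hr : 2 <= Re r) by (change (2 <= Re b - Re s); lra).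
    set (w := Clog (- x)).
    assert (Ew : Cexp w = - x) by (apply Cexp_Clog; now apply slit_neq_0).
    assert (Hw : - PI < Im w < PI) by (apply Carg_slit, Hsl).
    assert (E := ibeta_reflection s r w Hs Hr Hw).
    replace (s + r) with b in E by (unfold r; ring).
    rewrite (Cexp_opp w), Ew in E.
    replace (- - x) with x in E by ring. replace (- / - x) with (/ x) in E by (field; exact X0).
    exists (- ibeta r b (/ x)). split.
    + assert (Sr := ibeta_series r Hr b (/ x)).
      replace (- ibeta r b (/ x)) with (-1 * ibeta r b (/ x)) by ring.
      eapply is_Cseries_ext; [|apply (is_Cseries_scal (-1)), Sr].
      * intros m. cbv beta.
        assert (N1 : r + INR m <> 0) by (apply nonpole_add, nonpole_Re; lra).
        replace (s - b - INR m) with (- (r + INR m)) by (unfold r; ring).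
        set (D := r + INR m) in *. set (z := (/ x) ^ m). field. exact N1.
      * rewrite Cmod_inv by exact X0. rewrite <- Rinv_1. apply Rinv_lt_contravar; lra.
    + rewrite <- E. unfold Cpower. fold w.
      replace (- s * w) with (- (s * w)) by ring. rewrite Cexp_opp.
      replace (- b * w) with (- (s * w) + - r * w) by (unfold r; ring).
      rewrite Cexp_add, Cexp_opp. field. apply Cexp_neq_0.
  - assert (Hsb' : ~ Cint (s - (b + 1))).
    { replace (s - (b + 1)) with (s - b + RtoC (IZR (-1))) by ring.
      now apply nonint_shift. }
    destruct (IH (b + 1) Hsb') as (J & HJ & E).
    { rewrite S_INR in Hn. rewrite Re_plus_1. lra. }
    assert (Nbs : b - s <> 0).
    { intros Z. apply Hsb. exists 0%Z. replace (s - b) with (- (b - s)) by ring. rewrite Z. ring. }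
    assert (Nm : forall m, s - b - INR m <> 0).
    { intros m Z. apply Hsb. exists (Z.of_nat m).
      rewrite <- INR_IZR_INZ. replace (s - b) with (s - b - INR m + INR m) by ring.
      rewrite Z. ring. }
    assert (S1 : is_Cseries (fun m => - INR m * binom_coef b m
                     / (s - b - INR m) * (/ x) ^ m) (- b * / x * J)).
    { replace (- b * / x * J) with
        ((fun m => - INR m * binom_coef b m / (s - b - INR m) * (/ x) ^ m) O
         + - b * / x * J) by (simpl; unfold Cdiv; ring).
      apply is_Cseries_Sl.
      eapply is_Cseries_ext; [|apply (is_Cseries_scal (- b * / x) _ _ HJ)].
      intros m. cbv beta.
      assert (B : RtoC (INR (S m)) * binom_coef b (S m) = b * binom_coef (b + 1) m).
      { unfold binom_coef. rewrite pochn_Sl, fact_simpl, mult_INR, RtoC_mult.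
        field. split; [apply INR_fact_C | apply RtoC_INR_S]. }
      assert (N1 := Nm (S m)).
      assert (N2 : s - b - INR (S m) = s - (b + 1) - INR m)
        by (rewrite S_INR, RtoC_plus; ring).
      replace (- INR (S m) * binom_coef b (S m)) with (- (b * binom_coef (b + 1) m))
        by (rewrite <- B; ring).
      rewrite N2 in *. rewrite Cpow_S. unfold Cdiv. ring. }
    assert (S2 : is_Cseries (fun n => binom_coef b n * (/ x) ^ n)
                    (Cpower (1 - x) (- b) / Cpower (- x) (- b))).
    { replace (Cpower (1 - x) (- b) / Cpower (- x) (- b))
        with (/ Cpower (- x) (- b) * Cpower (1 - x) (- b)) by (unfold Cdiv; ring).
      eapply is_Cseries_ext; [|apply (is_Cseries_scal _ _ _ (opp_power_series b x Hx H1))].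
      intros n'. cbv beta. set (z := (/ x) ^ n'). field. apply Cpower_neq_0. }
    assert (S3 := is_Cseries_scal (/ (b - s)) _ _ (is_Cseries_minus _ _ _ _ S1 S2)).
    cbv beta in S3.
    eexists. split.
    + eapply is_Cseries_ext; [|exact S3]. intros m. cbv beta. assert (N1 := Nm m).
      set (q := (/ x) ^ m). field. auto.
    + assert (L := ibeta_lower_b s b x Hs Hx).
      replace (ibeta s b x) with ((b - s) * ibeta s b x / (b - s)) by (field; exact Nbs).
      rewrite L, E.
      replace (b + 1 - s) with (b - s + 1) by ring.
      assert (R1 := rGamma_rec b). assert (R2 := rGamma_rec (b - s)).
      assert (G1 : rGamma (b - s) <> 0).
      { apply rGamma_neq_0, nonint_nonpole.
        replace (b - s) with (- (s - b)) by ring. now apply nonint_opp. }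
      assert (G2 : rGamma (b - s + 1) <> 0) by (intros Z; apply G1; rewrite R2, Z; ring).
      assert (G3 : rGamma s <> 0) by (apply rGamma_neq_0, nonpole_Re; lra).
      replace (- (b + 1)) with (- b + - (1)) by ring.
      rewrite Cpower_add, (Cpower_opp _ 1), Cpower_1 by now apply slit_neq_0.
      rewrite R1, R2. field. repeat split; auto using Cpower_neq_0.
Qed.

(** * Continuation of the Gauss function and its expansion at infinity *)

Lemma is_pseries_Cseries (u : nat -> C) (z l : C) :
  is_pseries (K := C_AbsRing) (V := C_NormedModule) u z l <->
  is_Cseries (fun n => u n * z ^ n) l.
Proof.
  unfold is_pseries. rewrite is_series_Cseries.
  assert (E : forall n, scal (K := C_AbsRing) (V := C_NormedModule) (pow_n (K := C_Ring) z n) (u n)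
              = u n * z ^ n).
  { intros n. change (pow_n (K := C_Ring) z n * u n = u n * z ^ n).
    apply Cmult_comm. }
  split; apply is_Cseries_ext; intros n; rewrite <- E; reflexivity.
Qed.

Lemma nonint_inv_bound (w : C) : ~ Cint w ->
  exists M, 0 < M /\ forall k m : nat, Cmod (/ (w + INR k - INR m)) <= M.
Proof.
  intros H. destruct (inv_shift_bound w (nonint_nonpole w H)) as (M1 & P1 & B1).
  destruct (inv_shift_bound (- w) (nonint_nonpole _ (nonint_opp w H))) as (M2 & P2 & B2).
  exists (Rmax M1 M2). split; [eapply Rlt_le_trans; [exact P1 | apply Rmax_l]|].
  intros k m. destruct (Nat.le_ge_cases m k) as [L|L].
  - eapply Rle_trans; [|apply Rmax_l].
    replace (w + INR k - INR m) with (w + INR (k - m)); [apply B1|].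
    rewrite minus_INR, RtoC_minus by exact L. ring.
  - eapply Rle_trans; [|apply Rmax_r].
    assert (E : w + INR k - INR m = - (- w + INR (m - k))).
    { rewrite minus_INR, RtoC_minus by exact L. ring. }
    rewrite E.
    assert (N := nonpole_add _ (m - k) (nonint_nonpole _ (nonint_opp w H))).
    replace (/ - (- w + INR (m - k))) with (- / (- w + INR (m - k))).
    + rewrite Cmod_opp. apply B2.
    + set (D := - w + INR (m - k)) in *. field. exact N.
Qed.

(** Coefficient of x^(-k) (-x)^(-a) in Gamma(c)^(-1) 2F1(a,b;c;x) at infinity. With
    reciprocal Gamma functions kept in this shifted form it is symmetric under
    exchange of a and b and defined for all a, b, c with a - b not an integer. *)
Definition inf_coef (a b c : C) (k : nat) : C :=
  rGamma b * rGamma (c - a - INR k) / rGamma (b - a - INR k) * binom_coef a k.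

Definition inf_expansion (a b c : C) (F : C -> C) (x : C) : Prop :=
  exists S1 S2, is_Cseries (fun k => inf_coef a b c k * (/ x) ^ k) S1 /\
    is_Cseries (fun k => inf_coef b a c k * (/ x) ^ k) S2 /\
    F x = (Cpower (- x) (- a) * S1 + Cpower (- x) (- b) * S2) / rGamma c.

Definition continued (a b c : C) : Prop :=
  exists F, is_hyp2F1 a b c F /\
    forall x, cut_plane x -> 1 < Cmod x -> inf_expansion a b c F x.

Lemma nonint_sub_nat (w : C) (k : nat) : ~ Cint w -> ~ Cint (w - INR k).
Proof.
  intros H. assert (E := nonint_shift w (- Z.of_nat k) H).
  now rewrite opp_IZR, <- INR_IZR_INZ, RtoC_opp in E.
Qed.

Lemma rGamma_nonint (w : C) : ~ Cint w -> rGamma w <> 0.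
Proof. intros H. now apply rGamma_neq_0, nonint_nonpole. Qed.

Lemma nonint_sym (a b : C) : ~ Cint (a - b) -> ~ Cint (b - a).
Proof. intros H. replace (b - a) with (- (a - b)) by ring. now apply nonint_opp. Qed.

Lemma binom_coef_shift (a : C) (k : nat) :
  a * binom_coef (a + 1) k = (a + INR k) * binom_coef a k.
Proof.
  unfold binom_coef. unfold Cdiv. rewrite !Cmult_assoc, <- pochn_Sl. simpl. ring.
Qed.

Lemma inf_coef_raise_c (a b c : C) (k : nat) : ~ Cint (a - b) ->
  inf_coef a b c k = c * inf_coef a b (c + 1) k - a * b * inf_coef (a + 1) (b + 1) (c + 2) k.
Proof.
  intros H. unfold inf_coef.
  assert (N := rGamma_nonint _ (nonint_sub_nat _ k (nonint_sym a b H))).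
  replace (c + 2 - (a + 1) - INR k) with (c - a - INR k + 1) by ring.
  replace (c + 1 - a - INR k) with (c - a - INR k + 1) by ring.
  replace (b + 1 - (a + 1) - INR k) with (b - a - INR k) by ring.
  rewrite (rGamma_rec (c - a - INR k)), (rGamma_rec b).
  set (g := rGamma (c - a - INR k + 1)).
  replace (a * b * (rGamma (b + 1) * g / rGamma (b - a - INR k) * binom_coef (a + 1) k))
    with (b * rGamma (b + 1) * g / rGamma (b - a - INR k) * (a * binom_coef (a + 1) k))
    by (field; exact N).
  rewrite binom_coef_shift. field. exact N.
Qed.

Lemma inf_coef_raise_a_1 (a b c : C) (k : nat) : ~ Cint (a - b) ->
  inf_coef a b c (S k) = - inf_coef (a + 1) b c k + b * inf_coef (a + 1) (b + 1) (c + 1) (S k).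
Proof.
  intros H. unfold inf_coef.
  assert (N := rGamma_nonint _ (nonint_sub_nat _ (S k) (nonint_sym a b H))).
  rewrite S_INR, RtoC_plus in *.
  replace (c - (a + 1) - INR k) with (c - a - (RtoC (INR k) + 1)) by ring.
  replace (b - (a + 1) - INR k) with (b - a - (RtoC (INR k) + 1)) by ring.
  replace (c + 1 - (a + 1) - (RtoC (INR k) + 1)) with (c - a - (RtoC (INR k) + 1)) by ring.
  replace (b + 1 - (a + 1) - (RtoC (INR k) + 1)) with (b - a - (RtoC (INR k) + 1)) by ring.
  rewrite (rGamma_rec b).
  assert (E : binom_coef a (S k) = binom_coef (a + 1) (S k) - binom_coef (a + 1) k).
  { unfold binom_coef. rewrite pochn_Sl, fact_simpl, mult_INR, RtoC_mult.
    simpl pochn. assert (A := RtoC_INR_S k). assert (A' := INR_fact_C k).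
    rewrite S_INR, RtoC_plus in *. field. auto. }
  rewrite E. field. exact N.
Qed.

Lemma inf_coef_raise_a_1_0 (a b c : C) : ~ Cint (a - b) ->
  inf_coef a b c 0 = b * inf_coef (a + 1) (b + 1) (c + 1) 0.
Proof.
  intros H. unfold inf_coef.
  assert (N := rGamma_nonint _ (nonint_sub_nat _ 0 (nonint_sym a b H))).
  replace (c + 1 - (a + 1)) with (c - a) by ring.
  replace (b + 1 - (a + 1)) with (b - a) by ring.
  rewrite (rGamma_rec b), !binom_coef_0. field. exact N.
Qed.

Lemma inf_coef_raise_a_2 (a b c : C) (k : nat) : ~ Cint (a - b) ->
  inf_coef b a c k = inf_coef b (a + 1) c k + b * inf_coef (b + 1) (a + 1) (c + 1) k.
Proof.
  intros H. unfold inf_coef.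
  assert (N := rGamma_nonint _ (nonint_sub_nat _ k H)).
  replace (c + 1 - (b + 1) - INR k) with (c - b - INR k) by ring.
  replace (a + 1 - (b + 1) - INR k) with (a - b - INR k) by ring.
  replace (a + 1 - b - INR k) with (a - b - INR k + 1) by ring.
  rewrite (rGamma_rec (a - b - INR k)) in *. rewrite (rGamma_rec a).
  set (g := rGamma (a - b - INR k + 1)) in *.
  assert (N1 : g <> 0) by (intros Z; apply N; rewrite Z; ring).
  assert (N2 : a - b - INR k <> 0) by (intros Z; apply N; rewrite Z; ring).
  replace (b * (rGamma (a + 1) * rGamma (c - b - INR k) / ((a - b - INR k) * g)
             * binom_coef (b + 1) k))
    with (rGamma (a + 1) * rGamma (c - b - INR k) / ((a - b - INR k) * g)
             * (b * binom_coef (b + 1) k)) by (field; auto).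
  rewrite binom_coef_shift. field. auto.
Qed.

(** Continuations can be combined by contiguous relations F = F1 + q x F2, which need
    no derivatives; at 0 such a relation is an identity between Taylor coefficients. *)
Lemma is_hyp2F1_step (a b c a1 b1 c1 a2 b2 c2 q : C) (F G : C -> C) :
  is_hyp2F1 a1 b1 c1 F -> is_hyp2F1 a2 b2 c2 G ->
  (forall n, hyp2F1_coef a b c (S n) = hyp2F1_coef a1 b1 c1 (S n) + q * hyp2F1_coef a2 b2 c2 n) ->
  is_hyp2F1 a b c (fun x => F x + q * x * G x).
Proof.
  intros [F1 F2] [G1 G2] H.
  assert (Hs : forall (v : nat -> C) h l, is_Cseries (fun n => v n * h ^ n) l ->
     is_Cseries (fun n => match n with O => 0 | S m => v m end * h ^ n) (h * l)).
  { intros v h l Hl.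
    replace (h * l) with ((fun n => match n with O => 0 | S m => v m end * h ^ n) O + h * l)
      by (simpl; ring).
    apply is_Cseries_Sl. eapply is_Cseries_ext; [|apply (is_Cseries_scal h _ _ Hl)].
    intros n. simpl. ring. }
  split.
  - intros x Hx. destruct (F1 x Hx) as (u & r1 & R1 & P1). destruct (G1 x Hx) as (v & r2 & R2 & P2).
    exists (fun n => u n + q * (x * v n + match n with O => 0 | S m => v m end)), (Rmin r1 r2).
    split; [now apply Rmin_pos|]. intros z Hz.
    specialize (P1 z (Rlt_le_trans _ _ _ Hz (Rmin_l _ _))).
    specialize (P2 z (Rlt_le_trans _ _ _ Hz (Rmin_r _ _))).
    apply is_pseries_Cseries in P1, P2. apply is_pseries_Cseries.
    assert (T := is_Cseries_plus _ _ _ _ P1 (is_Cseries_scal q _ _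
       (is_Cseries_plus _ _ _ _ (is_Cseries_scal x _ _ P2) (Hs _ _ _ P2)))).
    replace (F z + q * z * G z) with (F z + q * (x * G z + (z - x) * G z)) by ring.
    eapply is_Cseries_ext; [|exact T]. intros n. cbv beta. ring.
  - intros x Hx. apply is_pseries_Cseries.
    assert (P1 := proj1 (is_pseries_Cseries _ _ _) (F2 x Hx)).
    assert (P2 := proj1 (is_pseries_Cseries _ _ _) (G2 x Hx)).
    replace (F x + q * x * G x) with (F x + q * (x * G x)) by ring.
    eapply is_Cseries_ext; [|apply (is_Cseries_plus _ _ _ _ P1 (is_Cseries_scal q _ _ (Hs _ _ _ P2)))].
    intros n. cbv beta. destruct n as [|n].
    + unfold hyp2F1_coef. simpl. field.
    + rewrite H. ring.
Qed.

Lemma hyp2F1_coef_raise_c (a b c : C) (n : nat) : nonpole c ->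
  hyp2F1_coef a b c (S n) = hyp2F1_coef a b (c + 1) (S n)
    + a * b / (c * (c + 1)) * hyp2F1_coef (a + 1) (b + 1) (c + 2) n.
Proof.
  intros Hc. unfold hyp2F1_coef.
  assert (N0 := nonpole_neq_0 c Hc).
  assert (N1 := nonpole_neq_0 _ (nonpole_S c Hc)).
  assert (N2 := pochn_neq_0 (c + 2) n).
  assert (N3 := nonpole_add _ n (nonpole_S c Hc)).
  assert (E : pochn (c + 1) n = (c + 1) * pochn (c + 2) n / (c + 1 + INR n)).
  { replace (c + 2) with (c + 1 + 1) by ring. rewrite <- pochn_Sl. simpl. field. exact N3. }
  rewrite (pochn_Sl a), (pochn_Sl b), (pochn_Sl c), (pochn_Sl (c + 1)), E.
  replace (c + 1 + 1) with (c + 2) by ring.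
  rewrite fact_simpl, mult_INR, RtoC_mult.
  assert (A := RtoC_INR_S n). assert (A' := INR_fact_C n). rewrite S_INR, RtoC_plus in *.
  field. repeat split; auto. apply N2. replace (c + 2) with (c + 1 + 1) by ring.
  now apply nonpole_S, nonpole_S.
Qed.

Lemma hyp2F1_coef_raise_a (a b c : C) (n : nat) : nonpole c ->
  hyp2F1_coef a b c (S n) = hyp2F1_coef (a + 1) b c (S n)
    + - b / c * hyp2F1_coef (a + 1) (b + 1) (c + 1) n.
Proof.
  intros Hc. unfold hyp2F1_coef.
  assert (N0 := nonpole_neq_0 c Hc). assert (N1 := pochn_neq_0 _ n (nonpole_S c Hc)).
  rewrite (pochn_Sl a), (pochn_Sl b), (pochn_Sl c).
  rewrite fact_simpl, mult_INR, RtoC_mult. simpl (pochn (a + 1) (S n)).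
  assert (A := RtoC_INR_S n). assert (A' := INR_fact_C n). rewrite S_INR, RtoC_plus in *.
  field. auto.
Qed.

(** The contiguous relation 2F1(a,b;c) = 2F1(a,b;c+1) + ab/(c(c+1)) x 2F1(a+1,b+1;c+2)
    is respected term by term by the expansions at infinity. *)
Lemma continued_raise_c (a b c : C) : ~ Cint (a - b) -> nonpole c ->
  continued a b (c + 1) -> continued (a + 1) (b + 1) (c + 2) -> continued a b c.
Proof.
  intros Hab Hc (F & HF & EF) (G & HG & EG).
  exists (fun x => F x + a * b / (c * (c + 1)) * x * G x). split.
  { eapply is_hyp2F1_step; [exact HF | exact HG|]. intros n. now apply hyp2F1_coef_raise_c. }
  intros x Hx H1.
  destruct (EF x Hx H1) as (S1 & S2 & HS1 & HS2 & E1).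
  destruct (EG x Hx H1) as (T1 & T2 & HT1 & HT2 & E2).
  assert (Nx := slit_neq_0 _ (cut_opp_slit x Hx H1)).
  assert (N0 := nonpole_neq_0 c Hc). assert (N1 := nonpole_neq_0 _ (nonpole_S c Hc)).
  exists (c * S1 - a * b * T1), (c * S2 - a * b * T2). repeat split.
  - eapply is_Cseries_ext; [|apply (is_Cseries_minus _ _ _ _
      (is_Cseries_scal c _ _ HS1) (is_Cseries_scal (a * b) _ _ HT1))].
    intros k. cbv beta. rewrite (inf_coef_raise_c a b c) by exact Hab. ring.
  - eapply is_Cseries_ext; [|apply (is_Cseries_minus _ _ _ _
      (is_Cseries_scal c _ _ HS2) (is_Cseries_scal (a * b) _ _ HT2))].
    intros k. cbv beta. rewrite (inf_coef_raise_c b a c) by now apply nonint_sym. ring.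
  - rewrite E1, E2.
    replace (- (a + 1)) with (- a + - (1)) by ring. replace (- (b + 1)) with (- b + - (1)) by ring.
    rewrite !(Cpower_add _ _ (- (1))), (Cpower_opp _ 1), Cpower_1 by exact Nx.
    rewrite (rGamma_rec c), (rGamma_rec (c + 1)).
    replace (c + 1 + 1) with (c + 2) by ring.
    assert (N2 : rGamma (c + 2) <> 0).
    { replace (c + 2) with (c + 1 + 1) by ring. now apply rGamma_neq_0, nonpole_S, nonpole_S. }
    field. repeat split; auto. intros Z. apply Nx. rewrite Z. ring.
Qed.

(** The same for 2F1(a,b;c) = 2F1(a+1,b;c) - (b/c) x 2F1(a+1,b+1;c+1). *)
Lemma continued_raise_a (a b c : C) : ~ Cint (a - b) -> nonpole c ->
  continued (a + 1) b c -> continued (a + 1) (b + 1) (c + 1) -> continued a b c.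
Proof.
  intros Hab Hc (F & HF & EF) (G & HG & EG).
  exists (fun x => F x + - b / c * x * G x). split.
  { eapply is_hyp2F1_step; [exact HF | exact HG|]. intros n. now apply hyp2F1_coef_raise_a. }
  intros x Hx H1.
  destruct (EF x Hx H1) as (S1 & S2 & HS1 & HS2 & E1).
  destruct (EG x Hx H1) as (T1 & T2 & HT1 & HT2 & E2).
  assert (Nx := slit_neq_0 _ (cut_opp_slit x Hx H1)).
  assert (Nx' : x <> 0) by (intros Z; apply Nx; rewrite Z; ring).
  assert (N0 := nonpole_neq_0 c Hc).
  exists (- / x * S1 + b * T1), (S2 + b * T2). repeat split.
  - replace (- / x * S1 + b * T1)
      with (inf_coef a b c 0 * (/ x) ^ 0
            + (- / x * S1 + (b * T1 - b * inf_coef (a + 1) (b + 1) (c + 1) 0)))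
      by (rewrite (inf_coef_raise_a_1_0 a b c Hab); change ((/ x) ^ 0) with (RtoC 1); ring).
    apply (is_Cseries_Sl (fun k => inf_coef a b c k * (/ x) ^ k)).
    assert (HT : is_Cseries (fun k => b * inf_coef (a + 1) (b + 1) (c + 1) (S k) * (/ x) ^ S k)
                   (b * T1 - b * inf_coef (a + 1) (b + 1) (c + 1) 0)).
    { apply (is_Cseries_Sl (fun k => b * inf_coef (a + 1) (b + 1) (c + 1) k * (/ x) ^ k)).
      cbv beta. change ((/ x) ^ 0) with (RtoC 1).
      match goal with |- is_Cseries _ ?s => replace s with (b * T1) by ring end.
      eapply is_Cseries_ext; [|apply (is_Cseries_scal b _ _ HT1)]. intros k; cbv beta; ring. }
    eapply is_Cseries_ext; [|apply (is_Cseries_plus _ _ _ _ (is_Cseries_scal (- / x) _ _ HS1) HT)].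
    intros k. cbv beta. rewrite (inf_coef_raise_a_1 a b c k Hab), !Cpow_S. unfold Cdiv. ring.
  - eapply is_Cseries_ext; [|apply (is_Cseries_plus _ _ _ _ HS2 (is_Cseries_scal b _ _ HT2))].
    intros k. cbv beta. rewrite (inf_coef_raise_a_2 a b c k Hab). ring.
  - rewrite E1, E2.
    replace (- (a + 1)) with (- a + - (1)) by ring. replace (- (b + 1)) with (- b + - (1)) by ring.
    rewrite !(Cpower_add _ _ (- (1))), (Cpower_opp _ 1), Cpower_1 by exact Nx.
    rewrite (rGamma_rec c).
    assert (N2 := rGamma_neq_0 _ (nonpole_S c Hc)).
    field. auto.
Qed.

Lemma pochn_reflect (z : C) (n : nat) :
  pochn (z - INR n) n = (-1) ^ n * pochn (1 - z) n.
Proof.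
  revert z. induction n as [|n IH]; intros z; [simpl; ring|].
  rewrite pochn_Sl. replace (z - INR (S n) + 1) with (z - INR n)
    by (rewrite S_INR, RtoC_plus; ring).
  rewrite IH. rewrite S_INR, RtoC_plus. simpl. ring.
Qed.

Lemma rGamma_sub_nat (z : C) (n : nat) :
  rGamma (z - INR n) = (-1) ^ n * pochn (1 - z) n * rGamma z.
Proof.
  rewrite (rGamma_shift (z - INR n) n), pochn_reflect.
  now replace (z - INR n + INR n) with z by ring.
Qed.

Lemma beta_integrand_bound (s r : C) (t : R) : 2 <= Re s -> 2 <= Re r -> 0 <= t <= 1 ->
  Cmod (beta_integrand s r t) <= 1.
Proof.
  intros Hs Hr Ht. unfold beta_integrand. rewrite Cmod_mult.
  apply Rle_trans with (1 * 1)%R; [|lra].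
  apply Rmult_le_compat; auto using Cmod_ge_0; apply tpow_le_1; try lra.
  - change (0 <= Re s - 1). lra.
  - change (0 <= Re r - 1). lra.
Qed.

Lemma Re_add_INR_ge (s : C) (r : R) (n : nat) : r <= Re s -> r <= Re (s + INR n).
Proof. intros H. change (r <= Re s + INR n). assert (P := pos_INR n). lra. Qed.

(** Euler's integral representation. Its Taylor series at 0 has the moments of
    t^(a-1) (1-t)^(c-a-1) as coefficients, and these are Beta integrals. *)
Lemma euler_is_hyp2F1 (a b c : C) : 2 <= Re a -> 2 <= Re (c - a) ->
  is_hyp2F1 a b c
    (fun x => rGamma a * rGamma (c - a) / rGamma c * euler_int (beta_integrand a (c - a)) b x).
Proof.
  intros Ha Hp. set (p := c - a) in *.
  assert (Hc : nonpole c).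
  { apply nonpole_Re. change (2 <= Re c - Re a) in Hp. lra. }
  set (phi := beta_integrand a p).
  assert (phi_c : forall t, 0 <= t <= 1 -> RCcontinuous phi t)
    by (intros t _; now apply beta_integrand_continuous).
  assert (phi_b : forall t, 0 <= t <= 1 -> Cmod (phi t) <= 1)
    by (intros t Ht; now apply beta_integrand_bound).
  set (q := rGamma a * rGamma p / rGamma c).
  assert (Nc := rGamma_neq_0 c Hc).
  assert (Np : rGamma p <> 0) by (apply rGamma_neq_0, nonpole_Re; lra).
  split.
  - intros x Hx. destruct (cut_plane_dist x Hx) as (rho & R0 & Hrho).
    exists (fun n => q * euler_coef phi b x n), rho. split; [exact R0|]. intros z Hz.
    apply is_pseries_Cseries.
    assert (T := euler_int_taylor phi b 1 phi_c phi_b x rho R0 Hrho (z - x) Hz).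
    replace (x + (z - x)) with z in T by ring.
    eapply is_Cseries_ext; [|apply (is_Cseries_scal q _ _ T)]. intros n; cbv beta; ring.
  - intros x Hx. apply is_pseries_Cseries.
    assert (T := euler_int_taylor phi b 1 phi_c phi_b 0 1 Rlt_0_1).
    specialize (fun H => T H x Hx). replace (0 + x) with x in T by ring.
    eapply is_Cseries_ext; [|apply (is_Cseries_scal q), T].
    + intros n. cbv beta. rewrite Cmult_assoc. f_equal.
      assert (Han := Re_add_INR_ge a 2 n Ha).
      assert (E : euler_coef phi b 0 n = binom_coef b n * CRInt (beta_integrand (a + INR n) p) 0 1).
      { rewrite <- CRInt_scal by (try lra; intros; now apply beta_integrand_continuous).
        apply CRInt_ext; [lra|]. intros t Ht. unfold euler_term, phi, beta_integrand.
        replace (a + INR n - 1) with (a - 1 + INR n) by ring.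
        rewrite <- tpow_mult_nat.
        replace (1 - 0 * RtoC t) with (RtoC 1) by ring. rewrite Cpower_1_l. ring. }
      rewrite E, beta_integral by assumption.
      replace (a + INR n + p) with (c + INR n) by (unfold p; ring).
      unfold q, hyp2F1_coef, binom_coef.
      assert (N1 : rGamma (a + INR n) <> 0) by (apply rGamma_neq_0, nonpole_Re; lra).
      assert (N2 : rGamma (c + INR n) <> 0) by now apply rGamma_neq_0, nonpole_shift.
      rewrite (rGamma_shift c n), (rGamma_shift a n).
      field. repeat split; auto using INR_fact_C, pochn_neq_0.
    + intros t Ht. replace (1 - 0 * RtoC t) with (RtoC 1) by ring. rewrite Cmod_1. lra.
Qed.

(** Term-by-term integration after expanding (1 - t)^(p-1) in powers of t. *)
Lemma euler_int_ibeta (a b p x : C) : 2 <= Re a -> 2 <= Re p -> cut_plane x ->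
  is_Cseries (fun k => binom_coef (1 - p) k * ibeta (a + INR k) b x)
    (euler_int (beta_integrand a p) b x).
Proof.
  intros Ha Hp Hx. set (d := binom_coef (1 - p)).
  destruct (binom_coef_summable_1 p Hp) as [G HG]. fold d in HG.
  assert (Hak := fun k => Re_add_INR_ge a 2 k Ha).
  destruct (cut_plane_dist x Hx) as (rho & R0 & Hrho).
  set (B := exp (Rabs (Re (- b)) * (Rabs (ln rho) + Rabs (ln (1 + Cmod x)))
           + Rabs (Im (- b)) * PI)).
  apply is_Cseries_ext with (fun k => CRInt (fun t => d k *
    (tpow t (a + INR k - 1) * Cpower (1 - x * RtoC t) (- b))) 0 1).
  { intros k. rewrite CRInt_scal; [reflexivity | lra|].
    intros t Ht. now apply ibeta_integrand_continuous. }
  apply (CRInt_series 0 1 ltac:(lra) (fun k t => d k *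
    (tpow t (a + INR k - 1) * Cpower (1 - x * RtoC t) (- b)))
    (fun t => beta_integrand a p t * Cpower (1 - x * RtoC t) (- b))
    (fun k => B * Cmod (d k))%R (B * G)%R).
  - intros k t Ht. apply RCcontinuous_mult; [apply RCcontinuous_const|].
    now apply ibeta_integrand_continuous.
  - intros t Ht. apply (euler_integrand_continuous (beta_integrand a p));
      [|exact Ht | now apply cut_plane_slit].
    intros u _. now apply beta_integrand_continuous.
  - apply summable_scal; [left; apply exp_pos | exact HG].
  - intros k t Ht. rewrite !Cmod_mult.
    assert (T1 : Cmod (tpow t (a + INR k - 1)) <= 1).
    { apply tpow_le_1; [|lra]. specialize (Hak k).
      change (0 <= Re (a + INR k) - 1). lra. }
    assert (T2 : Cmod (Cpower (1 - x * RtoC t) (- b)) <= B).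
    { apply Cmod_Cpower_le; [exact R0|]. split; [apply Hrho; lra|].
      unfold Cminus. eapply Rle_trans; [apply Cmod_triangle|].
      rewrite Cmod_1, Cmod_opp, Cmod_mult, Cmod_R, Rabs_pos_eq by lra.
      assert (X0 := Cmod_ge_0 x). nra. }
    rewrite (Rmult_comm B). apply Rmult_le_compat_l; [apply Cmod_ge_0|].
    rewrite <- (Rmult_1_l B). apply Rmult_le_compat; auto using Cmod_ge_0.
  - intros t Ht.
    apply is_Cseries_ext with (fun k => tpow t (a - 1) * Cpower (1 - x * RtoC t) (- b)
        * (binom_coef (1 - p) k * RtoC t ^ k)).
    + intros k. cbv beta. fold d.
      replace (a + INR k - 1) with (a - 1 + INR k) by ring.
      rewrite <- tpow_mult_nat. ring.
    + replace (beta_integrand a p t * Cpower (1 - x * RtoC t) (- b))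
        with (tpow t (a - 1) * Cpower (1 - x * RtoC t) (- b) * tpow (1 - t) (p - 1))
        by (unfold beta_integrand; ring).
      apply is_Cseries_scal, binomial_series_real, Ht.
Qed.

(** The base case of the continuation, for Re a >= 2 and Re (c - a) >= 2. The expansion
    of [ibeta] at infinity is inserted in [euler_int_ibeta]; the part carrying (-x)^(-b)
    is then a double series, whose other summation is done by [beta_series]. *)
Lemma continued_euler (a b c : C) : ~ Cint (a - b) ->
  2 <= Re a -> 2 <= Re (c - a) -> continued a b c.
Proof.
  intros Hab Ha Hp.
  exists (fun x => rGamma a * rGamma (c - a) / rGamma c * euler_int (beta_integrand a (c - a)) b x).
  split; [now apply euler_is_hyp2F1|]. intros x Hx H1. set (p := c - a) in *.
  assert (Hc : nonpole c).
  { apply nonpole_Re. change (2 <= Re c - Re a) in Hp. lra. }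
  assert (Nc := rGamma_neq_0 c Hc).
  assert (Hsl := cut_opp_slit x Hx H1). assert (NX := slit_neq_0 _ Hsl).
  assert (Nx : x <> 0) by (intros Z; apply NX; rewrite Z; ring).
  set (d := binom_coef (1 - p)). set (X := - x) in *.
  destruct (binom_coef_summable_1 p Hp) as [G HG]. fold d in HG.
  assert (Hak := fun k => Re_add_INR_ge a 2 k Ha).
  assert (Hkab : forall k, ~ Cint (a + INR k - b)).
  { intros k. replace (a + INR k - b) with (a - b + RtoC (IZR (Z.of_nat k)))
      by (rewrite <- INR_IZR_INZ; ring). now apply nonint_shift. }
  assert (Na : rGamma a <> 0) by (apply rGamma_neq_0, nonpole_Re; lra).
  assert (Np : rGamma p <> 0) by (apply rGamma_neq_0, nonpole_Re; lra).
  assert (HE := euler_int_ibeta a b p x Ha Hp Hx). fold d in HE.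
  assert (HJ : exists J : nat -> C, forall k,
    is_Cseries (fun m => binom_coef b m / (a + INR k - b - INR m) * (/ x) ^ m) (J k) /\
    ibeta (a + INR k) b x
      = rGamma b / (rGamma (a + INR k) * rGamma (b - (a + INR k)))
          * Cpower X (- (a + INR k)) + Cpower X (- b) * J k).
  { exists (fun k => CSeries (fun m =>
      binom_coef b m / (a + INR k - b - INR m) * (/ x) ^ m)).
    intros k. destruct (ibeta_connection (a + INR k) b x (Hak k) (Hkab k) Hx H1)
      as (J & HJ & E).
    rewrite (CSeries_unique _ _ HJ). split; [exact HJ | exact E]. }
  destruct HJ as [J HJ].
  destruct (nonint_inv_bound (a - b) Hab) as (M & M0 & HM).
  destruct (binom_coef_summable b (Cmod (/ x))) as [G' HG'].
  { split; [apply Cmod_ge_0|]. rewrite Cmod_inv by exact Nx.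
    rewrite <- Rinv_1. apply Rinv_lt_contravar; lra. }
  assert (Nab : forall m, nonpole (a - b - INR m))
    by (intros m; apply nonint_nonpole, nonint_sub_nat, Hab).
  destruct (is_Cseries_Fubini
    (fun k m => d k * (binom_coef b m / (a + INR k - b - INR m) * (/ x) ^ m))
    (fun k => d k * J k)
    (fun m => binom_coef b m * (/ x) ^ m *
       (rGamma (c - b - INR m) / (rGamma (a - b - INR m) * rGamma p)))
    (fun k => Cmod (d k)) (fun m => M * (Cmod (binom_coef b m) * Cmod (/ x) ^ m))%R
    G (M * G')%R) as (U & HU1 & HU2).
  { exact HG. }
  { apply summable_scal; [lra | exact HG']. }
  { intros k m. rewrite !Cmod_mult, Cmod_pow. apply Rmult_le_compat_l; [apply Cmod_ge_0|].
    unfold Cdiv. rewrite Cmod_mult.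
    replace (a + INR k - b - INR m) with (a - b + INR k - INR m) by ring.
    replace (Cmod (binom_coef b m) * Cmod (/ (a - b + INR k - INR m)) * Cmod (/ x) ^ m)%R
      with (Cmod (/ (a - b + INR k - INR m)) * (Cmod (binom_coef b m) * Cmod (/ x) ^ m))%R
      by ring.
    apply Rmult_le_compat_r; [|apply HM].
    apply Rmult_le_pos; [apply Cmod_ge_0 | apply pow_le, Cmod_ge_0]. }
  { intros k. apply is_Cseries_scal, HJ. }
  { intros m. assert (T := beta_series p (a - b - INR m) Hp (Nab m)).
    replace (a - b - INR m + p) with (c - b - INR m) in T by (unfold p; ring).
    eapply is_Cseries_ext; [|apply (is_Cseries_scal (binom_coef b m * (/ x) ^ m) _ _ T)].
    intros k. cbv beta. fold d.
    replace (a + INR k - b - INR m) with (a - b - INR m + INR k) by ring.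
    unfold Cdiv. ring. }
  assert (HV := is_Cseries_minus _ _ _ _ HE (is_Cseries_scal (Cpower X (- b)) _ _ HU1)).
  cbv beta in HV.
  set (V := euler_int (beta_integrand a p) b x - Cpower X (- b) * U) in HV.
  exists (rGamma a * rGamma p * Cpower X a * V), (rGamma a * rGamma p * U).
  repeat split.
  + eapply is_Cseries_ext; [|apply (is_Cseries_scal (rGamma a * rGamma p * Cpower X a) _ _ HV)].
    intros k. cbv beta. rewrite (proj2 (HJ k)).
    assert (N1 : rGamma (a + INR k) <> 0) by (apply rGamma_neq_0, nonpole_Re; specialize (Hak k); lra).
    assert (N2 := rGamma_nonint _ (nonint_sub_nat _ k (nonint_sym a b Hab))).
    replace (b - (a + INR k)) with (b - a - INR k) by ring.
    replace (- (a + INR k)) with (- a + - INR k) by ring.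
    rewrite Cpower_add, !Cpower_opp, Cpower_nat by exact NX.
    unfold inf_coef. fold p. rewrite (rGamma_sub_nat p).
    rewrite (rGamma_shift a k). unfold d, binom_coef.
    assert (EX : / X ^ k = (-1) ^ k * (/ x) ^ k).
    { rewrite <- Cpow_mult_l, <- Cpow_inv by exact NX. f_equal. unfold X. field. exact Nx. }
    rewrite EX. set (z := (/ x) ^ k). field. repeat split; auto using INR_fact_C, Cpower_neq_0.
  + eapply is_Cseries_ext; [|apply (is_Cseries_scal (rGamma a * rGamma p) _ _ HU2)].
    intros m. cbv beta. unfold inf_coef.
    assert (N2 := rGamma_nonint _ (nonint_sub_nat _ m Hab)).
    set (z := (/ x) ^ m). field. auto.
  + unfold V. fold X. rewrite (Cpower_opp X a). field. repeat split; auto using Cpower_neq_0.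
Qed.

(** The relation raising c reaches Re (c - a) >= 2, and then the one raising a reaches
    Re a >= 2; both leave a - b unchanged modulo the integers. *)
Lemma continued_all (a b c : C) : ~ Cint (a - b) -> nonpole c -> continued a b c.
Proof.
  assert (P : forall n a b c, ~ Cint (a - b) -> nonpole c ->
    (2 <= Re a) -> 2 <= Re (c - a) + INR n -> continued a b c).
  { clear. induction n as [|n IH]; intros a b c Hab Hc Ha Hn.
    - apply continued_euler; auto. change (INR 0) with 0%R in Hn. lra.
    - rewrite S_INR in Hn. change (Re (c - a)) with (Re c - Re a)%R in Hn.
      assert (Hab' : ~ Cint (a + 1 - (b + 1))) by now replace (a + 1 - (b + 1)) with (a - b) by ring.
      apply continued_raise_c; auto; apply IH; auto using nonpole_S.
      + change (2 <= Re c + 1 - Re a + INR n). lra.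
      + replace (c + 2) with (c + 1 + 1) by ring. auto using nonpole_S.
      + rewrite Re_plus_1. lra.
      + change (2 <= Re c + 2 - (Re a + 1) + INR n). lra. }
  assert (Q : forall n a b c, ~ Cint (a - b) -> nonpole c -> 2 <= Re a + INR n -> continued a b c).
  { clear - P. induction n as [|n IH]; intros a b c Hab Hc Hn.
    - change (INR 0) with 0%R in Hn. destruct (INR_unbounded (2 - Re (c - a))) as [m Hm].
      apply (P m); auto; lra.
    - rewrite S_INR in Hn.
      assert (Hab' : ~ Cint (a + 1 - (b + 1))) by now replace (a + 1 - (b + 1)) with (a - b) by ring.
      assert (Hab1 : ~ Cint (a + 1 - b)).
      { replace (a + 1 - b) with (a - b + RtoC (IZR 1)) by ring. now apply nonint_shift. }
      apply continued_raise_a; auto; apply IH; auto using nonpole_S; rewrite Re_plus_1; lra. }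
  intros Hab Hc. destruct (INR_unbounded (2 - Re a)) as [n Hn]. apply (Q n); auto. lra.
Qed.

(** * Uniqueness of the continuation *)

Lemma is_Cseries_term_bound (u : nat -> C) (l : C) :
  is_Cseries u l -> exists M, forall n, Cmod (u n) <= M.
Proof.
  intros H.
  assert (T : is_Clim u 0).
  { replace (RtoC 0) with (l - l) by ring.
    apply is_Clim_ext with (fun n => Csum (n + 1) u - Csum n u).
    - intros n. rewrite Nat.add_1_r. simpl. ring.
    - apply is_Clim_minus; [apply (is_Clim_incr (fun n => Csum n u) l 1), H | exact H]. }
  destruct (filterlim_bounded (V := C_NormedModule) u) as [M HM].
  - exists (RtoC 0). apply filterlim_Clim, T.
  - exists M. exact HM.
Qed.

(** The constant coefficient vanishes by continuity along the direction d; dividing by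
    h reduces the other coefficients to it. *)
Lemma power_series_zero (u : nat -> C) (r e : R) (d : C) :
  (0 < r) -> 0 < e -> d <> 0 ->
  (forall h, Cmod h < r -> exists l, is_Cseries (fun n => u n * h ^ n) l) ->
  (forall s : R, 0 < s < e -> is_Cseries (fun n => u n * (RtoC s * d) ^ n) 0) ->
  forall n, u n = 0.
Proof.
  intros Hr He Hd Hu Hz n. revert u Hu Hz.
  assert (Dp := proj1 (Cmod_gt_0 d) Hd).
  assert (P : forall u, (forall h, (Cmod h < r) -> exists l, is_Cseries (fun n => u n * h ^ n) l) ->
    (forall s : R, 0 < s < e -> is_Cseries (fun n => u n * (RtoC s * d) ^ n) 0) -> u O = 0).
  { intros u Hu Hz.
    set (f := fun h => CSeries (fun n => u n * h ^ n)).
    assert (Hf : forall h, Cmod h < r -> is_Cseries (fun n => u n * h ^ n) (f h)).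
    { intros h Hh. destruct (Hu h Hh) as [l Hl]. unfold f. now rewrite (CSeries_unique _ _ Hl). }
    destruct (is_Cseries_term_bound _ _ (Hf (RtoC (r / 2))
      ltac:(rewrite Cmod_R, Rabs_pos_eq; lra))) as [M HM].
    destruct (Cdiff_power_series u f (r / 2) M 0) as (l & _ & D).
    - intros k. specialize (HM k). rewrite Cmod_mult, Cmod_pow, Cmod_R, Rabs_pos_eq in HM by lra.
      exact HM.
    - intros w Hw. apply Hf. lra.
    - rewrite Cmod_0. lra.
    - assert (F0 : f 0 = u O).
      { apply (is_Cseries_unique (fun n => u n * 0 ^ n)); [apply Hf; rewrite Cmod_0; exact Hr|].
        replace (u O) with (Csum 1 (fun n => u n * 0 ^ n)) by (simpl; ring).
        apply is_Cseries_finite. intros k Hk. destruct k; [lia|]. simpl; ring. }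
      assert (D' := Cdiff_continuous _ _ _ D).
      destruct (Ceq_dec (u O) 0) as [E|E]; [exact E | exfalso].
      apply Cmod_gt_0 in E. destruct (D' _ E) as (dl & Dl & Q).
      set (s := Rmin (e / 2) (Rmin (r / (2 * Cmod d)) (dl / (2 * Cmod d)))).
      assert (Q1 : 0 < r / (2 * Cmod d)) by (apply Rdiv_lt_0_compat; lra).
      assert (Q2 : 0 < dl / (2 * Cmod d)) by (apply Rdiv_lt_0_compat; lra).
      assert (S0 : 0 < s) by (repeat apply Rmin_pos; lra).
      assert (S1 : s <= e / 2) by apply Rmin_l.
      assert (S2 : s <= r / (2 * Cmod d)) by (eapply Rle_trans; [apply Rmin_r | apply Rmin_l]).
      assert (S3 : s <= dl / (2 * Cmod d)) by (eapply Rle_trans; [apply Rmin_r | apply Rmin_r]).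
      assert (Es : Cmod (RtoC s * d) = (s * Cmod d)%R)
        by (rewrite Cmod_mult, Cmod_R, Rabs_pos_eq; lra).
      apply Rle_div_r in S2; [|lra]. apply Rle_div_r in S3; [|lra].
      specialize (Q (RtoC s * d)). rewrite Es in Q. specialize (Q ltac:(lra)).
      rewrite Cplus_0_l, F0 in Q.
      replace (f (RtoC s * d)) with (RtoC 0) in Q.
      + replace (0 - u O) with (- u O) in Q by ring. rewrite Cmod_opp in Q. lra.
      + apply (is_Cseries_unique (fun n => u n * (RtoC s * d) ^ n)); [apply Hz; lra|].
        apply Hf. rewrite Es. lra. }
  induction n as [|n IH]; intros u Hu Hz; [now apply P|].
  assert (U0 := P u Hu Hz).
  assert (Hsh : forall h l : C, h <> 0 -> is_Cseries (fun n => u n * h ^ n) l ->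
            is_Cseries (fun n => u (S n) * h ^ n) (/ h * l)).
  { intros h l Hh Hl.
    assert (T : is_Cseries (fun n => u (S n) * h ^ S n) l).
    { apply (is_Cseries_Sl (fun n => u n * h ^ n)). rewrite U0.
      replace (0 * h ^ 0 + l) with l by ring. exact Hl. }
    eapply is_Cseries_ext; [|apply (is_Cseries_scal (/ h) _ _ T)].
    intros k. cbv beta. rewrite Cpow_S. set (z := h ^ k). field. exact Hh. }
  apply (IH (fun n => u (S n))).
  - intros h Hh. destruct (Ceq_dec h 0) as [->|E].
    + exists (Csum 1 (fun n => u (S n) * 0 ^ n)). apply is_Cseries_finite.
      intros k Hk. destruct k; [lia|]. simpl; ring.
    + destruct (Hu h Hh) as [l Hl]. exists (/ h * l). now apply Hsh.
  - intros s Hs. replace (RtoC 0) with (/ (RtoC s * d) * 0) by ring.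
    apply Hsh; [|now apply Hz]. apply Cmult_neq_0; [|exact Hd]. apply RtoC_neq_0; lra.
Qed.

Lemma cut_plane_ray (x : C) (t : R) : cut_plane x -> 0 <= t <= 1 -> cut_plane (RtoC t * x).
Proof.
  intros Hx Ht [H1 H2]. rewrite re_scal_l in H2. rewrite im_mult in H1. simpl in H1.
  change (snd x) with (Im x) in H1. change (fst x) with (Re x) in H1.
  assert (T0 : (t <> 0)%R) by (intros ->; lra).
  apply Hx. split; [|nra].
  apply (Rmult_eq_reg_l t); [|exact T0]. lra.
Qed.

(** Identity theorem on the cut plane, which is star-shaped about 0: the zero set is
    followed along the ray from 0 to x. *)
Lemma identity_theorem (f : C -> C) :
  (forall x, cut_plane x -> analytic_at f x) ->
  (forall x, Cmod x < 1 -> f x = 0) ->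
  forall x, cut_plane x -> f x = 0.
Proof.
  intros Hf H0 x Hx.
  destruct (Rlt_dec (Cmod x) 1) as [L|L]; [now apply H0|].
  assert (Xp : 0 < Cmod x) by lra. assert (Nx := proj2 (Cmod_gt_0 x) Xp).
  set (E := fun t : R => 0 <= t <= 1 /\ forall s : R, 0 <= s <= t -> f (RtoC s * x) = 0).
  assert (Ec : forall s : R, 0 <= s -> Cmod (RtoC s * x) = (s * Cmod x)%R).
  { intros s Hs. rewrite Cmod_mult, Cmod_R, Rabs_pos_eq; lra. }
  set (t0 := (/ (2 * Cmod x))%R).
  assert (T0 : 0 < t0) by (apply Rinv_0_lt_compat; lra).
  assert (T0x : (t0 * Cmod x = 1 / 2)%R) by (unfold t0; field; lra).
  assert (Et0 : E t0).
  { split; [nra|]. intros s Hs. apply H0. rewrite Ec by lra. nra. }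
  destruct (completeness E) as [T [UB LUB]].
  { exists 1%R. intros t [Ht _]. lra. }
  { now exists t0. }
  assert (HT0 : 0 < T) by (eapply Rlt_le_trans; [exact T0 | now apply UB]).
  assert (HT1 : T <= 1) by (apply LUB; intros t [Ht _]; lra).
  assert (Below : forall s : R, 0 <= s < T -> f (RtoC s * x) = 0).
  { intros s Hs. destruct (classic (exists t, E t /\ s <= t)) as [(t & [Ht Et] & Hst)|N].
    - apply Et. lra.
    - exfalso. assert (T <= s); [|lra]. apply LUB. intros t Et.
      destruct (Rle_dec t s); [assumption|]. exfalso. apply N. exists t. split; [exact Et | lra]. }
  destruct (Hf _ (cut_plane_ray x T Hx ltac:(lra))) as (u & r & Hr & Hu).
  assert (Hu' : forall h, Cmod h < r -> is_Cseries (fun n => u n * h ^ n) (f (RtoC T * x + h))).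
  { intros h Hh. apply is_pseries_Cseries.
    replace h with (RtoC T * x + h - RtoC T * x) at 1 by ring. apply Hu.
    now replace (RtoC T * x + h - RtoC T * x) with h by ring. }
  assert (U0 : forall n, u n = 0).
  { assert (Hrx : 0 < r / Cmod x) by (apply Rdiv_lt_0_compat; lra).
    apply (power_series_zero u r (Rmin T (r / Cmod x)) (- x) Hr).
    - apply Rmin_pos; assumption.
    - intros Z. apply Nx. replace x with (- - x) by ring. rewrite Z. ring.
    - intros h Hh. eexists. now apply Hu'.
    - intros s Hs. assert (S1 := Rlt_le_trans _ _ _ (proj2 Hs) (Rmin_l _ _)).
      assert (S2 := Rlt_le_trans _ _ _ (proj2 Hs) (Rmin_r _ _)).
      apply Rlt_div_r in S2; [|lra].
      rewrite <- (Below (T - s)%R) by lra.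
      replace (RtoC (T - s) * x) with (RtoC T * x + RtoC s * - x)
        by (rewrite RtoC_minus; ring).
      apply Hu'. replace (RtoC s * - x) with (- (RtoC s * x)) by ring.
      rewrite Cmod_opp, Ec by lra. exact S2. }
  assert (Near : forall h, Cmod h < r -> f (RtoC T * x + h) = 0).
  { intros h Hh. apply (is_Cseries_unique _ _ _ (Hu' h Hh)).
    apply (is_Cseries_finite _ 0). intros n _. rewrite U0. ring. }
  destruct (Rle_lt_or_eq_dec _ _ HT1) as [Hlt|Heq].
  - exfalso. set (T' := Rmin 1 (T + r / (2 * Cmod x))).
    assert (Q : 0 < r / (2 * Cmod x)) by (apply Rdiv_lt_0_compat; lra).
    assert (HT' : T < T') by (apply Rmin_glb_lt; lra).
    assert (ET' : E T').
    { split; [split; [lra | apply Rmin_l]|]. intros s Hs.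
      destruct (Rlt_dec s T) as [Hst|Hst]; [apply Below; lra|].
      replace (RtoC s * x) with (RtoC T * x + RtoC (s - T) * x) by (rewrite RtoC_minus; ring).
      apply Near. rewrite Ec by lra.
      assert (B : s <= T + r / (2 * Cmod x)) by (eapply Rle_trans; [apply Hs | apply Rmin_r]).
      apply Rle_lt_trans with (r / (2 * Cmod x) * Cmod x)%R.
      - apply Rmult_le_compat_r; lra.
      - replace (r / (2 * Cmod x) * Cmod x)%R with (r / 2)%R by (field; lra). lra. }
    apply UB in ET'. lra.
  - assert (N := Near 0). rewrite Cmod_0 in N. specialize (N Hr).
    rewrite Heq in N. now replace (1 * x + 0) with x in N by ring.
Qed.

Lemma is_hyp2F1_unique (a b c : C) (F G : C -> C) :
  is_hyp2F1 a b c F -> is_hyp2F1 a b c G -> forall x, cut_plane x -> F x = G x.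
Proof.
  intros [F1 F2] [G1 G2] x Hx.
  assert (E : F x - G x = 0).
  { apply (identity_theorem (fun x => F x - G x)); [| |exact Hx].
    - intros z Hz. destruct (F1 z Hz) as (u & r1 & R1 & P1). destruct (G1 z Hz) as (v & r2 & R2 & P2).
      exists (fun n => u n - v n), (Rmin r1 r2). split; [now apply Rmin_pos|]. intros w Hw.
      specialize (P1 w (Rlt_le_trans _ _ _ Hw (Rmin_l _ _))).
      specialize (P2 w (Rlt_le_trans _ _ _ Hw (Rmin_r _ _))).
      apply is_pseries_Cseries in P1, P2. apply is_pseries_Cseries.
      eapply is_Cseries_ext; [|apply (is_Cseries_minus _ _ _ _ P1 P2)]. intros n; cbv beta; ring.
    - intros z Hz.
      assert (P1 := proj1 (is_pseries_Cseries _ _ _) (F2 z Hz)).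
      assert (P2 := proj1 (is_pseries_Cseries _ _ _) (G2 z Hz)).
      rewrite (is_Cseries_unique _ _ _ P1 P2). ring. }
  replace (F x) with (F x - G x + G x) by ring. rewrite E. ring.
Qed.

Lemma hyp2F1_expansion (a b c x : C) :
  ~ Cint (a - b) -> nonpole c -> cut_plane x -> 1 < Cmod x ->
  inf_expansion a b c (hyp2F1 a b c) x.
Proof.
  intros Hab Hc Hx H1. destruct (continued_all a b c Hab Hc) as (F & HF & EF).
  assert (HH : is_hyp2F1 a b c (hyp2F1 a b c)).
  { unfold hyp2F1. apply epsilon_spec. now exists F. }
  destruct (EF x Hx H1) as (S1 & S2 & A1 & A2 & E). exists S1, S2. repeat split; auto.
  rewrite <- E. now apply (is_hyp2F1_unique a b c).
Qed.

(** * Remainders of double series *)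

Lemma Csum_pick (n p : nat) (v : C) : (p < n)%nat ->
  Csum n (fun m => if (m =? p)%nat then v else 0) = v.
Proof.
  induction n as [|n IH]; intros H; [lia|]. simpl.
  destruct (Nat.eq_dec p n) as [->|E].
  - rewrite Nat.eqb_refl, Csum_0; [ring|].
    intros k Hk. destruct (Nat.eqb_spec k n); [lia | reflexivity].
  - rewrite IH by lia. destruct (Nat.eqb_spec n p); [lia | ring].
Qed.

Lemma Csum_extend (n p : nat) (u : nat -> C) : (n <= p)%nat ->
  (forall k, (n <= k < p)%nat -> u k = 0) -> Csum p u = Csum n u.
Proof.
  induction 1 as [|p Hp IH]; intros H; [reflexivity|]. simpl.
  rewrite IH by (intros; apply H; lia). rewrite H by lia. ring.
Qed.

Lemma Csum_by_weight (t : nat -> nat -> C) (e N : nat) : (1 <= e)%nat ->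
  Csum N (fun n => Csum N (fun m => if (m + e * n <? N)%nat then t n m else 0))
  = Csum N (fun k => Csum (S (k / e)) (fun n => t n (k - e * n)%nat)).
Proof.
  intros He.
  transitivity (Csum N (fun n => Csum N (fun m => Csum N (fun k =>
     if (k =? m + e * n)%nat then t n m else 0)))).
  { apply Csum_ext. intros n Hn. apply Csum_ext. intros m Hm.
    destruct (Nat.ltb_spec (m + e * n) N) as [L|L].
    - symmetry. now apply Csum_pick.
    - symmetry. apply Csum_0. intros k Hk.
      destruct (Nat.eqb_spec k (m + e * n)); [lia | reflexivity]. }
  transitivity (Csum N (fun k => Csum N (fun n => Csum N (fun m =>
     if (k =? m + e * n)%nat then t n m else 0)))).
  { symmetry. etransitivity; [apply Csum_exchange|].
    apply Csum_ext. intros n Hn. apply Csum_exchange. }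
  apply Csum_ext. intros k Hk.
  assert (Hke : (k / e < N)%nat)
    by (apply Nat.le_lt_trans with k; [apply Nat.Div0.div_le_upper_bound; nia | exact Hk]).
  rewrite (Csum_extend (S (k / e)) N); [|lia|].
  2:{ intros n Hn. apply Csum_0. intros m Hm.
      destruct (Nat.eqb_spec k (m + e * n)) as [E|E]; [|reflexivity].
      assert (n <= k / e)%nat by (apply Nat.div_le_lower_bound; lia). lia. }
  apply Csum_ext. intros n Hn.
  assert (Hen : (e * n <= k)%nat).
  { assert (e * (k / e) <= k)%nat by apply Nat.Div0.mul_div_le. nia. }
  rewrite <- (Csum_pick N (k - e * n) (t n (k - e * n)%nat)) by lia.
  apply Csum_ext. intros m Hm.
  destruct (Nat.eqb_spec k (m + e * n)) as [E|E], (Nat.eqb_spec m (k - e * n)) as [E'|E'];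
    try reflexivity; try lia. now rewrite <- E'.
Qed.

(** A double series dominated by q^(m + e n) with q <= 1/2 differs from its part of
    weight below N by O(q^N): on the remaining terms,
    q^w = (2 q)^N q^(w-N) / 2^N <= (2 q)^N / 2^w. *)
Lemma double_series_remainder (t : nat -> nat -> C) (s : nat -> C) (M q : R) (e N : nat) :
  (0 <= M) -> 0 <= q <= 1 / 2 -> (1 <= e)%nat ->
  (forall n m, Cmod (t n m) <= M * q ^ (m + e * n)) ->
  (forall n, is_Cseries (t n) (s n)) ->
  exists S0, is_Cseries s S0 /\
    (Cmod (S0 - Csum N (fun k => Csum (S (k / e)) (fun n => t n (k - e * n)%nat)))
     <= 4 * M * (2 * q) ^ N).
Proof.
  intros HM Hq He Ht Hs.
  set (head := fun n m => if (m + e * n <? N)%nat then t n m else 0).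
  set (tail := fun n m => if (m + e * n <? N)%nat then RtoC 0 else t n m).
  set (Q := (M * (2 * q) ^ N)%R).
  assert (HQ : 0 <= Q) by (apply Rmult_le_pos; [exact HM | apply pow_le; lra]).
  assert (H2 : forall k, 0 <= (1 / 2) ^ k) by (intros; apply pow_le; lra).
  assert (Htail : forall n m, Cmod (tail n m) <= Q * (1 / 2) ^ n * (1 / 2) ^ m).
  { intros n m. unfold tail. destruct (Nat.ltb_spec (m + e * n) N) as [L|L].
    - rewrite Cmod_0. apply Rmult_le_pos; [now apply Rmult_le_pos | apply H2].
    - eapply Rle_trans; [apply Ht|]. unfold Q.
      rewrite !Rmult_assoc. apply Rmult_le_compat_l; [exact HM|].
      set (w := (m + e * n)%nat) in *.
      apply Rle_trans with ((2 * q) ^ N * (1 / 2) ^ w)%R.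
      + replace w with (N + (w - N))%nat by lia.
        rewrite !pow_add, Rpow_mult_distr.
        replace (2 ^ N * q ^ N * ((1 / 2) ^ N * (1 / 2) ^ (w - N)))%R
          with (2 ^ N * (1 / 2) ^ N * (q ^ N * (1 / 2) ^ (w - N)))%R by ring.
        rewrite <- Rpow_mult_distr. replace (2 * (1 / 2))%R with 1%R by field.
        rewrite pow1, Rmult_1_l. apply Rmult_le_compat_l; [apply pow_le; lra|].
        apply pow_incr. lra.
      + apply Rmult_le_compat_l; [apply pow_le; lra|].
        rewrite <- pow_add. replace w with ((n + m) + (w - (n + m)))%nat by (unfold w; nia).
        rewrite pow_add. rewrite <- (Rmult_1_r ((1 / 2) ^ (n + m))) at 2.
        apply Rmult_le_compat_l; [apply H2|].
        apply Rle_trans with (1 ^ (w - (n + m)))%R; [apply pow_incr; lra | rewrite pow1; lra]. }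
  assert (G := summable_geom (1 / 2) ltac:(lra)).
  replace (/ (1 - 1 / 2))%R with 2%R in G by field.
  assert (Hhead : forall n, is_Cseries (head n) (Csum N (head n))).
  { intros n. apply is_Cseries_finite. intros m Hm. unfold head.
    destruct (Nat.ltb_spec (m + e * n) N); [lia | reflexivity]. }
  assert (HT : forall n, is_Cseries (tail n) (s n - Csum N (head n))).
  { intros n. eapply is_Cseries_ext; [|apply (is_Cseries_minus _ _ _ _ (Hs n) (Hhead n))].
    intros m. cbv beta. unfold head, tail. destruct (m + e * n <? N)%nat; ring. }
  assert (HTb : forall n, Cmod (s n - Csum N (head n)) <= 2 * Q * (1 / 2) ^ n).
  { intros n. replace (2 * Q * (1 / 2) ^ n)%R with (Q * (1 / 2) ^ n * 2)%R by ring.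
    eapply is_Cseries_bound; [|apply Htail | apply HT].
    apply summable_scal; [now apply Rmult_le_pos | exact G]. }
  assert (G2 : summable (fun n => 2 * Q * (1 / 2) ^ n)%R (2 * Q * 2))
    by (apply summable_scal; [lra | exact G]).
  destruct (is_Cseries_dominated _ _ _ G2 HTb) as [T HTT].
  assert (HH : is_Cseries (fun n => Csum N (head n)) (Csum N (fun n => Csum N (head n)))).
  { apply is_Cseries_finite. intros n Hn. apply Csum_0. intros m Hm. unfold head.
    destruct (Nat.ltb_spec (m + e * n) N); [nia | reflexivity]. }
  exists (T + Csum N (fun n => Csum N (head n))). split.
  - eapply is_Cseries_ext; [|apply (is_Cseries_plus _ _ _ _ HTT HH)]. intros n; cbv beta; ring.
  - rewrite <- (Csum_by_weight t e N He). fold head.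
    change (fun n => Csum N (fun m => if (m + e * n <? N)%nat then t n m else 0))
      with (fun n => Csum N (head n)).
    match goal with |- (Cmod ?z <= _) => replace z with T by ring end.
    replace (4 * M * (2 * q) ^ N)%R with (2 * Q * 2)%R by (unfold Q; ring).
    exact (is_Cseries_bound _ _ _ _ G2 HTb HTT).
Qed.

(** * The double series for Phi1 at infinity *)

Lemma RtoC_pow_m1 (k : nat) : RtoC (powerRZ (-1) (Z.of_nat k)) = (-1) ^ k.
Proof. rewrite <- pow_powerRZ, RtoC_pow. reflexivity. Qed.

Lemma Cpow_m1_sqr (k : nat) : (-1) ^ k * (-1) ^ k = 1.
Proof.
  rewrite <- Cpow_mult_l. replace (-1 * -1) with (RtoC 1) by ring. apply Cpow_1_l.
Qed.

Lemma Cpow_m1_neq_0 (k : nat) : (-1) ^ k <> 0.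
Proof. intros Z. assert (A := Cpow_m1_sqr k). rewrite Z in A. rewrite Cmult_0_l in A. injection A; lra. Qed.

Lemma powerRZ_m1_opp (k : nat) : RtoC (powerRZ (-1) (- Z.of_nat k)) = (-1) ^ k.
Proof.
  rewrite powerRZ_neg'. rewrite RtoC_inv, RtoC_pow_m1 by (apply powerRZ_NOR; lra).
  assert (N := Cpow_m1_neq_0 k). rewrite <- (Cmult_1_r (/ _)), <- (Cpow_m1_sqr k). field. exact N.
Qed.

Lemma powerRZ_m1_sqr (j : Z) : RtoC (powerRZ (-1) j) * RtoC (powerRZ (-1) j) = 1.
Proof.
  rewrite <- RtoC_mult, <- powerRZ_mult.
  replace (-1 * -1)%R with 1%R by ring. now rewrite powerRZ_R1.
Qed.

Lemma Cint_IZR_sub (z : C) (j : Z) : Cint (z - RtoC (IZR j)) -> Cint z.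
Proof.
  intros [k E]. exists (k + j)%Z. rewrite plus_IZR, RtoC_plus, <- E. ring.
Qed.

Lemma rGamma_sub_poch (z : C) (j : Z) : ~ Cint z ->
  rGamma (z - RtoC (IZR j)) = RtoC (powerRZ (-1) j) * (rGamma z * poch (1 - z) j).
Proof.
  intros Hz. unfold poch. destruct (Z.leb_spec 0 j) as [H|H].
  - rewrite <- (Z2Nat.id j) at 1 2 by exact H. set (k := Z.to_nat j).
    rewrite <- INR_IZR_INZ, RtoC_pow_m1, rGamma_sub_nat. ring.
  - set (k := Z.to_nat (- j)). replace j with (- Z.of_nat k)%Z by (unfold k; lia).
    rewrite powerRZ_m1_opp, opp_IZR, <- INR_IZR_INZ, RtoC_opp.
    replace (1 - z + - INR k) with (1 - z - INR k) by ring.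
    rewrite (pochn_reflect (1 - z) k). replace (1 - (1 - z)) with z by ring.
    replace (z - - INR k) with (z + INR k) by ring.
    rewrite (rGamma_shift z k).
    assert (N := pochn_neq_0 z k (nonint_nonpole z Hz)). assert (N' := Cpow_m1_neq_0 k).
    field. auto.
Qed.

(** Both cases in the definition of [rGamma_poch] have the value (-1)^j / Gamma(c-b-j). *)
Lemma rGamma_poch_eq (b c : C) (j : Z) :
  rGamma_poch b c j = RtoC (powerRZ (-1) j) * rGamma (c - b - RtoC (IZR j)).
Proof.
  unfold rGamma_poch. destruct (excluded_middle_informative (Cint (c - b))) as [H|H]; [reflexivity|].
  rewrite (rGamma_sub_poch (c - b) j H). replace (1 - (c - b)) with (b - c + 1) by ring.
  rewrite Cmult_assoc, powerRZ_m1_sqr. ring.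
Qed.

Section Coefficients.

Variables a b c eta : C.
Hypothesis Hab : ~ Cint (a - b).

(** Coefficients of x^(-m-2n) and x^(-m-n) in the two double series; for fixed n they
    come from the expansion of 2F1(a+n,b;c+n;x) at infinity. *)
Definition coef1 (n m : nat) : C :=
  pochn a (m + n) * pochn (a - c + 1) m
  / (pochn (a - b + 1) (m + n) * INR (fact m) * INR (fact n)) * eta ^ n.

Definition coef2 (n m : nat) : C :=
  let j := (Z.of_nat m - Z.of_nat n)%Z in
  pochn b m * rGamma_poch b c j
  / (poch (b - a + 1) j * INR (fact m) * INR (fact n)) * eta ^ n.

Lemma nonpole_ab1 : nonpole (a - b + 1).
Proof. apply (nonpole_shift _ 1), nonint_nonpole, Hab. Qed.

Lemma inf_coef_coef1 (n m : nat) :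
  pochn a n / INR (fact n) * ((-1) ^ n * eta ^ n)
    * inf_coef (a + INR n) b (c + INR n) m
  = rGamma b * rGamma (c - a) / rGamma (b - a) * coef1 n m.
Proof.
  unfold inf_coef, coef1, binom_coef.
  replace (c + INR n - (a + INR n) - INR m) with (c - a - INR m) by ring.
  replace (b - (a + INR n) - INR m) with (b - a - INR (m + n))
    by (rewrite plus_INR, RtoC_plus; ring).
  rewrite !rGamma_sub_nat.
  replace (1 - (c - a)) with (a - c + 1) by ring. replace (1 - (b - a)) with (a - b + 1) by ring.
  rewrite (Nat.add_comm m n), (pochn_add a), Cpow_add_r.
  assert (N1 := rGamma_nonint _ (nonint_sym a b Hab)).
  assert (N2 := pochn_neq_0 _ (n + m) nonpole_ab1).
  assert (N3 := Cpow_m1_neq_0 n). assert (N4 := Cpow_m1_neq_0 m).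
  field. repeat split; auto using INR_fact_C.
Qed.

Lemma inf_coef_coef2 (n m : nat) :
  pochn a n / INR (fact n) * eta ^ n
    * inf_coef b (a + INR n) (c + INR n) m
  = rGamma a / rGamma (a - b) * coef2 n m.
Proof.
  unfold inf_coef, coef2, binom_coef. set (j := (Z.of_nat m - Z.of_nat n)%Z).
  assert (Ej : RtoC (IZR j) = RtoC (INR m) - INR n).
  { unfold j. rewrite minus_IZR, RtoC_minus, <- !INR_IZR_INZ. reflexivity. }
  replace (c + INR n - b - INR m) with (c - b - RtoC (IZR j)) by (rewrite Ej; ring).
  replace (a + INR n - b - INR m) with (a - b - RtoC (IZR j)) by (rewrite Ej; ring).
  assert (N0 : rGamma (a - b - RtoC (IZR j)) <> 0).
  { apply rGamma_nonint. intros H. now apply Hab, (Cint_IZR_sub _ j). }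
  rewrite rGamma_poch_eq, (rGamma_shift a n).
  rewrite (rGamma_sub_poch (a - b) j Hab) in *.
  replace (1 - (a - b)) with (b - a + 1) in * by ring.
  assert (N1 := rGamma_nonint _ Hab).
  assert (N2 : poch (b - a + 1) j <> 0) by (intros Z; apply N0; rewrite Z; ring).
  assert (N3 : RtoC (powerRZ (-1) j) <> 0) by (intros Z; apply N0; rewrite Z; ring).
  assert (E3 := powerRZ_m1_sqr j).
  set (sg := RtoC (powerRZ (-1) j)) in *.
  match goal with |- ?l = ?r => replace r with (r * 1) by ring end.
  rewrite <- Cmult_1_r at 1. rewrite <- E3 at 2.
  field. repeat split; auto using INR_fact_C.
Qed.

End Coefficients.

Lemma shift_ratio_bound (u v : C) : exists n0, forall n, (n0 <= n)%nat ->
  (Cmod (u + INR n) <= 2 * Cmod (v + INR n)).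
Proof.
  destruct (INR_unbounded (Cmod u + 2 * Cmod v)) as [n0 H]. exists n0. intros n Hn.
  apply le_INR in Hn.
  assert (A := Cmod_triangle u (RtoC (INR n))).
  assert (B := Cmod_triangle (v + INR n) (- v)). rewrite Cmod_opp in B.
  replace (v + INR n + - v) with (RtoC (INR n)) in B by ring.
  rewrite Cmod_R, Rabs_pos_eq in A, B by apply pos_INR. lra.
Qed.

Lemma Cmod_sub_nat (u : C) (n : nat) : Cmod (u - INR n) = Cmod (- u + INR n).
Proof. rewrite <- Cmod_opp. f_equal. ring. Qed.

Lemma inv_fact_le_1 (n : nat) : Cmod (/ INR (fact n)) <= 1.
Proof.
  rewrite Cmod_inv, Cmod_R, Rabs_pos_eq by first [apply INR_fact_C | apply pos_INR].
  rewrite <- Rinv_1. apply Rinv_le_contravar; [lra|].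
  apply (le_INR 1), lt_O_fact.
Qed.

Lemma pow_div_fact_bound (z : C) (H : R) (n : nat) : Cmod z <= H ->
  Cmod (/ RtoC (INR (fact n))) * Cmod z ^ n <= H ^ n.
Proof.
  intros Hz. rewrite <- (Rmult_1_l (H ^ n)).
  apply Rmult_le_compat; auto using Cmod_ge_0, inv_fact_le_1.
  - apply pow_le, Cmod_ge_0.
  - apply pow_incr. split; [apply Cmod_ge_0 | exact Hz].
Qed.

(** Ratios of Pochhammer symbols grow at most like 2^(m+n) and 2^m, and eta is bounded. *)
Lemma coef1_bound (a b c : C) (H : R) : ~ Cint (a - b) -> 1 <= H ->
  exists M, 0 < M /\ forall eta n m, Cmod eta <= H ->
    (Cmod (coef1 a b c eta n m) <= M * (4 * H) ^ (m + 2 * n)).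
Proof.
  intros Hab HH. set (v := a - b + 1).
  assert (Hv : nonpole v) by now apply nonpole_ab1.
  destruct (shift_ratio_bound a v) as [n0 Hn0].
  destruct (geometric_bound (fun k => pochn a k / pochn v k) 2 n0) as (M1 & P1 & B1); [lra| |].
  { intros n Hn. simpl.
    assert (N1 := pochn_neq_0 v n Hv). assert (N2 := nonpole_add v n Hv).
    replace (pochn a n * (a + INR n) / (pochn v n * (v + INR n)))
      with ((a + INR n) / (v + INR n) * (pochn a n / pochn v n)) by (field; auto).
    rewrite Cmod_mult. apply Rmult_le_compat_r; [apply Cmod_ge_0|].
    rewrite Cmod_div by exact N2. apply Rle_div_l; [now apply Cmod_gt_0 | now apply Hn0]. }
  destruct (binom_coef_bound (a - c + 1) 2 ltac:(lra)) as (M2 & P2 & B2).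
  exists (M1 * M2)%R. split; [now apply Rmult_lt_0_compat|]. intros eta n m Heta.
  unfold coef1. fold v.
  assert (Nv := pochn_neq_0 v (m + n) Hv).
  replace (pochn a (m + n) * pochn (a - c + 1) m
    / (pochn v (m + n) * INR (fact m) * INR (fact n)) * eta ^ n)
    with (pochn a (m + n) / pochn v (m + n) * binom_coef (a - c + 1) m
          * (/ INR (fact n) * eta ^ n))
    by (unfold binom_coef; field; auto using INR_fact_C).
  rewrite !Cmod_mult, Cmod_pow.
  assert (En := pow_div_fact_bound eta H n Heta).
  specialize (B1 (m + n)%nat). cbv beta in B1. specialize (B2 m).
  apply Rle_trans with (M1 * 2 ^ (m + n) * (M2 * 2 ^ m) * H ^ n)%R.
  - apply Rmult_le_compat; auto.
    + apply Rmult_le_pos; apply Cmod_ge_0.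
    + apply Rmult_le_pos; [apply Cmod_ge_0 | apply pow_le, Cmod_ge_0].
    + apply Rmult_le_compat; auto using Cmod_ge_0.
  - replace (M1 * 2 ^ (m + n) * (M2 * 2 ^ m) * H ^ n)%R
      with (M1 * M2 * ((2 * 2) ^ m * (2 * H) ^ n))%R
      by (rewrite pow_add, !Rpow_mult_distr; ring).
    rewrite Rmult_assoc, Rmult_assoc.
    apply Rmult_le_compat_l; [lra|]. apply Rmult_le_compat_l; [lra|].
    rewrite pow_add, pow_mult.
    apply Rmult_le_compat; try (apply pow_le; lra); apply pow_incr; split; try lra; simpl; nra.
Qed.

(** The quotient of Gamma functions is indexed by m - n, of either sign, and its
    numerator may vanish; it is bounded by walking away from m = n in both directions. *)
Lemma coef2_bound (a b c : C) (H : R) : ~ Cint (a - b) -> 1 <= H ->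
  exists M, 0 < M /\ forall eta n m, Cmod eta <= H ->
    (Cmod (coef2 a b c eta n m) <= M * (4 * H) ^ (m + 1 * n)).
Proof.
  intros Hab HH.
  assert (Nj : forall z : C, ~ Cint z -> forall n : nat, z + INR n <> 0)
    by (intros z Hz n; now apply nonpole_add, nonint_nonpole).
  assert (Hba := nonint_opp _ Hab).
  set (g := fun j : Z => rGamma (c - b - RtoC (IZR j)) / rGamma (a - b - RtoC (IZR j))).
  assert (Ng : forall j : Z, rGamma (a - b - RtoC (IZR j)) <> 0).
  { intros j. apply rGamma_nonint. intros Hc. now apply Hab, (Cint_IZR_sub _ j). }
  assert (Gs : forall j, g (j + 1)%Z * (a - b - RtoC (IZR j) - 1) = (c - b - RtoC (IZR j) - 1) * g j).
  { intros j. unfold g. assert (N1 := Ng j). assert (N2 := Ng (j + 1)%Z).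
    rewrite plus_IZR, RtoC_plus in *.
    replace (c - b - RtoC (IZR j)) with (c - b - (RtoC (IZR j) + 1) + 1) by ring.
    replace (a - b - RtoC (IZR j)) with (a - b - (RtoC (IZR j) + 1) + 1) in * by ring.
    rewrite (rGamma_rec (c - b - (RtoC (IZR j) + 1))).
    rewrite (rGamma_rec (a - b - (RtoC (IZR j) + 1))) in *.
    set (u := a - b - (RtoC (IZR j) + 1)) in *. set (w := c - b - (RtoC (IZR j) + 1)).
    assert (N3 : u <> 0) by (intros Z; apply N2; rewrite Z; ring).
    field. auto. }
  destruct (shift_ratio_bound (- (c - b - 1)) (- (a - b - 1))) as [n1 Hn1].
  destruct (geometric_bound (fun k => g (Z.of_nat k)) 2 n1) as (M1 & P1 & B1); [lra| |].
  { intros n Hn. specialize (Hn1 n Hn). assert (E := f_equal Cmod (Gs (Z.of_nat n))).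
    rewrite !Cmod_mult in E.
    replace (Z.of_nat n + 1)%Z with (Z.of_nat (S n)) in E by lia.
    rewrite <- INR_IZR_INZ in E.
    replace (a - b - INR n - 1) with (a - b - 1 - INR n) in E by ring.
    replace (c - b - INR n - 1) with (c - b - 1 - INR n) in E by ring.
    rewrite !Cmod_sub_nat in E.
    assert (P : 0 < Cmod (- (a - b - 1) + INR n)).
    { apply Cmod_gt_0. replace (- (a - b - 1) + INR n) with (- (a - b) + INR (S n))
        by (rewrite S_INR, RtoC_plus; ring). now apply Nj. }
    set (A := Cmod (- (a - b - 1) + INR n)) in *.
    set (B := Cmod (- (c - b - 1) + INR n)) in *.
    assert (G0 := Cmod_ge_0 (g (Z.of_nat n))).
    apply Rmult_le_reg_r with A; [exact P|]. rewrite E. nra. }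
  (* Downwards the recurrence is divided by c - b + n, nonzero for large n. *)
  destruct (shift_ratio_bound (a - b) (c - b)) as [n2 Hn2].
  destruct (INR_unbounded (Cmod (c - b))) as [n3 Hn3].
  destruct (geometric_bound (fun k => g (- Z.of_nat k)%Z) 2 (n2 + n3)) as (M2 & P2 & B2); [lra| |].
  { intros n Hn. specialize (Hn2 n ltac:(lia)). assert (E := f_equal Cmod (Gs (- Z.of_nat n - 1)%Z)).
    rewrite !Cmod_mult in E.
    replace (- Z.of_nat n - 1 + 1)%Z with (- Z.of_nat n)%Z in E by lia.
    replace (- Z.of_nat n - 1)%Z with (- Z.of_nat (S n))%Z in E by lia.
    rewrite opp_IZR, <- INR_IZR_INZ, S_INR in E.
    replace (a - b - RtoC (- (INR n + 1)) - 1) with (a - b + INR n) in E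
      by (rewrite RtoC_opp, RtoC_plus; ring).
    replace (c - b - RtoC (- (INR n + 1)) - 1) with (c - b + INR n) in E
      by (rewrite RtoC_opp, RtoC_plus; ring).
    assert (P : 0 < Cmod (c - b + INR n)).
    { assert (Q : INR n3 <= INR n) by (apply le_INR; lia).
      assert (T := Cmod_triangle (c - b + INR n) (- (c - b))). rewrite Cmod_opp in T.
      replace (c - b + INR n + - (c - b)) with (RtoC (INR n)) in T by ring.
      rewrite Cmod_R, Rabs_pos_eq in T by apply pos_INR. lra. }
    set (A := Cmod (a - b + INR n)) in *.
    set (B := Cmod (c - b + INR n)) in *.
    assert (G0 := Cmod_ge_0 (g (- Z.of_nat n)%Z)).
    apply Rmult_le_reg_l with B; [exact P|]. rewrite <- E. nra. }
  assert (Bg : forall n m : nat, (Cmod (g (Z.of_nat m - Z.of_nat n)%Z) <= (M1 + M2) * 2 ^ (m + n))).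
  { intros n m.
    assert (Le : forall k, (k <= m + n)%nat -> 2 ^ k <= 2 ^ (m + n))
      by (intros k Hk; apply Rle_pow; [lra | exact Hk]).
    destruct (Nat.le_ge_cases n m) as [L|L].
    - replace (Z.of_nat m - Z.of_nat n)%Z with (Z.of_nat (m - n)) by lia.
      eapply Rle_trans; [apply B1|]. apply Rmult_le_compat; [lra | apply pow_le; lra | lra |].
      apply Le. lia.
    - replace (Z.of_nat m - Z.of_nat n)%Z with (- Z.of_nat (n - m))%Z by lia.
      eapply Rle_trans; [apply B2|]. apply Rmult_le_compat; [lra | apply pow_le; lra | lra |].
      apply Le. lia. }
  destruct (binom_coef_bound b 2 ltac:(lra)) as (M3 & P3 & B3).
  set (M4 := Cmod (rGamma (a - b))).
  assert (P4 : 0 < M4) by now apply Cmod_gt_0, rGamma_nonint.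
  exists (M4 * ((M1 + M2) * M3))%R.
  split; [apply Rmult_lt_0_compat; [exact P4 | apply Rmult_lt_0_compat; lra]|].
  intros eta n m Heta.
  assert (E : coef2 a b c eta n m = rGamma (a - b) * (g (Z.of_nat m - Z.of_nat n)%Z * binom_coef b m)
                * (/ INR (fact n) * eta ^ n)).
  { unfold coef2, g. set (j := (Z.of_nat m - Z.of_nat n)%Z).
    assert (N0 := Ng j). rewrite rGamma_poch_eq. rewrite (rGamma_sub_poch (a - b) j Hab) in *.
    replace (1 - (a - b)) with (b - a + 1) in * by ring.
    assert (N1 := rGamma_nonint _ Hab).
    assert (N2 : poch (b - a + 1) j <> 0) by (intros Z; apply N0; rewrite Z; ring).
    assert (N3 : RtoC (powerRZ (-1) j) <> 0) by (intros Z; apply N0; rewrite Z; ring).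
    assert (E3 : RtoC (powerRZ (-1) j) = / RtoC (powerRZ (-1) j)).
    { rewrite <- (Cmult_1_r (/ _)).
      rewrite <- (powerRZ_m1_sqr j). field. exact N3. }
    rewrite E3 at 1. unfold binom_coef. field. repeat split; auto using INR_fact_C. }
  rewrite E, !Cmod_mult, Cmod_pow. fold M4.
  assert (En := pow_div_fact_bound eta H n Heta).
  specialize (Bg n m). specialize (B3 m).
  apply Rle_trans with (M4 * ((M1 + M2) * 2 ^ (m + n) * (M3 * 2 ^ m)) * H ^ n)%R.
  - apply Rmult_le_compat; auto.
    + apply Rmult_le_pos; [lra|]. apply Rmult_le_pos; apply Cmod_ge_0.
    + apply Rmult_le_pos; [apply Cmod_ge_0 | apply pow_le, Cmod_ge_0].
    + apply Rmult_le_compat_l; [lra|]. apply Rmult_le_compat; auto using Cmod_ge_0.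
  - replace (M4 * ((M1 + M2) * 2 ^ (m + n) * (M3 * 2 ^ m)) * H ^ n)%R
      with (M4 * ((M1 + M2) * M3) * ((2 * 2) ^ m * (2 * H) ^ n))%R
      by (rewrite pow_add, !Rpow_mult_distr; ring).
    apply Rmult_le_compat_l.
    { apply Rmult_le_pos; [lra|]. apply Rmult_le_pos; lra. }
    rewrite pow_add, Nat.mul_1_l.
    apply Rmult_le_compat; try (apply pow_le; lra); apply pow_incr; split; lra.
Qed.

Lemma Cmod_Cpower_bound (z w : C) : z <> 0 ->
  (Cmod (Cpower z w) <= exp (Rabs (Im w) * PI) * Rpower (Cmod z) (Re w)).
Proof.
  intros Hz. unfold Cpower. rewrite Cmod_Cexp, re_mult. simpl.
  change (fst w) with (Re w). change (snd w) with (Im w).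
  unfold Rpower. rewrite <- exp_plus.
  assert (A := Carg_bound z Hz).
  assert (A' : Rabs (Carg z) <= PI) by (apply Rabs_le; lra).
  assert (Q := Rle_abs (- (Im w * Carg z))). rewrite Rabs_Ropp, Rabs_mult in Q.
  assert (Q' := Rmult_le_compat_l _ _ _ (Rabs_pos (Im w)) A').
  assert (H : Re w * ln (Cmod z) - Im w * Carg z <= Rabs (Im w) * PI + Re w * ln (Cmod z)) by lra.
  destruct (Rle_lt_or_eq_dec _ _ H) as [H'|H']; [left; now apply exp_increasing|].
  rewrite H'. lra.
Qed.

(** The n-th term of the series for Phi1, with 2F1(a+n,b;c+n;x) expanded at infinity
    and y = eta / x: the Gamma quotients lose their dependence on n. *)
Lemma Phi1_term_expansion (a b c x y : C) (n : nat) :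
  ~ Cint (a - b) -> nonpole c -> cut_plane x -> 1 < Cmod x ->
  exists S1 S2,
    is_Cseries (fun m => rGamma b * rGamma (c - a) / rGamma (b - a)
                         * coef1 a b c (x * y) n m * (/ x) ^ (m + 2 * n)) S1 /\
    is_Cseries (fun m => rGamma a / rGamma (a - b)
                         * coef2 a b c (x * y) n m * (/ x) ^ (m + 1 * n)) S2 /\
    pochn a n / pochn c n * hyp2F1 (a + INR n) b (c + INR n) x * (y ^ n / INR (fact n))
    = / rGamma c * (Cpower (- x) (- a) * S1 + Cpower (- x) (- b) * S2).
Proof.
  intros Hab Hc Hx H1.
  assert (NX := slit_neq_0 _ (cut_opp_slit x Hx H1)).
  assert (Nx : x <> 0) by (intros Z; apply NX; rewrite Z; ring).
  assert (Nc := rGamma_neq_0 c Hc).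
  set (eta := x * y).
  assert (Hn1 : ~ Cint (a + INR n - b)).
  { replace (a + INR n - b) with (a - b + RtoC (IZR (Z.of_nat n)))
      by (rewrite <- INR_IZR_INZ; ring). now apply nonint_shift. }
  destruct (hyp2F1_expansion (a + INR n) b (c + INR n) x Hn1
              (nonpole_shift c n Hc) Hx H1) as (T1 & T2 & HT1 & HT2 & E).
  assert (Ey : y ^ n = eta ^ n * (/ x) ^ n).
  { rewrite <- Cpow_mult_l. f_equal. unfold eta. field. exact Nx. }
  set (z := (/ x) ^ n) in *.
  assert (Nf := INR_fact_C n).
  exists (pochn a n / INR (fact n) * ((-1) ^ n * eta ^ n) * (z * z) * T1),
         (pochn a n / INR (fact n) * eta ^ n * z * T2).
  repeat split.
  - eapply is_Cseries_ext; [|apply (is_Cseries_scal _ _ _ HT1)]. intros m. cbv beta.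
    rewrite <- inf_coef_coef1 by exact Hab.
    rewrite Cpow_add_r, (Nat.mul_comm 2 n), Cpow_mult_r. fold z.
    replace (z ^ 2) with (z * z) by ring. ring.
  - eapply is_Cseries_ext; [|apply (is_Cseries_scal _ _ _ HT2)]. intros m. cbv beta.
    rewrite <- inf_coef_coef2 by exact Hab.
    rewrite Cpow_add_r, Nat.mul_1_l. fold z. ring.
  - rewrite E, Ey, (rGamma_shift c n).
    replace (- (a + INR n)) with (- a + - INR n) by ring.
    rewrite Cpower_add, (Cpower_opp _ (RtoC (INR n))), Cpower_nat by exact NX.
    assert (EX : / (- x) ^ n = (-1) ^ n * z).
    { unfold z. rewrite <- Cpow_mult_l, <- Cpow_inv by exact NX. f_equal. field. exact Nx. }
    rewrite EX.
    assert (N1 := pochn_neq_0 c n Hc). assert (N2 := rGamma_neq_0 _ (nonpole_shift c n Hc)).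
    field. auto.
Qed.

Theorem theorem3p10 (a b c : C)
    (hc : forall k : nat, c <> RtoC (- INR k)%R)
    (hab : ~ Cint (a - b))
    (eta1 eta2 : R) (heta1 : (0 < eta1)%R) (N : nat)
    (hN : (Rmax 1 (Rmax (Cmod a) (Cmod b)) <= INR N)%R) :
  exists K X : R, (0 < K)%R /\ (0 < X)%R /\
    forall x y : C,
      (X <= Cmod x)%R ->
      (Rabs (Carg (- x)) < PI)%R ->
      (eta1 <= Cmod (x * y) <= eta2)%R ->
      (Cmod (Phi1 a b c x y
             - (Gamma c * Gamma (b - a) * rGamma b * rGamma (c - a)
                  * Cpower (- x) (- a)
                  * Csum N (fun k => (b1 a b c k (x * y) / x ^ k)%C)
                + Gamma c * Gamma (a - b) * rGamma a
                  * Cpower (- x) (- b)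
                  * Csum N (fun k => (rGamma_b2 a b c k (x * y) / x ^ k)%C)))%C
       <= K * (Rpower (Cmod x) (- Re a - INR N)
               + Rpower (Cmod x) (- Re b - INR N)))%R.
Proof.
  set (H := Rmax 1 eta2). assert (HH : 1 <= H) by apply Rmax_l.
  destruct (coef1_bound a b c H hab HH) as (M1 & P1 & B1).
  destruct (coef2_bound a b c H hab HH) as (M2 & P2 & B2).
  set (A := (4 * H)%R) in *.
  set (k1 := rGamma b * rGamma (c - a) / rGamma (b - a)).
  set (k2 := rGamma a / rGamma (a - b)).
  set (e1 := exp (Rabs (Im (- a)) * PI)). set (e2 := exp (Rabs (Im (- b)) * PI)).
  assert (E1 : 0 < e1) by apply exp_pos. assert (E2 : 0 < e2) by apply exp_pos.
  assert (HA : 4 <= A) by (unfold A; lra).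
  set (AN := ((2 * A) ^ N)%R). assert (PAN : 0 < AN) by (apply pow_lt; lra).
  set (K1 := (Cmod (/ rGamma c * k1) * (4 * M1) * AN * e1)%R).
  set (K2 := (Cmod (/ rGamma c * k2) * (4 * M2) * AN * e2)%R).
  assert (HK1 : 0 <= K1).
  { unfold K1. repeat apply Rmult_le_pos; try lra; apply Cmod_ge_0. }
  assert (HK2 : 0 <= K2).
  { unfold K2. repeat apply Rmult_le_pos; try lra; apply Cmod_ge_0. }
  exists (K1 + K2 + 1)%R, (2 * A)%R. split; [lra|]. split; [lra|].
  intros x y Hx Harg Hxy. set (eta := x * y) in *.
  assert (Nx : x <> 0) by (apply Cmod_gt_0; lra).
  assert (NX : - x <> 0) by (intros Z; apply Nx; replace x with (- - x) by ring; rewrite Z; ring).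
  assert (Hsl := slit_of_Carg _ NX Harg).
  assert (Hcut : cut_plane x).
  { intros [I1 I2]. destruct Hsl as [S|S].
    - change (0 < - Re x) in S. lra.
    - apply S. change (- Im x = 0)%R. lra. }
  assert (Heta : Cmod eta <= H) by (eapply Rle_trans; [apply Hxy | apply Rmax_r]).
  assert (Nc := rGamma_neq_0 c hc).
  assert (Hn := fun n => Phi1_term_expansion a b c x y n hab hc Hcut ltac:(lra)).
  cbv beta in Hn. fold eta k1 k2 in Hn.
  destruct (choice _ Hn) as [s1 Hn']. destruct (choice _ Hn') as [s2 Hs]. clear Hn Hn'.
  set (q := (A / Cmod x)%R).
  assert (Hq : 0 <= q <= 1 / 2).
  { unfold q. split; [apply Rle_div_r | apply Rle_div_l]; lra. }
  assert (Hpow : forall k, Cmod ((/ x) ^ k) = (/ Cmod x ^ k)%R).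
  { intros k. now rewrite Cmod_pow, Cmod_inv, pow_inv by exact Nx. }
  assert (Bd : forall k cf M w, Cmod cf <= M * A ^ w ->
     (Cmod (k * cf * (/ x) ^ w) <= Cmod k * M * q ^ w)).
  { intros k cf M w B. rewrite !Cmod_mult, Hpow. unfold q, Rdiv.
    rewrite Rpow_mult_distr, pow_inv.
    replace (Cmod k * M * (A ^ w * / Cmod x ^ w))%R with (Cmod k * (M * A ^ w) * / Cmod x ^ w)%R by ring.
    apply Rmult_le_compat_r; [left; apply Rinv_0_lt_compat, pow_lt; lra|].
    apply Rmult_le_compat_l; [apply Cmod_ge_0 | exact B]. }
  assert (C0 := fun z => Cmod_ge_0 z).
  destruct (double_series_remainder (fun n m => k1 * coef1 a b c eta n m * (/ x) ^ (m + 2 * n)) s1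
    (Cmod k1 * M1) q 2 N) as (S1 & HS1 & R1);
    [apply Rmult_le_pos; [auto | lra] | exact Hq | lia | intros n m; now apply Bd, B1 | apply Hs|].
  destruct (double_series_remainder (fun n m => k2 * coef2 a b c eta n m * (/ x) ^ (m + 1 * n)) s2
    (Cmod k2 * M2) q 1 N) as (S2 & HS2 & R2);
    [apply Rmult_le_pos; [auto | lra] | exact Hq | lia | intros n m; now apply Bd, B2 | apply Hs|].
  cbv beta in R1, R2.
  assert (EP : Phi1 a b c x y = / rGamma c * (Cpower (- x) (- a) * S1 + Cpower (- x) (- b) * S2)).
  { unfold Phi1. apply CSeries_unique.
    eapply is_Cseries_ext; [|apply (is_Cseries_scal (/ rGamma c) _ _ (is_Cseries_plus _ _ _ _
      (is_Cseries_scal (Cpower (- x) (- a)) _ _ HS1) (is_Cseries_scal (Cpower (- x) (- b)) _ _ HS2)))].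
    intros n. cbv beta. symmetry. apply Hs. }
  assert (W1 : Csum N (fun k => Csum (S (k / 2)) (fun n =>
        k1 * coef1 a b c eta n (k - 2 * n) * (/ x) ^ (k - 2 * n + 2 * n)))
      = k1 * Csum N (fun k => b1 a b c k eta / x ^ k)).
  { rewrite <- Csum_scal. apply Csum_ext. intros k _. unfold b1. rewrite Nat.div2_div.
    match goal with |- _ = k1 * (?S / _) =>
      replace (k1 * (S / x ^ k)) with (k1 * / x ^ k * S) by (unfold Cdiv; ring) end.
    rewrite <- Csum_scal.
    apply Csum_ext. intros n Hn.
    assert (Hk : (2 * n <= k)%nat).
    { assert (2 * (k / 2) <= k)%nat by apply Nat.Div0.mul_div_le. lia. }
    replace (k - 2 * n + 2 * n)%nat with k by lia.
    rewrite Cpow_inv by exact Nx. unfold coef1. cbv zeta. ring. }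
  assert (W2 : Csum N (fun k => Csum (S (k / 1)) (fun n =>
        k2 * coef2 a b c eta n (k - 1 * n) * (/ x) ^ (k - 1 * n + 1 * n)))
      = k2 * Csum N (fun k => rGamma_b2 a b c k eta / x ^ k)).
  { rewrite <- Csum_scal. apply Csum_ext. intros k _. unfold rGamma_b2. rewrite Nat.div_1_r.
    match goal with |- _ = k2 * (?S / _) =>
      replace (k2 * (S / x ^ k)) with (k2 * / x ^ k * S) by (unfold Cdiv; ring) end.
    rewrite <- Csum_scal.
    apply Csum_ext. intros n Hn. rewrite Nat.mul_1_l.
    replace (k - n + n)%nat with k by lia.
    rewrite Cpow_inv by exact Nx. unfold coef2. cbv zeta. ring. }
  rewrite W1 in R1. rewrite W2 in R2.
  set (D1 := Csum N (fun k => b1 a b c k eta / x ^ k)) in *.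
  set (D2 := Csum N (fun k => rGamma_b2 a b c k eta / x ^ k)) in *.
  assert (Nab := rGamma_nonint _ hab). assert (Nba := rGamma_nonint _ (nonint_sym a b hab)).
  rewrite EP. unfold Gamma.
  replace (/ rGamma c * (Cpower (- x) (- a) * S1 + Cpower (- x) (- b) * S2)
     - (/ rGamma c * / rGamma (b - a) * rGamma b * rGamma (c - a) * Cpower (- x) (- a) * D1
        + / rGamma c * / rGamma (a - b) * rGamma a * Cpower (- x) (- b) * D2))
    with (/ rGamma c * Cpower (- x) (- a) * (S1 - k1 * D1)
          + / rGamma c * Cpower (- x) (- b) * (S2 - k2 * D2)) by (unfold k1, k2; field; auto).
  assert (Qn : ((2 * q) ^ N = AN * / Cmod x ^ N)%R).
  { unfold AN, q, Rdiv. rewrite <- pow_inv, <- Rpow_mult_distr. f_equal. ring. }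
  assert (RP : forall r, (Rpower (Cmod x) (- r) * / Cmod x ^ N = Rpower (Cmod x) (- r - INR N))%R).
  { intros r. unfold Rminus. rewrite Rpower_plus, Rpower_Ropp, Rpower_Ropp, Rpower_pow by lra.
    reflexivity. }
  assert (Piece : forall w k M ew S0 D0, 0 <= M -> ew = exp (Rabs (Im (- w)) * PI) ->
    (Cmod (S0 - k * D0) <= 4 * (Cmod k * M) * (2 * q) ^ N) ->
    (Cmod (/ rGamma c * Cpower (- x) (- w) * (S0 - k * D0))
      <= Cmod (/ rGamma c * k) * (4 * M) * AN * ew * Rpower (Cmod x) (- Re w - INR N))).
  { intros w k M ew S0 D0 HM -> Hb. rewrite !Cmod_mult, <- RP.
    assert (Pw := Cmod_Cpower_bound (- x) (- w) NX). rewrite Cmod_opp in Pw.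
    change (Re (- w)) with (- Re w)%R in Pw.
    rewrite Qn in Hb.
    eapply Rle_trans.
    - apply Rmult_le_compat; [apply Rmult_le_pos; auto | auto | | exact Hb].
      apply Rmult_le_compat_l; [auto | exact Pw].
    - right. ring. }
  assert (Q1 := Piece a k1 M1 e1 S1 D1 ltac:(lra) eq_refl R1).
  assert (Q2 := Piece b k2 M2 e2 S2 D2 ltac:(lra) eq_refl R2).
  fold K1 in Q1. fold K2 in Q2.
  assert (R1p : 0 < Rpower (Cmod x) (- Re a - INR N)) by apply exp_pos.
  assert (R2p : 0 < Rpower (Cmod x) (- Re b - INR N)) by apply exp_pos.
  eapply Rle_trans; [apply Cmod_triangle|]. nra.
Qed.
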